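(* Let $p_1,p_2,q_1,q_2\in\mathbb{R}$ satisfy $|p_1|<|p_2|$, $|q_1|<|q_2|$ and $p_2^2+q_2^2<1$. Let $\delta_1,\delta_2,\varepsilon_1,\varepsilon_2\in\{-1,1\}$, $\theta\in[\arcsin|q_2|,\arccos|p_2|]$, and consider the octahedron in $\mathbb{S}^3$ with vertices $$\begin{aligned} \mathbf{a}_1&=\Bigl(\tfrac{p_1}{\cos\theta},\delta_1\sqrt{1-\tfrac{p_1^2}{\cos^2\theta}},0,0\Bigr),& \mathbf{b}_1&=\Bigl(\tfrac{p_2}{\cos\theta},\delta_2\sqrt{1-\tfrac{p_2^2}{\cos^2\theta}},0,0\Bigr),\\ \mathbf{a}_2&=\Bigl(0,0,\tfrac{q_1}{\sin\theta},\varepsilon_1\sqrt{1-\tfrac{q_1^2}{\sin^2\theta}}\Bigr),& \mathbf{b}_2&=\Bigl(0,0,\tfrac{q_2}{\sin\theta},\varepsilon_2\sqrt{1-\tfrac{q_2^2}{\sin^2\theta}}\Bigr),\\ \mathbf{a}_3&=(\cos\theta,0,\sin\theta,0),&\mathbf{b}_3&=(\cos\theta,0,-\sin\theta,0). \end{aligned}$$ Put $y=\langle\mathbf{a}_1,\mathbf{b}_1\rangle$ and $r_j=(1-q_j^2)^{-1/2}$ for $j=1,2$. Then the oriented volume $\mathcal{V}\in\mathbb{R}/2\pi^2\mathbb{Z}$ of this octahedron is given by $$\mathcal{V}=-\frac{\delta_1\operatorname{sgn}(p_2)\,\pi}{2}\bigl(\varepsilon_1A_1(y)-\varepsilon_2A_2(y)\bigr)\pmod{2\pi^2\mathbb{Z}},$$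 where $$A_j(y)=\arccos\frac{r_j(p_1-p_2y)}{\sqrt{(1-r_j^2p_2^2)(1-y^2)}}+\arccos\frac{r_j(p_2-p_1y)}{\sqrt{(1-r_j^2p_1^2)(1-y^2)}}+\arccos\frac{y-r_j^2p_1p_2}{\sqrt{(1-r_j^2p_1^2)(1-r_j^2p_2^2)}}-\pi.$$ Moreover, with $$y_{\max,\min}=\frac{p_1p_2\pm\sqrt{(1-q_2^2-p_1^2)(1-q_2^2-p_2^2)}}{1-q_2^2}$$ (sign $+$ for $y_{\max}$, sign $-$ for $y_{\min}$), one has $0<A_1(y)<2\pi$ for all $y\in[y_{\min},y_{\max}]$, $0<A_2(y)<2\pi$ for all $y\in(y_{\min},y_{\max})$, and $A_2(y_{\min})=A_2(y_{\max})=0$.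
   Context: $\mathbb{S}^3$ is the unit sphere centered at the origin in Euclidean space $\mathbb{E}^4$ with scalar product $\langle\cdot,\cdot\rangle$. An octahedron with vertices $\mathbf{a}_1,\mathbf{a}_2,\mathbf{a}_3,\mathbf{b}_1,\mathbf{b}_2,\mathbf{b}_3$ has as edges all pairs of vertices except $\{\mathbf{a}_i,\mathbf{b}_i\}$ and 8 triangular faces $\mathbf{u}_1\mathbf{u}_2\mathbf{u}_3$, $\mathbf{u}_i\in\{\mathbf{a}_i,\mathbf{b}_i\}$; it is oriented so that the face $\mathbf{a}_1\mathbf{a}_2\mathbf{a}_3$, with this order of vertices, is positively oriented. For a spherical tetrahedron with linearly independent vertices, $V_{\mathrm{or}}(\mathbf{c}_1,\mathbf{c}_2,\mathbf{c}_3,\mathbf{c}_4)=\operatorname{sgn}\det(\mathbf{c}_1,\mathbf{c}_2,\mathbf{c}_3,\mathbf{c}_4)$ times its volume. The (generalized) oriented volume of the octahedron is the sum $\sum V_{\mathrm{or}}(\mathbf{o},\mathbf{v}_0,\mathbf{v}_1,\mathbf{v}_2)$ over all positively oriented faces $\mathbf{v}_0\mathbf{v}_1\mathbf{v}_2$, i.e. $\sum_{\mathbf{u}_i\in\{\mathbf{a}_i,\mathbf{b}_i\}}(-1)^{\#\{i:\mathbf{u}_i=\mathbf{b}_i\}}V_{\mathrm{or}}(\mathbf{o},\mathbf{u}_1,\mathbf{u}_2,\mathbf{u}_3)$, where $\mathbf{o}\in\mathbb{S}^3$ is any point for which all these tetrahedra are non-degenerate; it is well defined as an element of $\mathbb{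R}/2\pi^2\mathbb{Z}$.
   Formalization: The claim A_2(y_min)=0 is false when p_2<0 (e.g. p_1=0, p_2=-12/25, q_2=3/5 gives 2π); the formal statement asserts A_2(y_min)=0 for p_2>0 and A_2(y_min)=2π for p_2<0, with everything else unchanged. *)

(* Defs.v *)
From mathcomp Require Import all_boot all_order all_algebra.
From mathcomp Require Import all_classical all_reals all_analysis.

Set Implicit Arguments.
Unset Strict Implicit.
Unset Printing Implicit Defensive.

Import Order.TTheory GRing.Theory Num.Theory.

Local Open Scope classical_set_scope.
Local Open Scope ring_scope.

Definition vec4 (R : realType) (x0 x1 x2 x3 : R) : 'rV[R]_4 :=
  \row_(i < 4) nth 0 [:: x0; x1; x2; x3] i.

Definition dotv (R : realType) (u v : 'rV[R]_4) : R :=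
  \sum_(i < 4) u 0 i * v 0 i.

Definition sphere3 (R : realType) : set 'rV[R]_4 := [set u | dotv u u = 1].

(* Lebesgue measure on R^4, realised on the product type since MathComp-Analysis
   does not equip 'rV[R]_4 with a measure. *)
Definition lebesgue4 (R : realType) :=
  (@lebesgue_measure R \x
    (@lebesgue_measure R \x (@lebesgue_measure R \x @lebesgue_measure R)))%E.

Definition unit_cone (R : realType) (X : set 'rV[R]_4) :
    set (R * (R * (R * R))) :=
  [set x | exists t : R, exists u : 'rV[R]_4,
     [/\ 0 <= t <= 1, X u & vec4 x.1 x.2.1 x.2.2.1 x.2.2.2 = t *: u]].

(* The volume of X in the unit 3-sphere is 4 times the Lebesgue measure of the
   cone [0,1].X over X; with this normalisation the whole sphere has volume
   2 pi^2. *)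
Definition sphere_volume (R : realType) (X : set 'rV[R]_4) : \bar R :=
  (4%:R%:E * lebesgue4 (unit_cone X))%E.

(* The vertices of a tetrahedron are the rows of C. *)
Definition sphere_tetrahedron (R : realType) (C : 'M[R]_4) : set 'rV[R]_4 :=
  [set u | sphere3 u /\
     exists w : 'rV[R]_4, (forall i, 0 <= w 0 i) /\ u = w *m C].

Definition tetrahedron_orvol (R : realType) (C : 'M[R]_4) : R :=
  Num.sg (\det C) * fine (sphere_volume (sphere_tetrahedron C)).

Definition triple (T : Type) (x0 x1 x2 : T) : 'I_3 -> T :=
  fun i => nth x0 [:: x0; x1; x2] i.

(* An octahedron is given by its vertices a_i, b_i (i : 'I_3), a_i opposite to
   b_i. The face indexed by s has as i-th vertex b_i if i \in s and a_i
   otherwise; the matrix below has rows o, u_1, u_2, u_3, the u_i being the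
   vertices of that face. *)
Definition face_cone (R : realType) (a b : 'I_3 -> 'rV[R]_4) (o : 'rV[R]_4)
    (s : {set 'I_3}) : 'M[R]_4 :=
  col_mx o (\matrix_(i < 3) (if i \in s then b i else a i)).

Definition generic_apex (R : realType) (a b : 'I_3 -> 'rV[R]_4)
    (o : 'rV[R]_4) : Prop :=
  sphere3 o /\ forall s : {set 'I_3}, \det (face_cone a b o s) != 0.

Definition octahedron_orvol_from (R : realType) (a b : 'I_3 -> 'rV[R]_4)
    (o : 'rV[R]_4) : R :=
  \sum_(s : {set 'I_3}) (-1) ^+ #|s| * tetrahedron_orvol (face_cone a b o s).

Definition eq_mod_2pi2 (R : realType) (x y : R) : Prop :=
  exists k : int, x - y = k%:~R * (2 * pi ^+ 2).

(* V represents the oriented volume, an element of R / 2 pi^2 Z: admissible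
   apexes o exist, and each of them yields the class of V. *)
Definition is_octahedron_orvol (R : realType) (a b : 'I_3 -> 'rV[R]_4)
    (V : R) : Prop :=
  (exists o, generic_apex a b o) /\
  (forall o, generic_apex a b o -> eq_mod_2pi2 (octahedron_orvol_from a b o) V).

Definition rcoef (R : realType) (q : R) : R := (Num.sqrt (1 - q ^+ 2))^-1.

Definition Afun (R : realType) (p1 p2 q y : R) : R :=
  let r := rcoef q in
  acos (r * (p1 - p2 * y)
        / Num.sqrt ((1 - r ^+ 2 * p2 ^+ 2) * (1 - y ^+ 2)))
  + acos (r * (p2 - p1 * y)
          / Num.sqrt ((1 - r ^+ 2 * p1 ^+ 2) * (1 - y ^+ 2)))
  + acos ((y - r ^+ 2 * p1 * p2)
          / Num.sqrt ((1 - r ^+ 2 * p1 ^+ 2) * (1 - r ^+ 2 * p2 ^+ 2)))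
  - pi.

Definition ymax (R : realType) (p1 p2 q2 : R) : R :=
  (p1 * p2 + Num.sqrt ((1 - q2 ^+ 2 - p1 ^+ 2) * (1 - q2 ^+ 2 - p2 ^+ 2)))
  / (1 - q2 ^+ 2).

Definition ymin (R : realType) (p1 p2 q2 : R) : R :=
  (p1 * p2 - Num.sqrt ((1 - q2 ^+ 2 - p1 ^+ 2) * (1 - q2 ^+ 2 - p2 ^+ 2)))
  / (1 - q2 ^+ 2).

(* Main.v *)
(* Take u = a2 or u = b2. The half-turn about the plane of a1 and b1 exchanges
   a3 with b3 and u with - u, so the tetrahedra a1 b1 u a3 and a1 b1 u b3 together
   have the volume of a lune: the suspension, with poles u and - u, of a spherical
   triangle with sides y, r p1, r p2 (given by their cosines). By Girard's
   theorem that triangle has area A_j, and the lune has volume pi A_j / 2.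

   That the sum over the faces agrees modulo 2 pi^2 with the sum over these four
   tetrahedra is the cocycle relation for five points: moving along the linear
   relation between five vectors of R^4, one sees that the tetrahedra of either
   sign tile the same region, unless all signs agree and the tetrahedra tile the
   whole sphere. When theta = arcsin |q2| the points a1, b1, b2, a3, b3 lie on a
   great sphere; there four of them may surround that sphere, the tetrahedra with
   apex o then fill a half-sphere, and this matches A_2 = 2 pi.

   A region of the sphere is measured by the Lebesgue measure of the cone over it
   in the unit ball of R^4; besides the volume of the ball, this uses only the
   invariance under rotations. *)
Require Import Defs.
From HB Require Import structures.
From mathcomp Require Import all_boot all_order all_algebra.
From mathcomp Require Import all_classical all_reals all_analysis.
From mathcomp Require Import measurable_realfun.
From mathcomp Require Import ring lra.

Set Implicit Arguments.
Unset Strict Implicit.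
Unset Printing Implicit Defensive.

Import Order.TTheory GRing.Theory Num.Theory.
Import numFieldNormedType.Exports.

Local Open Scope classical_set_scope.
Local Open Scope ring_scope.

(** The prefactor -δ1 sgn(p2) is the sign of [D], the determinant of a1 and b1 in their plane: since
    |p1| < |p2|, neither δ2 nor theta can change it. The sign of A_j comes from the last coordinate
    of a2 or b2, which is how ε_j enters. An admissible apex o is generic with respect to the faces
    only, whereas tetrahedra around the diagonal a1 b1 involve det(o, a1, b1, u), which may vanish.
    The cocycle relation is therefore used twice: once to replace o by an apex avoiding these
    hyperplanes as well, once to cut along the diagonal. In the flat position the discrepancy is π²
    or -π², the same class modulo 2π², so the side on which the half-sphere lies need not be
    tracked. At y_min the value of A_2 depends on the sign of p2: it is 0 for p2 > 0 and 2π for p2 <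
    0, the case in which the half-sphere occurs. No wedge is integrated: its volume is additive in
    the angle and nonnegative, hence linear. Rotation invariance itself reduces to translations of
    the line, by Fubini applied to shears. *)

Lemma ltr_sqr_norm (R : realDomainType) (x y : R) :
  `|x| < `|y| -> x ^+ 2 < y ^+ 2.
Proof.
by move=> xy; rewrite -(real_normK (num_real x)) -(real_normK (num_real y)) ltr_sqr ?nnegrE.
Qed.

(** * Rotations preserve Lebesgue measure *)

Definition preserving d (T : measurableType d) (R : realType)
    (mu : set T -> \bar R) (f : T -> T) : Prop :=
  measurable_fun setT f /\ forall A, measurable A -> mu (f @^-1` A) = mu A.

Lemma preserving_comp d (T : measurableType d) (R : realType)
    (mu : set T -> \bar R) (f g : T -> T) :
  preserving mu f -> preserving mu g -> preserving mu (f \o g).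
Proof.
move=> [mf pf] [mg pg]; split; first exact: measurableT_comp.
move=> A mA; rewrite comp_preimage pg ?pf//.
by rewrite -[X in measurable X]setTI; exact: mf.
Qed.

(** Uniqueness of Lebesgue measure: the pushforward has the right values on half-open intervals. *)
Lemma preserving_translate (R : realType) (a : R) :
  preserving (@lebesgue_measure R) (fun x => x + a).
Proof.
have mf : measurable_fun setT (fun x : measurableTypeR R => x + a : measurableTypeR R).
  exact: measurable_funD.
split => // A mA.
rewrite -[LHS]/(pushforward lebesgue_measure
  ((fun x => x + a) : measurableTypeR R -> measurableTypeR R) A).
apply/esym; apply: lebesgue_measure_unique => //= _ [[b c]] _ <-.
rewrite /pushforward.
rewrite (_ : _ @^-1` _ = `]b - a, c - a]%classic); last first.
  by apply/seteqP; split => x /=; rewrite !in_itv/= ltrBlDr lerBrDr.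
rewrite /= !lebesgue_measure_itv/= !lte_fin ltrD2r.
by case: ifP => // _; rewrite -!EFinB; congr EFin; ring.
Qed.

Section product_sigma_finite.
Context d1 d2 (T1 : measurableType d1) (T2 : measurableType d2) (R : realType).
Variable m1 : {sigma_finite_measure set T1 -> \bar R}.
Variable m2 : {sigma_finite_measure set T2 -> \bar R}.
Local Open Scope ereal_scope.

Lemma product_measure_sigma_finite : sigma_finite setT (m1 \x m2).
Proof.
have /sigma_finiteP[F [TF ndF Foo]] := sigma_finiteT m1.
have /sigma_finiteP[G [TG ndG Goo]] := sigma_finiteT m2.
exists (fun n => F n `*` G n).
  apply/seteqP; split => // -[x y] _.
  have [i _ Fx] : (\bigcup_i F i) x by rewrite -TF.
  have [j _ Gy] : (\bigcup_i G i) y by rewrite -TG.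
  (* Both exhausting sequences increase, so the larger index serves for both coordinates. *)
  exists (maxn i j) => //; split => /=.
    by move: x Fx; exact/subsetPset/ndF/leq_maxl.
  by move: y Gy; exact/subsetPset/ndG/leq_maxr.
move=> k; have [? ?] := Foo k; have [? ?] := Goo k.
split; first exact: measurableX.
by rewrite product_measure1E// lte_mul_pinfty// ge0_fin_numE.
Qed.

(* An alias: the library infers a sigma-finite measure structure on a product
   measure only when the factors are subprobabilities. *)
Definition sprod : set (T1 * T2) -> \bar R := m1 \x m2.

HB.instance Definition _ := Measure.copy sprod (m1 \x m2).
HB.instance Definition _ := Measure_isSigmaFinite.Build _ _ _ sprod
  product_measure_sigma_finite.
End product_sigma_finite.

Section product.
Context d1 d2 (T1 : measurableType d1) (T2 : measurableType d2) (R : realType).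
Variable m1 : {sigma_finite_measure set T1 -> \bar R}.
Variable m2 : {sigma_finite_measure set T2 -> \bar R}.
Local Open Scope ereal_scope.

(** The two iterated integrals agree on rectangles, hence on all measurable sets. This makes shears
    along the first coordinate as accessible as those along the second. *)
Lemma product_measure12 (A : set (T1 * T2)) : measurable A ->
  (m1 \x m2) A = (m1 \x^ m2) A.
Proof.
by move=> mA; apply: product_measure_unique => // X Y mX mY; exact: product_measure2E.
Qed.

(** Cavalieri's principle: each slice over [x] is moved by the measure-preserving [g x]. A shear is
    the case where [g x] is a translation. *)
Lemma preserving_xsection (f : T1 * T2 -> T1 * T2) (g : T1 -> T2 -> T2) :
  measurable_fun setT f -> (forall x, preserving m2 (g x)) ->
  (forall x y, f (x, y) = (x, g x y)) -> preserving (m1 \x m2) f.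
Proof.
move=> mf gp fE; split => // A mA; apply: eq_integral => x _ /=.
rewrite -(proj2 (gp x) (xsection A x)); last exact: measurable_xsection.
by congr (m2 _); apply/seteqP; split => y; rewrite /xsection/= !inE /= fE.
Qed.

Lemma preserving_ysection (f : T1 * T2 -> T1 * T2) (g : T2 -> T1 -> T1) :
  measurable_fun setT f -> (forall x, preserving m1 (g x)) ->
  (forall x y, f (x, y) = (g y x, y)) -> preserving (m1 \x m2) f.
Proof.
move=> mf gp fE; split => // A mA.
rewrite !product_measure12//; last first.
  by rewrite -[X in measurable X]setTI; exact: mf.
apply: eq_integral => x _ /=.
rewrite -(proj2 (gp x) (ysection A x)); last exact: measurable_ysection.
by congr (m1 _); apply/seteqP; split => y; rewrite /ysection/= !inE /= fE.
Qed.
End product.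

Section rotation.
Context d (T : measurableType d) (R : realType).
Variable m : {sigma_finite_measure set T -> \bar R}.
Notation L := (@lebesgue_measure R).
Notation RT := (measurableTypeR R).

(* A rotation is a product of three shears, sh1 and sh2 being the shears along
   the two axes. *)
Lemma preserving_rotation_aux d' (U : measurableType d') (mu : set U -> \bar R)
    (sh1 sh2 : R -> U -> U) (rot : R -> R -> U -> U) :
  (forall a, preserving mu (sh1 a)) -> (forall a, preserving mu (sh2 a)) ->
  (forall c s, c ^+ 2 + s ^+ 2 = 1 -> s != 0 ->
     rot c s = sh1 ((c - 1) / s) \o (sh2 s \o sh1 ((c - 1) / s))) ->
  (rot 1 0 = id) -> (rot (-1) 0 = rot 0 1 \o rot 0 1) ->
  forall c s, c ^+ 2 + s ^+ 2 = 1 -> preserving mu (rot c s).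
Proof.
move=> p1 p2 rotE rot1 rotN1.
have H c s : c ^+ 2 + s ^+ 2 = 1 -> s != 0 -> preserving mu (rot c s).
  by move=> cs s0; rewrite rotE//; do 2!apply: preserving_comp => //.
(* The shear factor [(c - 1) / s] requires [s != 0]. What is left is the identity and the half-turn,
   which is the square of a quarter-turn. *)
move=> c s cs; have [s0|] := eqVneq s 0; last exact: H.
have /eqP : c ^+ 2 = 1 by rewrite -cs s0; ring.
rewrite sqrf_eq1 s0 => /orP[] /eqP ->; last first.
  by rewrite rotN1; apply: preserving_comp; apply: H; rewrite ?oner_eq0//; ring.
by rewrite rot1; split => // A _; rewrite preimage_id.
Qed.

(** For an angle φ with cosine [c] and sine [s], the quotient [(c - 1) / s] is -tan(φ/2); these are
    the half-angle identities that verify the matrix product of the three shears. *)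
Lemma rot_coefE (c s : R) : c ^+ 2 + s ^+ 2 = 1 -> s != 0 ->
  (c - 1) / s * s = c - 1 /\ (c - 1) / s * c = - s - (c - 1) / s.
Proof.
move=> cs s0; split; first by rewrite divfK.
have h : (c - 1) / s * s = c - 1 by rewrite divfK.
move: (_ / s) h => a h; apply: (mulIf s0).
rewrite mulrBl mulrAC h mulNr -expr2 (_ : s ^+ 2 = 1 - c ^+ 2); first by ring.
by rewrite -cs; ring.
Qed.

Definition rot2 (c s : R) (z : RT * RT) : RT * RT :=
  (c * z.1 - s * z.2, s * z.1 + c * z.2).

Lemma preserving_rot2 (c s : R) : c ^+ 2 + s ^+ 2 = 1 ->
  preserving (L \x L)%E (rot2 c s).
Proof.
apply: (@preserving_rotation_aux _ (RT * RT)%type (L \x L)%E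
  (fun a z => (z.1 + a * z.2, z.2)) (fun a z => (z.1, z.2 + a * z.1)) rot2).
- move=> a; apply: (@preserving_ysection _ _ _ _ _ L L _ (fun y x => x + a * y)) => //.
    apply/measurable_fun_pairP; split => /=; last exact: measurable_snd.
    apply: measurable_funD; first exact: measurable_fst.
    by apply: measurable_funM => //; exact: measurable_snd.
  by move=> x; exact: preserving_translate.
- move=> a; apply: (@preserving_xsection _ _ _ _ _ L L _ (fun x y => y + a * x)) => //.
    apply/measurable_fun_pairP; split => /=; first exact: measurable_fst.
    apply: measurable_funD; first exact: measurable_snd.
    by apply: measurable_funM => //; exact: measurable_fst.
  by move=> x; exact: preserving_translate.
- move=> {}c {}s cs s0; apply/funext => -[x y] /=; rewrite /rot2 /=.
  have [as1 ac] := rot_coefE cs s0; move: (_ / s) as1 ac => a as1 ac.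
  congr pair; last by transitivity (y + (a * s) * y + s * x); [rewrite as1; ring|ring].
  transitivity (x + (a * s) * x + (a + a + (a * s) * a) * y); last by ring.
  have -> : a + a + (a * s) * a = - s by rewrite as1 -[RHS](subrK a) -ac; ring.
  by rewrite as1; ring.
- by apply/funext => -[x y]; rewrite /rot2/=; congr pair; ring.
- by apply/funext => -[x y]; rewrite /rot2/=; congr pair; ring.
Qed.

(** The spectator factor [T] is arbitrary so that one map gives both [rot01], where [T] is a plane,
    and [rot12], where [T] is a line. *)
Definition rot3 (c s : R) (z : RT * (RT * T)) : RT * (RT * T) :=
  (c * z.1 - s * z.2.1, (s * z.1 + c * z.2.1, z.2.2)).

Lemma preserving_rot3 (c s : R) : c ^+ 2 + s ^+ 2 = 1 ->
  preserving (L \x (L \x m))%E (rot3 c s).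
Proof.
have m21 : measurable_fun setT (fun z : RT * (RT * T) => z.2.1).
  exact: measurableT_comp measurable_fst measurable_snd.
have m22 : measurable_fun setT (fun z : RT * (RT * T) => z.2.2).
  exact: measurableT_comp measurable_snd measurable_snd.
apply: (@preserving_rotation_aux _ (RT * (RT * T))%type (L \x (L \x m))%E
  (fun a z => (z.1 + a * z.2.1, z.2))
  (fun a z => (z.1, (z.2.1 + a * z.1, z.2.2))) rot3).
- move=> a.
  apply: (@preserving_ysection _ _ _ _ _ L (sprod L m) _ (fun y x => x + a * y.1)) => //.
    apply/measurable_fun_pairP; split => /=; last exact: measurable_snd.
    apply: measurable_funD; first exact: measurable_fst.
    exact: measurable_funM.
  by move=> x; exact: preserving_translate.
- move=> a.
  apply: (@preserving_xsection _ _ _ _ _ L (sprod L m) _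
    (fun x y => (y.1 + a * x, y.2))) => //.
    apply/measurable_fun_pairP; split => /=; first exact: measurable_fst.
    apply/measurable_fun_pairP; split => //=.
    apply: measurable_funD => //.
    by apply: measurable_funM => //; exact: measurable_fst.
  move=> x.
  apply: (@preserving_ysection _ _ _ _ _ L m _ (fun z y => y + a * x)) => //.
    apply/measurable_fun_pairP; split => /=; last exact: measurable_snd.
    by apply: measurable_funD => //; exact: measurable_fst.
  by move=> y; exact: preserving_translate.
- move=> {}c {}s cs s0; apply/funext => -[x [y z]] /=; rewrite /rot3 /=.
  have [as1 ac] := rot_coefE cs s0; move: (_ / s) as1 ac => a as1 ac.
  congr pair; last first.
    by congr pair; transitivity (y + (a * s) * y + s * x); [rewrite as1; ring|ring].
  transitivity (x + (a * s) * x + (a + a + (a * s) * a) * y); last by ring.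
  have -> : a + a + (a * s) * a = - s by rewrite as1 -[RHS](subrK a) -ac; ring.
  by rewrite as1; ring.
- by apply/funext => -[x [y z]]; rewrite /rot3/=; congr pair; [ring|congr pair; ring].
- by apply/funext => -[x [y z]]; rewrite /rot3/=; congr pair; [ring|congr pair; ring].
Qed.

Lemma preserving_snd (f : T -> T) : preserving m f ->
  preserving (L \x m)%E (fun z : RT * T => (z.1, f z.2)).
Proof.
move=> mf; apply: (@preserving_xsection _ _ _ _ _ L m _ (fun _ => f)) => //.
apply/measurable_fun_pairP; split => /=; first exact: measurable_fst.
exact: measurableT_comp (proj1 mf) measurable_snd.
Qed.

End rotation.

(** * Isometries of R^4 and normal forms of one or two vectors *)

Notation V4 R := (measurableTypeR R * (measurableTypeR R *
  (measurableTypeR R * measurableTypeR R)))%type.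

Section R4.
Variable R : realType.
Notation L := (@lebesgue_measure R).
Notation R4 := (V4 R).

Definition dot4 (n x : R4) : R :=
  n.1 * x.1 + n.2.1 * x.2.1 + n.2.2.1 * x.2.2.1 + n.2.2.2 * x.2.2.2.

(** Preserving [dot4] fixes the unit ball and pulls the half-space of normal [f n] back to that of
    normal [n]; together with the measure, this is what moving a configuration uses. *)
Definition isom4 (f : R4 -> R4) : Prop :=
  preserving (@lebesgue4 R) f /\ forall x y, dot4 (f x) (f y) = dot4 x y.

Lemma isom4_comp (f g : R4 -> R4) : isom4 f -> isom4 g -> isom4 (f \o g).
Proof.
move=> [pf df] [pg dg]; split; first exact: preserving_comp.
by move=> x y /=; rewrite df dg.
Qed.

Definition rot01 (c s : R) : R4 -> R4 := rot3 c s.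
Definition rot12 (c s : R) (x : R4) : R4 := (x.1, rot3 c s x.2).
Definition rot23 (c s : R) (x : R4) : R4 := (x.1, (x.2.1, rot2 c s x.2.2)).

Lemma isom4_rot01 (c s : R) : c ^+ 2 + s ^+ 2 = 1 -> isom4 (rot01 c s).
Proof.
move=> cs; split; first exact: (preserving_rot3 (sprod L L)).
move=> x y; rewrite /dot4/=.
transitivity ((c ^+ 2 + s ^+ 2) * (x.1 * y.1 + x.2.1 * y.2.1)
  + x.2.2.1 * y.2.2.1 + x.2.2.2 * y.2.2.2); first by ring.
by rewrite cs; ring.
Qed.

Lemma isom4_rot12 (c s : R) : c ^+ 2 + s ^+ 2 = 1 -> isom4 (rot12 c s).
Proof.
move=> cs; split.
  exact: (@preserving_snd _ _ _ (sprod L (sprod L L)) _ (preserving_rot3 L cs)).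
move=> x y; rewrite /dot4/=.
transitivity ((c ^+ 2 + s ^+ 2) * (x.2.1 * y.2.1 + x.2.2.1 * y.2.2.1)
  + x.1 * y.1 + x.2.2.2 * y.2.2.2); first by ring.
by rewrite cs; ring.
Qed.

Lemma isom4_rot23 (c s : R) : c ^+ 2 + s ^+ 2 = 1 -> isom4 (rot23 c s).
Proof.
move=> cs; split.
  apply: (@preserving_snd _ _ _ (sprod L (sprod L L)) (fun z => (z.1, rot2 c s z.2))).
  exact: (@preserving_snd _ _ _ (sprod L L) _ (preserving_rot2 cs)).
move=> x y; rewrite /dot4/=.
transitivity ((c ^+ 2 + s ^+ 2) * (x.2.2.1 * y.2.2.1 + x.2.2.2 * y.2.2.2)
  + x.1 * y.1 + x.2.1 * y.2.1); first by ring.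
by rewrite cs; ring.
Qed.

Lemma rotation_to_axis (x y : R) : exists c s : R,
  [/\ c ^+ 2 + s ^+ 2 = 1, s * x + c * y = 0 & 0 <= c * x - s * y].
Proof.
have [xy0|xy0] := eqVneq (x ^+ 2 + y ^+ 2) 0.
  move/eqP: xy0; rewrite paddr_eq0 ?sqr_ge0// !sqrf_eq0 => /andP[/eqP-> /eqP->].
  by exists 1, 0; split; [ring|ring|lra].
have p0 : 0 < x ^+ 2 + y ^+ 2 by rewrite lt_def xy0 addr_ge0 ?sqr_ge0.
set r := Num.sqrt (x ^+ 2 + y ^+ 2).
have r0 : 0 < r by rewrite sqrtr_gt0.
have r2 : r ^+ 2 = x ^+ 2 + y ^+ 2 by rewrite sqr_sqrtr// ltW.
exists (x / r), (- y / r); split.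
- rewrite !expr_div_n sqrrN -mulrDl -r2 divff//.
  by rewrite sqrf_eq0 gt_eqF.
- by field; rewrite gt_eqF.
- have -> : x / r * x - - y / r * y = (x ^+ 2 + y ^+ 2) / r by field; rewrite gt_eqF.
  by rewrite divr_ge0// ltW.
Qed.

(** Rotations in adjacent coordinate planes clear the coordinates from the last one backwards; each
    of them leaves the coordinates already cleared at zero. *)
Lemma isom4_reduce1 (n : R4) : exists f a,
  [/\ isom4 f, 0 <= a & f n = (a, (0, (0, 0)))].
Proof.
have [c1 [s1 [cs1 e1 _]]] := rotation_to_axis n.2.2.1 n.2.2.2.
have cs1' := isom4_rot23 cs1.
set n1 := rot23 c1 s1 n.
have [c2 [s2 [cs2 e2 _]]] := rotation_to_axis n1.2.1 n1.2.2.1.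
have cs2' := isom4_rot12 cs2.
set n2 := rot12 c2 s2 n1.
have [c3 [s3 [cs3 e3 p]]] := rotation_to_axis n2.1 n2.2.1.
have cs3' := isom4_rot01 cs3.
exists (rot01 c3 s3 \o (rot12 c2 s2 \o rot23 c1 s1)), (c3 * n2.1 - s3 * n2.2.1).
split; [exact (isom4_comp cs3' (isom4_comp cs2' cs1'))|exact: p|].
have -> : (rot01 c3 s3 \o (rot12 c2 s2 \o rot23 c1 s1)) n = rot01 c3 s3 n2 by [].
rewrite /rot01 /rot3 e3.
have -> : n2.2.2 = (s2 * n1.2.1 + c2 * n1.2.2.1, s1 * n.2.2.1 + c1 * n.2.2.2) by [].
by rewrite e2 e1.
Qed.

(** Once [n] lies on the first axis, two more rotations of the last three coordinates fix it and
    bring [m] into the plane of the first two. *)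
Lemma isom4_reduce2 (n m : R4) : exists f a b c,
  [/\ isom4 f, 0 <= a, c <= 0, f n = (a, (0, (0, 0))) & f m = (b, (c, (0, 0)))].
Proof.
have [f [a [fi a0 fn]]] := isom4_reduce1 n.
set m0 := f m.
have [c1 [s1 [cs1 e1 _]]] := rotation_to_axis m0.2.2.1 m0.2.2.2.
have cs1' := isom4_rot23 cs1.
set m1 := rot23 c1 s1 m0.
(* Negated, so that the remaining coordinate becomes nonpositive: the second normal is then a
   negative multiple of some [dir t] with [t] between 0 and [pi]. *)
have [c2 [s2 [cs2 e2 p2]]] := rotation_to_axis (- m1.2.1) (- m1.2.2.1).
have {}e2 : s2 * m1.2.1 + c2 * m1.2.2.1 = 0 by rewrite !mulrN in e2; lra.
have {}p2 : c2 * m1.2.1 - s2 * m1.2.2.1 <= 0 by rewrite !mulrN in p2; lra.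
have cs2' := isom4_rot12 cs2.
exists (rot12 c2 s2 \o (rot23 c1 s1 \o f)), a, m0.1, (c2 * m1.2.1 - s2 * m1.2.2.1).
split; [|exact: a0|exact: p2| |].
- exact (isom4_comp cs2' (isom4_comp cs1' fi)).
- rewrite -[LHS]/(rot12 c2 s2 (rot23 c1 s1 (f n))) fn /rot12 /rot23 /rot3 /rot2 /=.
  by rewrite !mulr0 !subr0 !addr0 !mulr0 addr0 subr0.
- rewrite -[LHS]/(rot12 c2 s2 m1) /rot12 /rot3 e2.
  have -> : m1.2.2.2 = s1 * m0.2.2.1 + c1 * m0.2.2.2 by [].
  by rewrite e1.
Qed.

End R4.

(** * The volume of the unit ball of R^4 *)

Lemma continuous_mulr (R : realType) (c : R) (g : R -> R) :
  continuous g -> continuous (fun x => c * g x).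
Proof. by move=> cg x; apply: continuousM; [exact: cst_continuous|exact: cg]. Qed.

Section ball_integrals.
Variable R : realType.
Notation L := (@lebesgue_measure R).

Lemma LRcontinuous_of_derivable (F : R -> R) (a b : R) :
  (forall x : R, derivable F x 1) -> derivable_oo_LRcontinuous F a b.
Proof.
move=> dF.
have cF : continuous F by move=> x; apply: differentiable_continuous; exact/derivable1_diffP.
split; first by move=> x _; exact: dF.
  exact: cvg_at_right_filter (cF a).
exact: cvg_at_left_filter (cF b).
Qed.

Lemma integral_is_derive (F f : R -> R) (a b : R) : a < b ->
  (forall x : R, is_derive x (1 : R) F (f x)) -> continuous f ->
  (\int[L]_(x in `[a, b]) (f x)%:E = (F b - F a)%:E)%E.
Proof.
move=> ab dF cf; rewrite EFinB; apply: continuous_FTC2 => //.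
- exact: continuous_subspaceT.
- by apply: LRcontinuous_of_derivable => x; have [] := dF x.
- by move=> x _; rewrite derive1E derive_val.
Qed.

(** The substitution x = r sin t turns sqrt(r² - x²), which is not derivable at the end points, into
    a cosine, whose powers have antiderivatives derivable on the whole line. *)
Lemma integral_sin_substitution (r : R) (G : R -> R) : 0 < r -> continuous G ->
  (\int[L]_(x in `[(- r)%R, r]) (G x)%:E =
   \int[L]_(t in `[(- (pi / 2))%R, (pi / 2)%R])
     (G (r * sin t) * (r * cos t))%R%:E)%E.
Proof.
move=> r0 cG; pose F (t : R) := r * sin t.
have dF (x : R) : is_derive x (1 : R) F (r * cos x).
  rewrite /F; apply: is_derive_eq.
  by [].
have dFE : derive1 F = (fun x => r * cos x).
  by apply/funext => x; rewrite derive1E derive_val.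
have cdF : continuous (derive1 F).
  rewrite dFE => x; apply: continuousM; first exact: cst_continuous.
  exact: continuous_cos.
have -> : `[- r, r]%classic = `[F (- (pi / 2)), F (pi / 2)]%classic :> set R.
  by rewrite /F sinN sin_pihalf mulrN mulr1.
rewrite (@integration_by_substitution_increasing R F G (- (pi / 2)) (pi / 2)) //.
- by apply: eq_integral => x _; rewrite dFE.
- by have := pi_ge0 R; lra.
- by move=> x y xi yi xy; rewrite /F ltr_pM2l// ltr_sin.
- by apply: cvgP; exact: cvg_at_right_filter (cdF _).
- by apply: cvgP; exact: cvg_at_left_filter (cdF _).
- by apply: LRcontinuous_of_derivable => x; have [] := dF x.
- exact: continuous_subspaceT.
Qed.

Lemma integral_sin_cos (f : R -> R) (F : R -> R) (r : R) (G : R -> R) :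
  0 < r -> continuous G -> continuous f ->
  (forall x : R, is_derive x (1 : R) F (f x)) ->
  (forall t, - (pi / 2) <= t <= pi / 2 -> G (r * sin t) * (r * cos t) = f t) ->
  (\int[L]_(x in `[(- r)%R, r]) (G x)%:E = (F (pi / 2) - F (- (pi / 2)))%:E)%E.
Proof.
move=> r0 cG cf dF GE; rewrite integral_sin_substitution//.
rewrite -(integral_is_derive _ dF cf); last by have := pi_gt0 R; lra.
by apply: eq_integral => t; rewrite inE/= in_itv/= => /GE ->.
Qed.

Lemma sqrt_sin (r t : R) : 0 <= r -> - (pi / 2) <= t <= pi / 2 ->
  Num.sqrt (r ^+ 2 - (r * sin t) ^+ 2) = r * cos t.
Proof.
move=> r0 tp.
rewrite (_ : _ - _ = (r * cos t) ^+ 2); last by rewrite !exprMn cos2sin2; ring.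
by rewrite sqrtr_sqr ger0_norm// mulr_ge0// cos_ge0_pihalf.
Qed.

Lemma continuous_sqrt_sub (r : R) : continuous (fun x : R => Num.sqrt (r - x ^+ 2)).
Proof.
move=> x; apply: (@continuous_comp _ _ _ (fun x : R => r - x ^+ 2) Num.sqrt).
  by apply: cvgB; [exact: cvg_cst|exact: exprn_continuous].
exact: sqrt_continuous.
Qed.

Lemma integral_half_disc (r : R) : 0 < r ->
  (\int[L]_(x in `[(- r)%R, r]) (2 * Num.sqrt (r ^+ 2 - x ^+ 2))%R%:E =
   (pi * r ^+ 2)%:E)%E.
Proof.
move=> r0.
pose f (t : R) := 2 * r ^+ 2 * cos t ^+ 2.
pose F (t : R) := r ^+ 2 * (t + sin t * cos t).
have dF (t : R) : is_derive t (1 : R) F (f t).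
  apply: is_derive_eq; rewrite /f /GRing.scale /=.
  by have := cos2Dsin2 t; nra.
have cf : continuous f.
  apply: (@continuous_mulr _ (2 * r ^+ 2) (fun t => cos t ^+ 2)) => x.
  apply: (@continuous_comp _ _ _ cos (fun x => x ^+ 2)); first exact: continuous_cos.
  exact: exprn_continuous.
pose G (x : R) := 2 * Num.sqrt (r ^+ 2 - x ^+ 2).
have cG : continuous G.
  apply: (@continuous_mulr _ 2 (fun x => Num.sqrt (r ^+ 2 - x ^+ 2))).
  exact: continuous_sqrt_sub.
have GE t : - (pi / 2) <= t <= pi / 2 -> G (r * sin t) * (r * cos t) = f t.
  by move=> tp; have h := sqrt_sin (ltW r0) tp; rewrite /G h /f; ring.
rewrite [LHS](integral_sin_cos r0 cG cf dF GE).
by congr EFin; rewrite /F sinN cosN sin_pihalf cos_pihalf; field.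
Qed.

Lemma integral_ball4 :
  (\int[L]_(x in `[(- 1)%R, 1%R]) (4 / 3 * pi * Num.sqrt (1 - x ^+ 2) ^+ 3)%R%:E =
   (pi ^+ 2 / 2)%:E)%E.
Proof.
pose f (t : R) := 4 / 3 * pi * cos t ^+ 4.
(* The bracket is 8 times an antiderivative of cos⁴, and [pi / 6] is [4 / 3 * pi] divided by 8. *)
pose F (t : R) := pi / 6 * (3 * t + 3 * (sin t * cos t) + 2 * (sin t * cos t ^+ 3)).
have dF (t : R) : is_derive t (1 : R) F (f t).
  apply: is_derive_eq; rewrite /f /GRing.scale /=.
  transitivity (pi / 6 * (3 - 3 * sin t ^+ 2 + 3 * cos t ^+ 2
    + 2 * (cos t ^+ 4 - 3 * cos t ^+ 2 * sin t ^+ 2))); first by ring.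
  by rewrite sin2cos2; field.
have cf : continuous f.
  apply: (@continuous_mulr _ (4 / 3 * pi) (fun t => cos t ^+ 4)) => x.
  apply: (@continuous_comp _ _ _ cos (fun x => x ^+ 4)); first exact: continuous_cos.
  exact: exprn_continuous.
pose G (x : R) := 4 / 3 * pi * Num.sqrt (1 - x ^+ 2) ^+ 3.
have cG : continuous G.
  apply: (@continuous_mulr _ (4 / 3 * pi) (fun x => Num.sqrt (1 - x ^+ 2) ^+ 3)) => x.
  apply: (@continuous_comp _ _ _ (fun x : R => Num.sqrt (1 - x ^+ 2)) (fun x => x ^+ 3)).
    exact: continuous_sqrt_sub.
  exact: exprn_continuous.
have GE t : - (pi / 2) <= t <= pi / 2 -> G (1 * sin t) * (1 * cos t) = f t.
  by move=> tp; have := sqrt_sin ler01 tp; rewrite expr1n /G /f => ->; ring.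
rewrite [LHS](integral_sin_cos ltr01 cG cf dF GE).
by congr EFin; rewrite /F sinN cosN sin_pihalf cos_pihalf; field.
Qed.

Lemma integral_disc_strip (r : R) : 0 < r ->
  (\int[L]_(x in `[(- r)%R, r]) (pi * (r ^+ 2 - x ^+ 2))%R%:E =
   (4 / 3 * pi * r ^+ 3)%:E)%E.
Proof.
move=> r0.
pose F (x : R) := pi * (r ^+ 2 * x - x ^+ 3 / 3).
pose f (x : R) := pi * (r ^+ 2 - x ^+ 2).
have dF (x : R) : is_derive x (1 : R) F (f x).
  by apply: is_derive_eq; rewrite /GRing.scale /f /=; field.
have cf : continuous f.
  apply: (@continuous_mulr _ pi (fun x => r ^+ 2 - x ^+ 2)) => x.
  by apply: cvgB; [exact: cvg_cst|exact: exprn_continuous].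
rewrite [LHS](integral_is_derive _ dF cf); first by congr EFin; rewrite /F; field.
by lra.
Qed.

End ball_integrals.

Section ball_volume.
Variable R : realType.
Notation L := (@lebesgue_measure R).

Lemma sqr_le_itv (s : R) : 0 <= s ->
  [set y : R | y ^+ 2 <= s] = `[- Num.sqrt s, Num.sqrt s]%classic.
Proof.
move=> s0; apply/seteqP; split => y /=; rewrite in_itv/= -ler_norml.
  by move=> ys; rewrite -(sqrtr_sqr y) ler_wsqrtr.
by move=> ys; rewrite -(sqr_sqrtr s0) -(real_normK (num_real y)) lerXn2r// nnegrE sqrtr_ge0.
Qed.

Lemma sqr_le_set0 (s : R) : s < 0 -> [set y : R | y ^+ 2 <= s] = set0.
Proof.
by move=> s0; rewrite -subset0 => y /= ys; have := sqr_ge0 y; lra.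
Qed.

(** For [s < 0] the set is empty and [Num.sqrt s] is 0 by convention. The formulas for balls are
    likewise valid for every [s], so that slices beyond the ball contribute 0 to an integral over
    the whole line. *)
Lemma lebesgue_sqr_le (s : R) :
  L [set y : R | y ^+ 2 <= s] = (2 * Num.sqrt s)%:E.
Proof.
have [s0|s0] := ltP s 0.
  by rewrite sqr_le_set0// measure0 ltr0_sqrtr// mulr0.
rewrite sqr_le_itv// lebesgue_measure_itv/= lte_fin.
have [h|h] := ltP (- Num.sqrt s) (Num.sqrt s).
  by rewrite -EFinD; congr EFin; ring.
have -> : Num.sqrt s = 0 by have := sqrtr_ge0 s; lra.
by rewrite mulr0.
Qed.

Lemma integral_slices (h : R -> \bar R) (s : R) :
  0 <= s -> (forall x, s < x ^+ 2 -> h x = 0%E) ->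
  (\int[L]_x h x = \int[L]_(x in `[(- Num.sqrt s)%R, Num.sqrt s]) h x)%E.
Proof.
move=> s0 h0; rewrite [RHS]integral_mkcond; apply: eq_integral => x _.
rewrite patchE -sqr_le_itv//; case: ifPn => //.
by rewrite notin_setE/= => /negP; rewrite -ltNge => /h0.
Qed.

Lemma lebesgue2_disc (s : R) :
  (L \x L)%E [set z : R * R | z.1 ^+ 2 + z.2 ^+ 2 <= s] =
  (pi * Num.sqrt s ^+ 2)%:E.
Proof.
transitivity (\int[L]_x (2 * Num.sqrt (s - x ^+ 2))%R%:E)%E.
  apply: eq_integral => x _ /=; rewrite -lebesgue_sqr_le; congr (L _).
  by apply/seteqP; split => y; rewrite /xsection/= inE/=; lra.
have [s0|s0] := leP s 0.
  rewrite ler0_sqrtr// expr0n/= mulr0 integral0_eq// => x _.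
  by rewrite ler0_sqrtr ?mulr0//; have := sqr_ge0 x; lra.
rewrite (@integral_slices _ s) ?ltW//.
  rewrite -integral_half_disc ?sqrtr_gt0//.
  by apply: eq_integral => x _; rewrite sqr_sqrtr// ltW.
by move=> x sx; rewrite ltr0_sqrtr ?mulr0//; lra.
Qed.

Lemma lebesgue3_ball (s : R) :
  (L \x (L \x L))%E
    [set z : R * (R * R) | z.1 ^+ 2 + (z.2.1 ^+ 2 + z.2.2 ^+ 2) <= s] =
  (4 / 3 * pi * Num.sqrt s ^+ 3)%:E.
Proof.
transitivity (\int[L]_x (pi * Num.sqrt (s - x ^+ 2) ^+ 2)%R%:E)%E.
  apply: eq_integral => x _ /=; rewrite -lebesgue2_disc; congr ((L \x L)%E _).
  by apply/seteqP; split => y; rewrite /xsection/= inE/=; lra.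
have [s0|s0] := leP s 0.
  rewrite ler0_sqrtr// expr0n/= mulr0 integral0_eq// => x _.
  by rewrite ler0_sqrtr ?expr0n ?mulr0//; have := sqr_ge0 x; lra.
rewrite (@integral_slices _ s) ?ltW//.
  rewrite -integral_disc_strip ?sqrtr_gt0//.
  apply: eq_integral => x; rewrite -sqr_le_itv ?ltW// inE/= => xs.
  by rewrite !sqr_sqrtr ?subr_ge0// ltW.
by move=> x sx; rewrite ltr0_sqrtr ?expr0n ?mulr0//; lra.
Qed.

Lemma lebesgue4_ball : lebesgue4 [set x : R * (R * (R * R)) | dot4 x x <= 1] =
   (pi ^+ 2 / 2)%:E.
Proof.
transitivity (\int[L]_x (4 / 3 * pi * Num.sqrt (1 - x ^+ 2) ^+ 3)%R%:E)%E.
  apply: eq_integral => x _ /=; rewrite -lebesgue3_ball; congr ((L \x (L \x L))%E _).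
  by apply/seteqP; split => y; rewrite /xsection/= inE/= /dot4/=; lra.
rewrite (@integral_slices _ 1)// ?sqrtr1 ?integral_ball4//.
by move=> x sx; rewrite ltr0_sqrtr ?expr0n ?mulr0//; lra.
Qed.

End ball_volume.

(** * Volumes of half-spaces and wedges *)

Lemma le_divn_eq0 (R : realType) (d M : R) :
  0 <= d -> (forall n, d <= M / n.+1%:R) -> d = 0.
Proof.
move=> d0 dM; apply/eqP; rewrite eq_le d0 andbT leNgt; apply/negP => dp.
have := dM (Num.truncn (M / d)).
rewrite ler_pdivlMr ?ltr0n// -ler_pdivlMl// mulrC leNgt => /negP; apply.
exact: truncnS_gt.
Qed.

Section additive_function.
Variables (R : realType) (T : R) (W : R -> R).
Hypothesis W0 : forall x, 0 <= W x.
Hypothesis WD : forall x y, 0 < x -> 0 < y -> x + y <= T -> W (x + y) = W x + W y.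

Let WM x n : 0 < x -> n.+1%:R * x <= T -> W (n.+1%:R * x) = n.+1%:R * W x.
Proof.
move=> x0; elim: n => [|n IH] nx; first by rewrite !mul1r.
have e y : n.+2%:R * y = n.+1%:R * y + y :> R by rewrite -[n.+2]addn1 natrD; ring.
rewrite !e in nx *; rewrite WD//; last by rewrite mulr_gt0// ltr0n.
by rewrite IH//; apply: le_trans nx; rewrite lerDl ltW.
Qed.

Let W_le x y : 0 < x -> x <= y -> y <= T -> W x <= W y.
Proof.
move=> x0; rewrite le_eqVlt => /predU1P[-> //|xy yT].
by have := @WD x (y - x); rewrite addrCA subrr addr0 => ->//; rewrite ?lerDl ?subr_gt0.
Qed.

(** Cauchy's functional equation: nonnegativity makes [W] monotone, so enclosing [x] between
    consecutive multiples of T/(n+1) determines [W x] up to an error of at most W(T)/(n+1). *)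
Lemma additive_nonneg_linear x : 0 < x <= T -> W x = W T / T * x.
Proof.
move=> /andP[x0 xT]; have T0 : 0 < T by exact: lt_le_trans xT.
have [->|xnT] := eqVneq x T; first by rewrite divfK// gt_eqF.
have {xnT} xT : x < T by rewrite lt_def eq_sym xnT.
apply/eqP; rewrite -subr_eq0 -normr_eq0; apply/eqP.
apply: (@le_divn_eq0 _ _ (W T)) => // n.
set N : R := n.+1%:R; have N0 : 0 < N by rewrite ltr0n.
have t0 : 0 < T / N by rewrite divr_gt0.
have NT : N * (T / N) = T by rewrite mulrC divfK// gt_eqF.
have WN : W (T / N) = W T / N.
  have := @WM (T / N) n t0; rewrite -/N NT => ->//.
  by field; rewrite gt_eqF.
set k := Num.truncn (x / (T / N)).
have /andP[k1 k2] : k%:R <= x / (T / N) < k.+1%:R.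
  by rewrite truncn_itv// divr_ge0// ltW.
rewrite ler_pdivlMr// in k1; rewrite ltr_pdivrMr// in k2.
have kn : (k.+1 <= n.+1)%N.
  rewrite ltnS leqNgt; apply/negP => nk.
  have : N * (T / N) <= k%:R * (T / N) by rewrite ler_pM2r// ler_nat.
  by rewrite NT => /le_trans /(_ k1); rewrite leNgt xT.
have kT : k.+1%:R * (T / N) <= T by rewrite -{2}NT ler_pM2r// ler_nat.
have up : W x <= k.+1%:R * (W T / N) by rewrite -WN -WM// W_le// ltW.
have lo : k%:R * (W T / N) <= W x.
  (* For [k = 0] additivity gives nothing, being assumed for positive arguments only; nonnegativity
     of [W] suffices. *)
  case: (k) k1 => [|j] k1; first by rewrite mul0r.
  rewrite -WN -WM//; first by rewrite W_le// ?ltW// mulr_gt0// ltr0n.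
  by apply: le_trans k1 _; exact: ltW.
have WT0 : 0 <= W T / N by rewrite divr_ge0// ltW.
have xe : W T / T * x = (x / (T / N)) * (W T / N) by field; rewrite !gt_eqF.
have q1 : k%:R <= x / (T / N) by rewrite ler_pdivlMr.
have q2 : x / (T / N) <= k.+1%:R by rewrite ltW// ltr_pdivrMr.
have e1 : k%:R * (W T / N) <= W T / T * x by rewrite xe ler_wpM2r.
have e2 : W T / T * x <= k.+1%:R * (W T / N) by rewrite xe ler_wpM2r.
have ks : k.+1%:R * (W T / N) = k%:R * (W T / N) + W T / N.
  by rewrite -addn1 natrD; ring.
rewrite ks in up e2.
rewrite ler_norml -/N.
move: (W x) (W T / N) (k%:R * (W T / N)) (W T / T * x) up lo e1 e2 => a b c d *.
by apply/andP; split; lra.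
Qed.
End additive_function.

Definition ball4 (R : realType) : set (V4 R) := [set x | dot4 x x <= 1].
Arguments ball4 {R}.

(* When X is a cone, this is the [sphere_volume] of its trace on the 3-sphere. *)
HB.lock Definition cone_volume (R : realType) (X : set (V4 R)) : R :=
  4 * fine (lebesgue4 (X `&` ball4)).

Section solid_volume.
Variable R : realType.
Notation L := (@lebesgue_measure R).
Notation RT := (measurableTypeR R).
Notation R4 := (V4 R).
Notation cvol := (@cone_volume R).
Notation m4 := (sprod L (sprod L (sprod L L))).

Lemma measurable_coordinates :
  [/\ measurable_fun setT (fun z : R4 => z.1),
      measurable_fun setT (fun z : R4 => z.2.1),
      measurable_fun setT (fun z : R4 => z.2.2.1) &
      measurable_fun setT (fun z : R4 => z.2.2.2)].
Proof.
have m22 : measurable_fun setT (fun z : R4 => z.2.2).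
  exact: measurableT_comp measurable_snd measurable_snd.
split; first exact: measurable_fst.
- exact: measurableT_comp measurable_fst measurable_snd.
- exact: measurableT_comp measurable_fst m22.
- exact: measurableT_comp measurable_snd m22.
Qed.

Lemma measurable_dot4 (n : R4) : measurable_fun setT (dot4 n).
Proof.
have [c1 c2 c3 c4] := measurable_coordinates.
by rewrite /dot4; do ?apply: measurable_funD; apply: measurable_funM.
Qed.

Lemma measurable_ball4 : measurable (ball4 : set R4).
Proof.
have [c1 c2 c3 c4] := measurable_coordinates.
have mf : measurable_fun setT (fun x : R4 => dot4 x x : RT).
  by rewrite /dot4; do ?apply: measurable_funD; apply: measurable_funM.
rewrite (_ : @ball4 R = (fun x : R4 => dot4 x x) @^-1` `]-oo, 1]%classic); last first.
  by apply/seteqP; split => x /=; rewrite in_itv/=.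
by rewrite -[X in measurable X]setTI; apply: mf => //; exact: measurable_itv.
Qed.

Definition halfspace (n : R4) : set R4 := [set x | 0 <= dot4 n x].
Definition hyperplane (n : R4) : set R4 := [set x | dot4 n x = 0].

Lemma measurable_halfspace (n : R4) : measurable (halfspace n).
Proof.
rewrite (_ : halfspace n = dot4 n @^-1` `[0, +oo[%classic); last first.
  by apply/seteqP; split => x /=; rewrite in_itv/= andbT.
by rewrite -[X in measurable X]setTI; exact: measurable_dot4.
Qed.

Lemma measurable_hyperplane (n : R4) : measurable (hyperplane n).
Proof.
rewrite (_ : hyperplane n = dot4 n @^-1` [set 0]); last by [].
by rewrite -[X in measurable X]setTI; exact: measurable_dot4.
Qed.

Let fin_m4 X : measurable X -> m4 (X `&` ball4) \is a fin_num.
Proof.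
move=> mX; rewrite ge0_fin_numE ?measure_ge0//.
apply: (@le_lt_trans _ _ (m4 ball4)).
  apply: le_measure; rewrite ?inE; last exact: subIsetr.
    by apply: measurableI => //; exact: measurable_ball4.
  exact: measurable_ball4.
by rewrite -[m4 _]/(lebesgue4 _) lebesgue4_ball ltry.
Qed.

Lemma cvolE X : cvol X = 4 * fine (m4 (X `&` ball4)).
Proof. by rewrite unlock. Qed.

Lemma fin_cone_ball X : measurable X ->
  sprod L (sprod L (sprod L L)) (X `&` ball4) \is a fin_num.
Proof. exact: fin_m4. Qed.

Lemma cvolT : cvol setT = 2 * pi ^+ 2.
Proof. by rewrite cvolE setTI -[m4 _]/(lebesgue4 _) lebesgue4_ball/=; field. Qed.

Lemma cvol_ge0 X : 0 <= cvol X.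
Proof. by rewrite cvolE mulr_ge0// fine_ge0. Qed.

Lemma cvol0 : cvol set0 = 0.
Proof. by rewrite cvolE set0I measure0 mulr0. Qed.

Lemma cvolU X Y : measurable X -> measurable Y -> X `&` Y = set0 ->
  cvol (X `|` Y) = cvol X + cvol Y.
Proof.
move=> mX mY XY; rewrite !cvolE -mulrDr; congr (_ * _).
rewrite -fineD ?fin_m4//; congr fine.
rewrite setIUl measureU//.
- by apply: measurableI => //; exact: measurable_ball4.
- by apply: measurableI => //; exact: measurable_ball4.
- by rewrite setIACA XY set0I.
Qed.

Lemma cvol_split X Y : measurable X -> measurable Y ->
  cvol X = cvol (X `&` Y) + cvol (X `\` Y).
Proof.
move=> mX mY; rewrite -cvolU; [by rewrite setUIDK|exact: measurableI|exact: measurableD|].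
by rewrite setDE setIACA setICr setI0.
Qed.

Lemma le_cvol X Y : measurable X -> measurable Y -> X `<=` Y -> cvol X <= cvol Y.
Proof.
move=> mX mY XY; rewrite (cvol_split mY mX) (setIidr XY) lerDl.
exact: cvol_ge0.
Qed.

Lemma cvol_null X Y : measurable X -> measurable Y -> X `<=` Y -> cvol Y = 0 ->
  cvol X = 0.
Proof.
move=> mX mY XY Y0; apply/eqP; rewrite eq_le cvol_ge0 andbT -Y0.
exact: le_cvol.
Qed.

Lemma cvolU_null X Y : measurable X -> measurable Y -> cvol (X `&` Y) = 0 ->
  cvol (X `|` Y) = cvol X + cvol Y.
Proof.
move=> mX mY XY.
rewrite (_ : X `|` Y = X `|` (Y `\` X)); last first.
  apply/seteqP; split => x [|]; [by left| |by left|by case; right].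
  by have [|] := pselect (X x); [left|right].
rewrite cvolU; [|exact: mX|exact: measurableD|by rewrite setDE setICA setICr setI0].
by rewrite (cvol_split mY mX) setIC XY add0r.
Qed.

Lemma cvol_isom (f : R4 -> R4) X : isom4 f -> measurable X ->
  cvol (f @^-1` X) = cvol X.
Proof.
move=> [pf df] mX.
have mXB : measurable (X `&` ball4) by exact: measurableI mX measurable_ball4.
have e : f @^-1` X `&` ball4 = f @^-1` (X `&` ball4).
  rewrite preimage_setI; congr (_ `&` _).
  by apply/seteqP; split => x; rewrite /ball4/= df.
by rewrite unlock e (proj2 pf _ mXB).
Qed.

Lemma isom4_halfspace (f : R4 -> R4) n : isom4 f ->
  f @^-1` (halfspace (f n)) = halfspace n.
Proof. by move=> [_ df]; apply/seteqP; split => x; rewrite /halfspace/= df. Qed.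

Lemma isom4_hyperplane (f : R4 -> R4) n : isom4 f ->
  f @^-1` (hyperplane (f n)) = hyperplane n.
Proof. by move=> [_ df]; apply/seteqP; split => x; rewrite /hyperplane/= df. Qed.

(** A rotation turns the hyperplane into {0} × R³, whose product measure is 0 times infinity, that
    is 0. *)
Lemma cvol_hyperplane (n : R4) : 0 < dot4 n n -> cvol (hyperplane n) = 0.
Proof.
move=> n0; have [f [a [fi a0 fn]]] := isom4_reduce1 n.
have a1 : a != 0.
  by apply: contraTneq n0 => a1; rewrite -(proj2 fi) fn a1 /dot4/= !mulr0 !addr0 ltxx.
rewrite -(isom4_hyperplane n fi) cvol_isom//; last exact: measurable_hyperplane.
apply: (@cvol_null _ ([set 0] `*` setT)); first exact: measurable_hyperplane.
- by apply: measurableX => //; exact: measurable_set1.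
- rewrite fn => x; rewrite /hyperplane/dot4/= !mul0r !addr0 => /eqP.
  by rewrite mulf_eq0 (negPf a1) => /eqP.
- rewrite cvolE (_ : m4 _ = 0%E) ?mulr0//.
  apply/eqP; rewrite eq_le measure_ge0 andbT.
  apply: (@le_trans _ _ (m4 ([set 0] `*` setT))).
    apply: le_measure; rewrite ?inE; last exact: subIsetl.
      apply: measurableI; last exact: measurable_ball4.
      by apply: measurableX => //; exact: measurable_set1.
    by apply: measurableX => //; exact: measurable_set1.
  rewrite -[m4 _]/((L \x sprod L (sprod L L))%E _) product_measure1E//.
  rewrite [X in (X * _)%E](_ : _ = 0%E) ?mul0e//.
  exact: lebesgue_measure_set1.
Qed.

End solid_volume.

Section wedge.
Variable R : realType.
Notation R4 := (V4 R).
Notation cvol := (@cone_volume R).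

Definition opp4 (x : R4) : R4 := (- x.1, (- x.2.1, (- x.2.2.1, - x.2.2.2))).

Lemma dot4N (n x : R4) : dot4 (opp4 n) x = - dot4 n x.
Proof. by rewrite /dot4/=; ring. Qed.

Lemma dot4Nr (n x : R4) : dot4 n (opp4 x) = - dot4 n x.
Proof. by rewrite /dot4/=; ring. Qed.

(** In even dimension the antipodal map is a rotation: here two half-turns in complementary
    coordinate planes. *)
Lemma isom4_opp : isom4 opp4.
Proof.
have c1 : (- 1) ^+ 2 + 0 ^+ 2 = 1 :> R by ring.
have := isom4_comp (isom4_rot01 c1) (isom4_rot23 c1); congr isom4.
apply/funext => -[x [y [z w]]].
rewrite /opp4 /rot01 /rot23 /rot3 /rot2 /=.
congr (_, (_, (_, _))); ring.
Qed.

Lemma halfspaceN (n : R4) : opp4 @^-1` (halfspace n) = halfspace (opp4 n).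
Proof.
by apply/seteqP; split => x; rewrite /halfspace/= dot4N dot4Nr.
Qed.

Lemma cvol_opp X : measurable X -> cvol (opp4 @^-1` X) = cvol X.
Proof. exact: cvol_isom isom4_opp. Qed.

(** The antipodal map exchanges the two sides of the hyperplane, which is itself null; each side has
    half of 2π². *)
Lemma cvol_halfspace (n : R4) : 0 < dot4 n n -> cvol (halfspace n) = pi ^+ 2.
Proof.
move=> n0.
have eI : halfspace n `&` halfspace (opp4 n) = hyperplane n.
  apply/seteqP; split => x; rewrite /halfspace /hyperplane /= dot4N.
    by move=> [h1 h2]; apply/eqP; rewrite eq_le h1 andbT; lra.
  by move=> ->; rewrite oppr0.
have eU : halfspace n `|` halfspace (opp4 n) = setT.
  apply/seteqP; split => // x _; rewrite /halfspace /= dot4N.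
  by have [h|h] := leP 0 (dot4 n x); [left|right; lra].
have := cvolU_null (measurable_halfspace n) (measurable_halfspace (opp4 n)).
rewrite eI eU cvolT cvol_hyperplane// => /(_ erefl).
rewrite -halfspaceN cvol_opp; last exact: measurable_halfspace.
by lra.
Qed.

Definition dir (a : R) : R4 := (cos a, (sin a, (0, 0))).

Lemma dot4_dir (a : R) x : dot4 (dir a) x = cos a * x.1 + sin a * x.2.1.
Proof. by rewrite /dot4/=; ring. Qed.

Lemma dir_neq0 (a : R) : 0 < dot4 (dir a) (dir a).
Proof. by rewrite /dot4/= !mul0r !addr0 -!expr2 cos2Dsin2 ltr01. Qed.

(** For 0 ≤ b - a ≤ π, these are the points whose polar angle in the first two coordinates lies
    between a - π/2 and b - π/2; the opening angle is b - a. *)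
Definition wedge (a b : R) : set R4 := halfspace (dir a) `&` halfspace (opp4 (dir b)).

Lemma measurable_wedge a b : measurable (wedge a b).
Proof. by apply: measurableI; exact: measurable_halfspace. Qed.

Lemma cvol_wedge_rot (c a b : R) : cvol (wedge (c + a) (c + b)) = cvol (wedge a b).
Proof.
pose f := @rot01 R (cos c) (sin c).
have fi : isom4 f by exact: isom4_rot01 (cos2Dsin2 c).
have fdir t : f (dir t) = dir (c + t).
  rewrite /f /rot01 /rot3 /dir /=; congr (_, (_, _)).
    by rewrite cosD.
  by rewrite sinD.
have fopp t : f (opp4 (dir t)) = opp4 (dir (c + t)).
  rewrite -fdir /f /rot01 /rot3 /dir /opp4 /= !oppr0.
  by congr (_, (_, _)); ring.
rewrite /wedge -fdir -fopp -(isom4_halfspace (dir a) fi).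
rewrite -(isom4_halfspace (opp4 (dir b)) fi) -preimage_setI cvol_isom//.
by apply: measurableI; exact: measurable_halfspace.
Qed.

Lemma cvol_wedgeD (a b : R) : 0 < a -> 0 < b -> a + b <= pi ->
  cvol (wedge 0 (a + b)) = cvol (wedge 0 a) + cvol (wedge 0 b).
Proof.
move=> a0 b0 ab.
have -> : cvol (wedge 0 b) = cvol (wedge a (a + b)).
  by rewrite -(cvol_wedge_rot a) addr0.
have sa : 0 < sin a by apply: sin_gt0_pi; rewrite a0/=; lra.
have sb : 0 < sin b by apply: sin_gt0_pi; rewrite b0/=; lra.
have sab : 0 <= sin (a + b) by apply: sin_ge0_pi; rewrite ab andbT; lra.
(* The linear relation between three coplanar unit normals. Its coefficients are nonnegative because
   [a + b <= pi], so the sign of the middle form is controlled by the outer two. *)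
have key x : sin (a + b) * dot4 (dir a) x =
    sin b * dot4 (dir 0) x + sin a * dot4 (dir (a + b)) x.
  rewrite !dot4_dir cos0 sin0 cosD sinD.
  have e : sin b = sin b * (cos a ^+ 2 + sin a ^+ 2) by rewrite cos2Dsin2 mulr1.
  rewrite [X in _ = X * (1 * _ + _) + _]e; ring.
rewrite -cvolU_null.
- congr cvol; apply/seteqP; split => x; rewrite /wedge /halfspace /= !dot4N.
    move=> [h1 h2]; have := key x; have [h|h] := leP 0 (dot4 (dir a) x) => hk.
      by right; split => //; lra.
    by left; split => //; lra.
  have := key x; move: (dot4 _ x) (dot4 (dir a) x) (dot4 (dir (a + b)) x) => u v w.
  move=> hk [[h1 h2]|[h1 h2]]; split => //.
    rewrite oppr_ge0 -(pmulr_rle0 _ sa).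
    have : 0 <= sin b * u by rewrite mulr_ge0// ltW.
    have : sin (a + b) * v <= 0 by rewrite mulr_ge0_le0//; lra.
    by lra.
  rewrite -(pmulr_rge0 _ sb).
  have : 0 <= sin a * - w by rewrite mulr_ge0// ltW.
  have : 0 <= sin (a + b) * v by rewrite mulr_ge0.
  by lra.
- exact: measurable_wedge.
- exact: measurable_wedge.
- apply: (cvol_null _ _ _ (cvol_hyperplane (dir_neq0 a))).
  + by apply: measurableI; exact: measurable_wedge.
  + exact: measurable_hyperplane.
  + move=> x; rewrite /wedge /halfspace /hyperplane /= !dot4N => -[[_ h1] [h2 _]].
    by apply/eqP; rewrite eq_le h2 andbT; lra.
Qed.

(** Linearity follows from additivity; the slope is read off at [a = pi], where the wedge is a
    half-space of volume π². The case [a = 0] is a subset of a hyperplane. *)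
Lemma cvol_wedge (a : R) : 0 <= a <= pi -> cvol (wedge 0 a) = pi * a.
Proof.
move=> /andP[]; rewrite le_eqVlt => /predU1P[<- _|a0 api].
  rewrite mulr0; apply: (cvol_null _ _ _ (cvol_hyperplane (dir_neq0 0))).
  - exact: measurable_wedge.
  - exact: measurable_hyperplane.
  - move=> x; rewrite /wedge /halfspace /hyperplane /= dot4N => -[h1 h2].
    by apply/eqP; rewrite eq_le h1 andbT; lra.
rewrite (@additive_nonneg_linear _ pi (fun a => cvol (wedge 0 a))).
- rewrite (_ : wedge 0 pi = halfspace (dir 0)) ?cvol_halfspace ?dir_neq0//.
    by rewrite expr2 mulfK// gt_eqF// pi_gt0.
  rewrite /wedge (_ : opp4 _ = dir 0) ?setIid//.
  by rewrite /opp4 /dir /= cospi sinpi cos0 sin0 opprK !oppr0.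
- by move=> x; exact: cvol_ge0.
- exact: cvol_wedgeD.
- by rewrite a0.
Qed.

(* The dihedral angle between two half-spaces is the supplement of the angle
   between their inner normals. *)
Lemma cvol_halfspaceI (n m : R4) : 0 < dot4 n n -> 0 < dot4 m m ->
  cvol (halfspace n `&` halfspace m) =
  pi * acos (- dot4 n m / Num.sqrt (dot4 n n * dot4 m m)).
Proof.
move=> n0 m0; have [f [a [b [c [fi a0 c0 fn fm]]]]] := isom4_reduce2 n m.
have dnn : dot4 n n = a ^+ 2 by rewrite -(proj2 fi) fn /dot4/=; ring.
have dnm : dot4 n m = a * b by rewrite -(proj2 fi) fn fm /dot4/=; ring.
have dmm : dot4 m m = b ^+ 2 + c ^+ 2 by rewrite -(proj2 fi) fm /dot4/=; ring.
have {}a0 : 0 < a.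
  by rewrite lt_def a0 andbT; apply: contraTneq n0 => a1; rewrite dnn a1 expr0n ltxx.
set r := Num.sqrt (b ^+ 2 + c ^+ 2).
have r0 : 0 < r by rewrite sqrtr_gt0 -dmm.
have r2 : r ^+ 2 = b ^+ 2 + c ^+ 2 by rewrite sqr_sqrtr// -dmm ltW.
have br : -1 <= - b / r <= 1.
  rewrite -ler_norml normrM normrN normfV (gtr0_norm r0) ler_pdivrMr// mul1r.
  rewrite -(ger0_norm (ltW r0)) -ler_sqr ?nnegrE// !real_normK ?num_real//.
  by rewrite r2 lerDl sqr_ge0.
(* The angle with (b, c) = -r (cos t, sin t); it lies between 0 and [pi] because [c <= 0]. *)
set t := acos (- b / r).
have ct : cos t = - b / r by rewrite /t acosK// in_itv.
have st : sin t = - c / r.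
  rewrite sin_acos// expr_div_n sqrrN r2 -[1](@divff _ (b ^+ 2 + c ^+ 2)).
    rewrite -mulrBl addrAC subrr add0r sqrtrM ?sqr_ge0// sqrtr_sqr ler0_norm//.
    by rewrite sqrtrV// addr_ge0// sqr_ge0.
  by rewrite -dmm gt_eqF.
have -> : - dot4 n m / Num.sqrt (dot4 n n * dot4 m m) = - b / r.
  rewrite dnm dnn dmm sqrtrM ?sqr_ge0// sqrtr_sqr gtr0_norm// -/r.
  by field; rewrite !gt_eqF.
rewrite -/t -cvol_wedge; last by rewrite acos_ge0// acos_lepi.
have -> : halfspace n `&` halfspace m =
    f @^-1` (halfspace (f n) `&` halfspace (f m)).
  by rewrite preimage_setI !isom4_halfspace.
rewrite cvol_isom; [|exact: fi|by apply: measurableI; exact: measurable_halfspace].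
have -> : halfspace (f n) `&` halfspace (f m) = wedge 0 t; last by [].
rewrite /wedge; congr (_ `&` _).
- apply/seteqP; split => x; rewrite /halfspace/= fn dot4_dir cos0 sin0 /dot4/=;
      rewrite !mul0r !addr0 mul1r.
      by rewrite pmulr_rge0.
    by move=> h; rewrite mulr_ge0// ltW.
- apply/seteqP; split => x; rewrite /halfspace/= fm dot4N dot4_dir ct st /dot4/=;
    rewrite !mul0r !addr0 (_ : - (_ + _) = (b * x.1 + c * x.2.1) / r).
  - by move=> h; rewrite divr_ge0// ltW.
  - by field; rewrite gt_eqF.
  - by rewrite pmulr_lge0// invr_gt0.
  - by field; rewrite gt_eqF.
Qed.

End wedge.

(** * Girard's theorem *)

Section null_overlap.
Variable R : realType.
Notation R4 := (V4 R).
Notation cvol := (@cone_volume R).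

Lemma cvol_bigU0 (I : Type) (s : seq I) (P : pred I) (A : I -> set R4) :
  (forall i, P i -> measurable (A i)) -> (forall i, P i -> cvol (A i) = 0) ->
  cvol (\big[setU/set0]_(i <- s | P i) A i) = 0.
Proof.
move=> mA A0; elim: s => [|i s IH]; first by rewrite big_nil cvol0.
rewrite big_cons; case: ifPn => // Pi.
have mB : measurable (\big[setU/set0]_(j <- s | P j) A j).
  exact: bigsetU_measurable.
rewrite cvolU_null; [by rewrite IH A0// addr0|exact: mA|exact: mB|].
apply: (cvol_null _ _ _ IH); [|exact: mB|exact: subIsetr].
by apply: measurableI; [exact: mA|exact: mB].
Qed.

Lemma cvol_bigU (I : eqType) (s : seq I) (P : pred I) (A : I -> set R4) :
  uniq s -> (forall i, P i -> measurable (A i)) ->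
  (forall i j, P i -> P j -> i != j -> cvol (A i `&` A j) = 0) ->
  cvol (\big[setU/set0]_(i <- s | P i) A i) = \sum_(i <- s | P i) cvol (A i).
Proof.
move=> + mA A0; elim: s => [_|i s IH /= /andP[si us]].
  by rewrite !big_nil cvol0.
rewrite !big_cons; case: ifPn => Pi; last exact: IH.
have mB : measurable (\big[setU/set0]_(j <- s | P j) A j).
  exact: bigsetU_measurable.
rewrite cvolU_null; [by rewrite IH|exact: mA|exact: mB|].
have -> : A i `&` \big[setU/set0]_(j <- s | P j) A j =
    \big[setU/set0]_(j <- s | P j && (j \in s)) (A i `&` A j).
  by rewrite big_distrr/= -big_filter -[RHS]big_filter; congr bigop;
    apply: eq_in_filter => j ->; rewrite andbT.
rewrite cvol_bigU0// => j /andP[Pj js].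
  by apply: measurableI; exact: mA.
by apply: A0 => //; apply: contraNneq si => ->.
Qed.

Lemma cvol_halfspace_split (X : set R4) (n : R4) : measurable X -> 0 < dot4 n n ->
  cvol X = cvol (X `&` halfspace n) + cvol (X `&` halfspace (opp4 n)).
Proof.
move=> mX n0.
have mH k : measurable (X `&` halfspace k).
  by apply: measurableI; [exact: mX|exact: measurable_halfspace].
rewrite -cvolU_null.
- congr cvol; rewrite -setIUr [X in _ `&` X](_ : _ = setT) ?setIT//.
  apply/seteqP; split => // x _; rewrite /halfspace /= dot4N.
  by have [h|h] := leP 0 (dot4 n x); [left|right; lra].
- exact: mH.
- exact: mH.
- apply: (cvol_null _ _ _ (cvol_hyperplane n0)).
  + by apply: measurableI; exact: mH.
  + exact: measurable_hyperplane.
  + move=> x [[_ +] [_]]; rewrite /halfspace /hyperplane /= dot4N => h1 h2.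
    by apply/eqP; rewrite eq_le h1 andbT; lra.
Qed.

Definition dihedral (n m : R4) : R :=
  acos (- dot4 n m / Num.sqrt (dot4 n n * dot4 m m)).

(* Girard's argument: halving wedges by the third hyperplane, and using that the
   antipodal map preserves volume. *)
Lemma cvol_trihedron (n1 n2 n3 : R4) :
  0 < dot4 n1 n1 -> 0 < dot4 n2 n2 -> 0 < dot4 n3 n3 ->
  cvol (halfspace n1 `&` halfspace n2 `&` halfspace n3) =
  pi / 2 * (dihedral n1 n2 + dihedral n1 n3 + dihedral n2 n3 - pi).
Proof.
move=> p1 p2 p3.
have mH k : measurable (halfspace k) := measurable_halfspace (k : R4).
have mHI (k l : R4) : measurable (halfspace k `&` halfspace l).
  by apply: measurableI; exact: mH.
have e1 := cvol_halfspace_split (mHI n1 n2) p3.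
have e2 := cvol_halfspace_split (mHI n1 (opp4 n3)) p2.
have e3 := cvol_halfspace_split (mH n1) p3.
have e4 := cvol_halfspace_split (mHI n2 n3) p1.
have e5 : cvol (halfspace n1 `&` halfspace (opp4 n3) `&` halfspace (opp4 n2)) =
    cvol (halfspace n2 `&` halfspace n3 `&` halfspace (opp4 n1)).
  rewrite -(@cvol_opp _ (halfspace n2 `&` _ `&` _)); last first.
    by apply: measurableI; [exact: mHI|exact: mH].
  rewrite !preimage_setI !halfspaceN.
  rewrite [halfspace (opp4 (opp4 n1))](_ : _ = halfspace n1).
    by rewrite setIC [X in _ `&` X]setIC setIA.
  by apply/seteqP; split => x; rewrite /halfspace/= !dot4N opprK.
rewrite (cvol_halfspace p1) in e3.
rewrite (cvol_halfspaceI p1 p2) -/(dihedral n1 n2) in e1.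
rewrite (cvol_halfspaceI p1 p3) -/(dihedral n1 n3) in e3.
rewrite (cvol_halfspaceI p2 p3) -/(dihedral n2 n3) in e4.
have e6 : halfspace n1 `&` halfspace (opp4 n3) `&` halfspace n2 =
    halfspace n1 `&` halfspace n2 `&` halfspace (opp4 n3) by rewrite setIAC.
have e7 : halfspace n2 `&` halfspace n3 `&` halfspace n1 =
    halfspace n1 `&` halfspace n2 `&` halfspace n3 by rewrite setIC setIA.
rewrite e6 e5 in e2; rewrite e7 in e4.
move: (cvol (halfspace n1 `&` halfspace n2 `&` halfspace n3)) e1 e4 => v e1 e4.
move: (cvol _) e1 e2 => u e1 e2.
move: (cvol (_ `&` _)) e2 e3 => w e2 e3.
move: (cvol _) e2 e4 => t e2 e4.
(* Now u + v and t + v are the wedges (1,2) and (2,3), u + t = w, and w is the half-space minus the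
   wedge (1,3). Adding the first two equations and eliminating u + t leaves 2v. *)
have : 2 * v = pi * (dihedral n1 n2 + dihedral n1 n3 + dihedral n2 n3) - pi ^+ 2.
  by rewrite !mulrDr; lra.
by lra.
Qed.
End null_overlap.

(** * Cones over five vectors *)

Section cones.
Variable R : realType.
Notation R4 := (V4 R).
Notation cvol := (@cone_volume R).

Definition row_of (x : R4) : 'rV[R]_4 := vec4 x.1 x.2.1 x.2.2.1 x.2.2.2.

Definition of_row (u : 'rV[R]_4) : R4 :=
  (u 0 ord0, (u 0 (lift ord0 ord0), (u 0 (lift ord0 (lift ord0 ord0)),
    u 0 (lift ord0 (lift ord0 (lift ord0 ord0)))))).

Lemma sum_ord4 (F : 'I_4 -> R) : \sum_i F i =
  F ord0 + F (lift ord0 ord0) + F (lift ord0 (lift ord0 ord0)) +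
  F (lift ord0 (lift ord0 (lift ord0 ord0))).
Proof. by rewrite !big_ord_recl big_ord0 addr0 !addrA. Qed.

Lemma of_rowK : cancel of_row row_of.
Proof.
move=> u; apply/rowP => i; rewrite !mxE /=.
case: i => -[|[|[|[|//]]]] /= ?; congr (u 0 _); exact: val_inj.
Qed.

Lemma row_ofK : cancel row_of of_row.
Proof. by move=> [x [y [z w]]]; rewrite /of_row !mxE. Qed.

Lemma dot4_of_row (u : 'rV[R]_4) (x : R4) :
  dot4 (of_row u) x = \sum_i u 0 i * row_of x 0 i.
Proof. by rewrite sum_ord4 !mxE. Qed.

Lemma dotv_row_of (x y : R4) : dotv (row_of x) (row_of y) = dot4 x y.
Proof. by rewrite /dotv sum_ord4 !mxE. Qed.

Lemma of_row_neq0 (u : 'rV[R]_4) : u != 0 -> 0 < dot4 (of_row u) (of_row u).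
Proof.
move=> u0; rewrite dot4_of_row of_rowK lt_def sumr_ge0 ?andbT; last first.
  by move=> i _; rewrite -expr2 sqr_ge0.
apply: contraNneq u0 => /eqP; rewrite psumr_eq0; last first.
  by move=> i _; rewrite -expr2 sqr_ge0.
move=> /allP h; apply/eqP/rowP => i; rewrite mxE.
by have := h i; rewrite mem_index_enum -expr2 sqrf_eq0 => /(_ isT)/eqP.
Qed.

(** The dual basis of the rows of an invertible [M]; it presents a simplicial cone as an
    intersection of four half-spaces. *)
Definition coord_form (M : 'M[R]_4) (j : 'I_4) : R4 := of_row (col j (invmx M))^T.

Lemma dot4_coord_form M j x :
  dot4 (coord_form M j) x = (row_of x *m invmx M) 0 j.
Proof.
rewrite dot4_of_row mxE; apply: eq_bigr => i _.
by rewrite mulrC; congr (_ * _); rewrite !mxE.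
Qed.

Lemma coord_form_neq0 M j : M \in unitmx ->
  0 < dot4 (coord_form M j) (coord_form M j).
Proof.
move=> uM; apply: of_row_neq0; rewrite trmx_eq0; apply/eqP => h.
have : (M *m invmx M) j j = 0.
  rewrite mxE big1// => i _.
  by move/colP : h => /(_ i); rewrite !mxE => ->; rewrite mulr0.
by rewrite mulmxV// mxE eqxx => /eqP; rewrite oner_eq0.
Qed.

Definition cone n (M : 'M[R]_(n, 4)) : set R4 :=
  [set x | exists w : 'rV[R]_n, (forall i, 0 <= w 0 i) /\ row_of x = w *m M].

Lemma coneE (M : 'M[R]_4) : M \in unitmx ->
  cone M = \bigcap_(j in [set: 'I_4]) halfspace (coord_form M j).
Proof.
move=> uM; apply/seteqP; split => x.
  move=> [w [w0 xw]] j _; rewrite /halfspace/= dot4_coord_form xw.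
  by rewrite mulmxK.
move=> h; exists (row_of x *m invmx M); split; last by rewrite mulmxKV.
by move=> i; rewrite -dot4_coord_form; exact: h.
Qed.

Lemma measurable_cone (M : 'M[R]_4) : M \in unitmx -> measurable (cone M).
Proof.
move=> uM; rewrite coneE//; apply: fin_bigcap_measurable => // j _.
exact: measurable_halfspace.
Qed.

Lemma mulmx_row' n (w : 'rV[R]_n.+1) (C : 'M[R]_(n.+1, 4)) i : w 0 i = 0 ->
  w *m C = col' i w *m row' i C.
Proof.
move=> w0; apply/rowP => k; rewrite !mxE (bigD1_ord i)//= w0 mul0r add0r.
by apply: eq_bigr => j _; rewrite !mxE.
Qed.

Lemma cone_row' n (C : 'M[R]_(n.+1, 4)) i x : cone (row' i C) x <->
  exists w : 'rV[R]_n.+1,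
    [/\ forall j, 0 <= w 0 j, w 0 i = 0 & row_of x = w *m C].
Proof.
split.
  move=> [w [w0 xw]].
  pose w' : 'rV[R]_n.+1 := \row_j (if unlift i j is Some k then w 0 k else 0).
  have w'i : w' 0 i = 0 by rewrite mxE unlift_none.
  exists w'; split => //.
    by move=> j; rewrite mxE; case: (unlift i j).
  rewrite xw (mulmx_row' C w'i); congr (_ *m _).
  by apply/rowP => j; rewrite !mxE liftK.
move=> [w [w0 wi xw]]; exists (col' i w); split; last by rewrite xw (mulmx_row' C wi).
by move=> j; rewrite mxE.
Qed.

Section relation.
Variables (C : 'M[R]_(5, 4)) (mu : 'rV[R]_5).
Hypothesis muC : mu *m C = 0.
Hypothesis muU : forall i, mu 0 i != 0 -> row' i C \in unitmx.

Let K i := cone (row' i C).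
Let P := [pred i | 0 < mu 0 i].

Let mK i : P i -> measurable (K i).
Proof.
by move=> Pi; apply: measurable_cone; apply: muU; rewrite gt_eqF.
Qed.

(** Subtracting the multiple of [mu] with the same i-th coordinate leaves a relation between the
    other four rows, which are independent by [muU]. *)
Lemma relation_unique (u : 'rV[R]_5) i : mu 0 i != 0 -> u *m C = 0 ->
  u = (u 0 i / mu 0 i) *: mu.
Proof.
move=> mi uC; apply/eqP; rewrite -subr_eq0; apply/eqP.
set v := _ - _.
have vi : v 0 i = 0 by rewrite !mxE divfK// subrr.
have : v *m C = 0 by rewrite mulmxBl -scalemxAl muC scaler0 uC subrr.
rewrite (mulmx_row' C vi) => /(congr1 (mulmx^~ (invmx (row' i C)))).
rewrite mulmxK ?muU// mul0mx => v0; apply/rowP => j; rewrite [RHS]mxE.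
case: (unliftP i j) => [k ->|->//].
by move/rowP: v0 => /(_ k); rewrite !mxE.
Qed.

(* Moving along the relation mu until the first of the coordinates in P
   vanishes. *)
Lemma relation_shift (w : 'rV[R]_5) : (exists i, P i) -> exists t i,
  [/\ P i, w 0 i + t * mu 0 i = 0, (forall j, P j -> 0 <= w 0 j + t * mu 0 j) &
      (forall j, 0 <= w 0 j) -> t <= 0].
Proof.
move=> [i0 Pi0].
(* For j in [P], nonnegativity after the shift means t ≥ -w_j/μ_j; the largest of these bounds is
   attained at [i], where equality holds. *)
case: (arg_maxP (fun j => - w 0 j / mu 0 j) Pi0) => i Pi imax.
exists (- w 0 i / mu 0 i), i; split => //.
- by rewrite divfK ?addrN// gt_eqF.
- move=> j Pj; have : - w 0 j / mu 0 j <= - w 0 i / mu 0 i by exact: imax.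
  rewrite ler_pdivrMr; last exact: Pj.
  by rewrite lerNl -subr_ge0 opprK addrC.
- by move=> w0; rewrite mulr_le0_ge0 ?oppr_le0// invr_ge0; exact: ltW.
Qed.

(** Starting from nonnegative coefficients, the shift uses t ≤ 0: coefficients with μ_j ≤ 0 do not
    decrease, and those in [P] stay nonnegative until the first one vanishes. Dropping that row
    gives the cone containing the point. *)
Lemma bigcup_cone : (exists i, P i) -> \big[setU/set0]_(i | P i) K i = cone C.
Proof.
move=> exP; rewrite -bigcup_seq_cond; apply/seteqP; split => x.
  move=> [i /andP[_ Pi]] /cone_row'[w [w0 wi xw]]; by exists w.
move=> [w [w0 xw]]; have [t [i [Pi ti tP /(_ w0) t0]]] := relation_shift w exP.
exists i; first by rewrite /= mem_index_enum.
apply/cone_row'; exists (w + t *: mu); split.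
- move=> j; rewrite !mxE; have [Pj|] := boolP (P j); first exact: tP.
  by rewrite /= -leNgt => mj; rewrite addr_ge0// mulr_le0.
- by rewrite !mxE.
- by rewrite mulmxDl -scalemxAl muC scaler0 addr0.
Qed.

(** A point common to [K i] and [K j] has coefficient vectors w and v with w_i = 0, v_j = 0 and v -
    w = t μ. Coordinate i gives t ≥ 0, then coordinate j gives w_j ≤ 0, hence w_j = 0: overlaps lie
    in hyperplanes. *)
Lemma sum_cvol_cone : (exists i, P i) ->
  \sum_(i | P i) cvol (K i) = cvol (cone C).
Proof.
move=> exP; rewrite -bigcup_cone// cvol_bigU ?index_enum_uniq//.
move=> i j Pi Pj ij.
have uM : row' i C \in unitmx by apply: muU; rewrite gt_eqF.
have [k jk] : exists k, j = lift i k.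
  have [k e|e] := unliftP i j; first by exists k.
  by rewrite e eqxx in ij.
apply: (cvol_null _ _ _ (cvol_hyperplane (coord_form_neq0 k uM))).
- by apply: measurableI; exact: mK.
- exact: measurable_hyperplane.
- move=> x [/cone_row'[w [w0 wi xw]] /cone_row'[v [v0 vj xv]]].
  rewrite /hyperplane /= dot4_coord_form xw (mulmx_row' C wi) mulmxK//.
  rewrite mxE -jk.
  have kv : (v - w) *m C = 0 by rewrite mulmxBl -xv -xw subrr.
  have mi : mu 0 i != 0 by rewrite gt_eqF.
  have e := relation_unique mi kv; set t := (v - w) 0 i / mu 0 i in e.
  have t0 : 0 <= t.
    by apply: divr_ge0; [rewrite !mxE wi subr0|exact: ltW].
  have : (v - w) 0 j = t * mu 0 j by rewrite [in LHS]e mxE.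
  rewrite !mxE vj sub0r => /eqP; rewrite eqr_oppLR => /eqP wE.
  by apply/eqP; rewrite eq_le w0 andbT wE oppr_le0 mulr_ge0//; exact: ltW.
Qed.

Lemma relation_preimage i x : mu 0 i != 0 ->
  exists w : 'rV[R]_5, w 0 i = 0 /\ row_of x = w *m C.
Proof.
move=> mi; pose M := row' i C.
pose w : 'rV[R]_5 :=
  \row_j (if unlift i j is Some k then (row_of x *m invmx M) 0 k else 0).
have wi : w 0 i = 0 by rewrite mxE unlift_none.
exists w; split => //; rewrite (mulmx_row' C wi) -[LHS](mulmxKV (muU mi)).
by congr (_ *m _); apply/rowP => j; rewrite [RHS]mxE [RHS]mxE liftK.
Qed.

(** Every vector is some combination of the rows, and a large enough multiple of a positive relation
    makes all its coefficients nonnegative. *)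
Lemma cone_relation_gt0 : (forall i, P i) -> cone C = setT.
Proof.
move=> allP; apply/seteqP; split => // x _.
have m0 : mu 0 ord0 != 0 by rewrite gt_eqF//; exact: allP.
have [w [w0 xw]] := relation_preimage x m0.
have [|t [i [Pi ti tP _]]] := relation_shift w; first by exists ord0.
exists (w + t *: mu); split.
  by move=> j; rewrite !mxE; exact/tP/allP.
by rewrite mulmxDl -scalemxAl muC scaler0 addr0.
Qed.

(** The four rows other than [i0] positively span a hyperplane, so the cone is the closed half-space
    on the side of row [i0]. *)
Lemma cvol_cone_relation_ge0 i0 : mu 0 i0 = 0 -> (forall i, i != i0 -> P i) ->
  cvol (cone C) = pi ^+ 2.
Proof.
move=> mi0 allP.
have [i1 i10] : exists i1, i1 != i0.
  by exists (lift i0 ord0); rewrite eq_sym neq_lift.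
have Pi1 := allP _ i10; have mi1 : mu 0 i1 != 0 by rewrite gt_eqF.
have uM := muU mi1.
have [k i0k] : exists k, i0 = lift i1 k.
  have [k e|e] := unliftP i1 i0; first by exists k.
  by rewrite e eqxx in i10.
rewrite (_ : cone C = halfspace (coord_form (row' i1 C) k)).
  by apply: cvol_halfspace; exact: coord_form_neq0.
(* As μ vanishes at [i0], the coefficient there is the same in every representation of [x]; it is
   the form that cuts out the half-space. *)
have base w x : row_of x = w *m C ->
    dot4 (coord_form (row' i1 C) k) x = w 0 i0.
  move=> xw; rewrite dot4_coord_form xw.
  pose v := w - (w 0 i1 / mu 0 i1) *: mu.
  have vi1 : v 0 i1 = 0 by rewrite !mxE divfK// subrr.
  have -> : w *m C = v *m C.
    by rewrite mulmxBl -scalemxAl muC scaler0 subr0.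
  rewrite (mulmx_row' C vi1) mulmxK// mxE -i0k !mxE mi0.
  by rewrite mulr0 subr0.
apply/seteqP; split => x.
  by move=> [w [w0 xw]]; rewrite /halfspace/= (base _ _ xw).
rewrite /halfspace/=; have [w [_ xw]] := relation_preimage x mi1.
rewrite (base _ _ xw) => wi0.
have [|t [i [Pi ti tP _]]] := relation_shift w; first by exists i1.
exists (w + t *: mu); split.
  move=> j; rewrite !mxE; have [->|ji] := eqVneq j i0.
    by rewrite mi0 mulr0 addr0.
  exact/tP/allP.
by rewrite mulmxDl -scalemxAl muC scaler0 addr0.
Qed.

End relation.

(** Cramer's rule: coordinate k is the expansion, along its first column, of a 5 × 5 determinant in
    which column k of [C] occurs twice. *)
Lemma lambda_relation (C : 'M[R]_(5, 4)) :
  (\row_i ((-1) ^+ i * \det (row' i C))) *m C = 0.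
Proof.
apply/rowP => k; rewrite !mxE.
pose B : 'M[R]_5 := row_mx (col k C) C.
pose c0 : 'I_5 := @lshift 1 4 ord0; pose cr (j : 'I_4) : 'I_5 := @rshift 1 4 j.
have BL i : B i c0 = C i k.
  have -> : C i k = col k C i ord0 by rewrite mxE.
  exact (row_mxEl (col k C) C i ord0).
have BR i j : B i (cr j) = C i j by exact (row_mxEr (col k C) C i j).
have detB : \det B^T = 0.
  apply: (@determinant_alternate _ _ _ c0 (cr k)) => //.
  have tE a b : B^T a b = B b a by rewrite [LHS]mxE.
  by move=> j; rewrite !tE BL BR.
rewrite -[RHS]detB det_tr (expand_det_col _ c0).
apply: eq_bigr => i _; rewrite BL mxE mulrC; congr (_ * _).
rewrite /cofactor addn0; congr (_ * \det _).
apply/matrixP => a b; rewrite [LHS]mxE.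
have -> : row' i (col' c0 B) a b = B (lift i a) (lift c0 b).
  by rewrite [LHS]mxE [LHS]mxE.
have -> : lift c0 b = cr b by exact: val_inj.
by rewrite BR.
Qed.

End cones.

(** * Oriented volumes and the cocycle relation for five points *)

Definition tet (R : realType) (c1 c2 c3 c4 : 'rV[R]_4) : 'M[R]_4 :=
  \matrix_(i < 4) nth 0 [:: c1; c2; c3; c4] i.

HB.lock Definition orv (R : realType) (c1 c2 c3 c4 : 'rV[R]_4) : R :=
  tetrahedron_orvol (tet c1 c2 c3 c4).

Section cocycle.
Variable R : realType.
Notation R4 := (V4 R).
Notation cvol := (@cone_volume R).

Lemma dotvZ (t : R) (u v : 'rV[R]_4) : dotv (t *: u) (t *: v) = t ^+ 2 * dotv u v.
Proof.
by rewrite /dotv mulr_sumr; apply: eq_bigr => i _; rewrite !mxE; ring.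
Qed.

Lemma dotv_gt0 (u : 'rV[R]_4) : u != 0 -> 0 < dotv u u.
Proof.
by move=> /of_row_neq0; rewrite -dotv_row_of of_rowK.
Qed.

Lemma unit_cone_tetrahedron (M : 'M[R]_4) : M \in unitmx ->
  unit_cone (sphere_tetrahedron M) = cone M `&` ball4.
Proof.
move=> uM.
have normalize (u : 'rV[R]_4) : u != 0 -> (exists w : 'rV[R]_4,
    (forall i, 0 <= w 0 i) /\ u = w *m M) ->
    sphere_tetrahedron M ((Num.sqrt (dotv u u))^-1 *: u).
  move=> u0 [w [w0 uw]]; have d0 := dotv_gt0 u0.
  split.
    rewrite /sphere3/= dotvZ exprVn sqr_sqrtr ?ltW// mulVf//.
    by rewrite gt_eqF.
  exists ((Num.sqrt (dotv u u))^-1 *: w); split; last by rewrite -scalemxAl -uw.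
  by move=> i; rewrite mxE mulr_ge0// invr_ge0 sqrtr_ge0.
apply/seteqP; split => x.
  move=> [t [u [/andP[t0 t1] [su [w [w0 uw]]] xu]]]; split.
    exists (t *: w); split; last by rewrite -scalemxAl -uw.
    by move=> i; rewrite mxE mulr_ge0.
  rewrite /ball4/= -dotv_row_of [row_of x]xu dotvZ su mulr1.
  by rewrite expr_le1.
move=> [xM]; rewrite /ball4/= -dotv_row_of => x1.
(* The origin is 0 times a point of the tetrahedron, and such a point must be exhibited: the first
   row of [M], normalized. *)
have [x0|x0] := eqVneq (row_of x) 0.
  pose w : 'rV[R]_4 := delta_mx 0 ord0.
  have wM0 : w *m M != 0.
    apply/eqP => /(congr1 (mulmx^~ (invmx M))); rewrite mulmxK// mul0mx.
    by move=> /rowP/(_ ord0); rewrite !mxE !eqxx => /eqP; rewrite oner_eq0.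
  exists 0, ((Num.sqrt (dotv (w *m M) (w *m M)))^-1 *: (w *m M)); split.
  - by rewrite lexx ler01.
  - apply: normalize => //; exists w; split => // i.
    by rewrite mxE eqxx; case: (_ == _).
  - by rewrite scale0r.
exists (Num.sqrt (dotv (row_of x) (row_of x))).
exists ((Num.sqrt (dotv (row_of x) (row_of x)))^-1 *: row_of x); split.
- rewrite sqrtr_ge0/= -sqrtr1.
  by rewrite ler_sqrt// ltr01.
- exact: normalize.
- by rewrite scalerA mulfV ?scale1r// gt_eqF// sqrtr_gt0 dotv_gt0.
Qed.

Lemma tetrahedron_orvolE (M : 'M[R]_4) :
  tetrahedron_orvol M = Num.sg (\det M) * cvol (cone M).
Proof.
rewrite /tetrahedron_orvol; have [->|dM] := eqVneq (\det M) 0.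
  by rewrite sgr0 !mul0r.
have uM : M \in unitmx by rewrite unitmxE unitfE.
congr (_ * _); rewrite cvolE /sphere_volume unit_cone_tetrahedron//.
by rewrite fineM//; exact (fin_cone_ball (measurable_cone uM)).
Qed.

Definition rows5 (c0 c1 c2 c3 c4 : 'rV[R]_4) : 'M[R]_(5, 4) :=
  \matrix_(i < 5) nth 0 [:: c0; c1; c2; c3; c4] i.

Let l0 : 'I_5 := ord0.
Let l1 : 'I_5 := lift ord0 ord0.
Let l2 : 'I_5 := lift ord0 (lift ord0 ord0).
Let l3 : 'I_5 := lift ord0 (lift ord0 (lift ord0 ord0)).
Let l4 : 'I_5 := lift ord0 (lift ord0 (lift ord0 (lift ord0 ord0))).

Lemma row'_rows5 c0 c1 c2 c3 c4 (C := rows5 c0 c1 c2 c3 c4) :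
  [/\ row' l0 C = tet c1 c2 c3 c4, row' l1 C = tet c0 c2 c3 c4,
      row' l2 C = tet c0 c1 c3 c4, row' l3 C = tet c0 c1 c2 c4 &
      row' l4 C = tet c0 c1 c2 c3].
Proof.
by split; apply/row_matrixP => -[[|[|[|[|//]]]] ?];
  apply/rowP => k; rewrite !mxE /=.
Qed.

Lemma eq_mod0 : eq_mod_2pi2 (0 : R) 0.
Proof. by exists 0; rewrite subrr mul0r. Qed.

Lemma eq_mod0D (x y : R) : eq_mod_2pi2 x 0 -> eq_mod_2pi2 y 0 -> eq_mod_2pi2 (x + y) 0.
Proof.
move=> [k kx] [l ly]; exists (k + l).
by rewrite subr0 in kx; rewrite subr0 in ly; rewrite subr0 kx ly intrD; ring.
Qed.

Lemma eq_mod0N (x : R) : eq_mod_2pi2 x 0 -> eq_mod_2pi2 (- x) 0.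
Proof. by move=> [k]; rewrite subr0 => ->; exists (- k); rewrite subr0 mulrNz mulNr. Qed.

Lemma eq_mod0B (x y : R) : eq_mod_2pi2 x 0 -> eq_mod_2pi2 y 0 -> eq_mod_2pi2 (x - y) 0.
Proof. by move=> hx hy; apply: eq_mod0D => //; exact: eq_mod0N. Qed.

Let I5P (P : 'I_5 -> Prop) : P l0 -> P l1 -> P l2 -> P l3 -> P l4 -> forall i, P i.
Proof.
move=> h0 h1 h2 h3 h4 i.
have := ltn_ord i; case: i => -[|[|[|[|[|//]]]]] h _.
- by rewrite (_ : Ordinal h = l0)//; exact: val_inj.
- by rewrite (_ : Ordinal h = l1)//; exact: val_inj.
- by rewrite (_ : Ordinal h = l2)//; exact: val_inj.
- by rewrite (_ : Ordinal h = l3)//; exact: val_inj.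
- by rewrite (_ : Ordinal h = l4)//; exact: val_inj.
Qed.

Section five_points.
Variables c0 c1 c2 c3 c4 : 'rV[R]_4.
Let C := rows5 c0 c1 c2 c3 c4.
Let lam : 'rV[R]_5 := \row_i ((-1) ^+ i * \det (row' i C)).

(** The alternating sum over the facets of a 4-simplex, the coboundary of the oriented volume. *)
Definition orv_boundary : R :=
  orv c1 c2 c3 c4 - orv c0 c2 c3 c4 + orv c0 c1 c3 c4
  - orv c0 c1 c2 c4 + orv c0 c1 c2 c3.

(** The alternating sign of a facet and the sign of its determinant merge into the sign of its
    coefficient in the linear relation between the five vectors. *)
Let boundaryE : orv_boundary = \sum_i Num.sg (lam 0 i) * cvol (cone (row' i C)).
Proof.
have [e0 e1 e2 e3 e4] := row'_rows5 c0 c1 c2 c3 c4.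
transitivity (\sum_(i < 5) (-1) ^+ i * tetrahedron_orvol (row' i C)).
  pose F (i : 'I_5) := (-1) ^+ i * tetrahedron_orvol (row' i C).
  have F0 : F l0 = orv c1 c2 c3 c4.
    by rewrite /F e0 orv.unlock mul1r.
  have F1 : F l1 = - orv c0 c2 c3 c4.
    by rewrite /F e1 orv.unlock expr1 mulN1r.
  have s2 : (-1) ^+ l2 = 1 :> R by rewrite -[LHS]/((-1) ^+ 2); ring.
  have s3 : (-1) ^+ l3 = -1 :> R by rewrite -[LHS]/((-1) ^+ 3); ring.
  have s4 : (-1) ^+ l4 = 1 :> R by rewrite -[LHS]/((-1) ^+ 4); ring.
  have F2 : F l2 = orv c0 c1 c3 c4.
    by rewrite /F e2 orv.unlock s2 mul1r.
  have F3 : F l3 = - orv c0 c1 c2 c4.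
    by rewrite /F e3 orv.unlock s3 mulN1r.
  have F4 : F l4 = orv c0 c1 c2 c3.
    by rewrite /F e4 orv.unlock s4 mul1r.
  rewrite /orv_boundary -F0 -F2 -F4 -[- orv c0 c2 c3 c4]F1 -[- orv c0 c1 c2 c4]F3.
  transitivity (\sum_i F i); last exact erefl.
  clearbody F; rewrite !big_ord_recl big_ord0 addr0 !addrA; exact erefl.
apply: eq_bigr => i _; rewrite tetrahedron_orvolE mulrA; congr (_ * _).
by rewrite mxE sgrM sgrX sgrN1.
Qed.

Let lamE : [/\ lam 0 l0 = \det (tet c1 c2 c3 c4),
  lam 0 l1 = - \det (tet c0 c2 c3 c4), lam 0 l2 = \det (tet c0 c1 c3 c4),
  lam 0 l3 = - \det (tet c0 c1 c2 c4) & lam 0 l4 = \det (tet c0 c1 c2 c3)].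
Proof.
have [e0 e1 e2 e3 e4] := row'_rows5 c0 c1 c2 c3 c4.
have s2 : (-1) ^+ l2 = 1 :> R by rewrite -[LHS]/((-1) ^+ 2); ring.
have s3 : (-1) ^+ l3 = -1 :> R by rewrite -[LHS]/((-1) ^+ 3); ring.
have s4 : (-1) ^+ l4 = 1 :> R by rewrite -[LHS]/((-1) ^+ 4); ring.
split.
- by rewrite [LHS]mxE e0 mul1r.
- by rewrite [LHS]mxE e1 expr1 mulN1r.
- by rewrite [LHS]mxE e2 s2 mul1r.
- by rewrite [LHS]mxE e3 s3 mulN1r.
- by rewrite [LHS]mxE e4 s4 mul1r.
Qed.

Let lamC : lam *m C = 0 := lambda_relation C.

Let lamU i : lam 0 i != 0 -> row' i C \in unitmx.
Proof. by rewrite mxE mulf_eq0 signr_eq0/= unitmxE unitfE. Qed.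

Let NlamE i : (- lam) 0 i = - lam 0 i. Proof. by rewrite [LHS]mxE. Qed.

Let boundary_split : orv_boundary =
  \sum_(i | 0 < lam 0 i) cvol (cone (row' i C)) -
  \sum_(i | 0 < (- lam) 0 i) cvol (cone (row' i C)).
Proof.
rewrite boundaryE (bigID (fun i => 0 < lam 0 i))/= (bigID (fun i => 0 < (- lam) 0 i)
  (fun i => ~~ (0 < lam 0 i)))/=.
rewrite [X in _ + (_ + X)]big1 ?addr0; last first.
  move=> i; rewrite NlamE oppr_gt0 -!leNgt => /andP[h1 h2].
  by have -> : lam 0 i = 0; [apply/eqP; rewrite eq_le h1|rewrite sgr0 mul0r].
congr (_ + _); first by apply: eq_bigr => i l; rewrite gtr0_sg ?mul1r.
rewrite -sumrN; apply: eq_big => [i|i /andP[_]].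
  rewrite NlamE oppr_gt0 -leNgt andb_idl// => /ltW//.
by rewrite NlamE oppr_gt0 => l; rewrite ltr0_sg ?mulN1r.
Qed.

Let NlamC : - lam *m C = 0. Proof. by rewrite mulNmx lamC oppr0. Qed.

Let NlamU i : (- lam) 0 i != 0 -> row' i C \in unitmx.
Proof. by rewrite NlamE oppr_eq0; exact: lamU. Qed.

Lemma orv_boundary_mixed (i j : 'I_5) : 0 < lam 0 i -> lam 0 j < 0 -> orv_boundary = 0.
Proof.
move=> li lj; rewrite boundary_split (sum_cvol_cone lamC lamU); last by exists i.
rewrite (sum_cvol_cone NlamC NlamU) ?subrr//.
by exists j; rewrite inE NlamE oppr_gt0.
Qed.

Lemma orv_boundary_pos : (exists i, 0 < lam 0 i) -> (forall i, 0 <= lam 0 i) ->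
  orv_boundary = cvol (cone C).
Proof.
move=> exl l0'; rewrite boundary_split (sum_cvol_cone lamC lamU)//.
by rewrite big1 ?subr0// => i; rewrite NlamE oppr_gt0 ltNge l0'.
Qed.

Lemma orv_boundary_neg : (exists i, lam 0 i < 0) -> (forall i, lam 0 i <= 0) ->
  orv_boundary = - cvol (cone C).
Proof.
move=> [i li] l0'; rewrite boundary_split (sum_cvol_cone NlamC NlamU); last first.
  by exists i; rewrite inE NlamE oppr_gt0.
by rewrite big1 ?sub0r// => j; rewrite ltNge l0'.
Qed.

Lemma orv_boundary_generic : \det (tet c1 c2 c3 c4) != 0 ->
  \det (tet c0 c2 c3 c4) != 0 -> \det (tet c0 c1 c3 c4) != 0 ->
  \det (tet c0 c1 c2 c4) != 0 -> \det (tet c0 c1 c2 c3) != 0 ->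
  eq_mod_2pi2 (orv_boundary) 0.
Proof.
move=> d0 d1 d2 d3 d4; have [e0 e1 e2 e3 e4] := lamE.
have lN0 : forall i, lam 0 i != 0.
  by apply: I5P; rewrite ?e0 ?e1 ?e2 ?e3 ?e4 ?oppr_eq0.
have [/existsP[i li]|/existsPn np] := boolP [exists i, 0 < lam 0 i]; last first.
  have neg i : lam 0 i < 0 by rewrite lt_neqAle lN0 leNgt np.
  rewrite orv_boundary_neg; [|by exists l0; exact: neg|by move=> i; exact/ltW/neg].
  rewrite (cone_relation_gt0 NlamC NlamU); last by move=> i; rewrite inE NlamE oppr_gt0.
  by rewrite cvolT; exists (-1); rewrite subr0 mulrNz mulN1r.
have [/existsP[j lj]|/existsPn nn] := boolP [exists i, lam 0 i < 0].
  by rewrite (orv_boundary_mixed li lj); exact: eq_mod0.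
have pos k : 0 < lam 0 k by rewrite lt_neqAle eq_sym lN0 leNgt nn.
rewrite orv_boundary_pos; [|by exists l0; exact: pos|by move=> k; exact/ltW/pos].
rewrite (cone_relation_gt0 lamC lamU); last by move=> k; exact: pos.
by rewrite cvolT; exists 1; rewrite subr0 mul1r.
Qed.

(* The case of four points c1, c2, c3, c4 on a great sphere: either they bound
   nothing, or they surround it and the boundary fills half of the 3-sphere. *)
Lemma orv_boundary_flat (l := [:: - \det (tet c0 c2 c3 c4); \det (tet c0 c1 c3 c4);
    - \det (tet c0 c1 c2 c4); \det (tet c0 c1 c2 c3)]) :
  \det (tet c1 c2 c3 c4) = 0 -> 
  [/\ has (fun x => 0 < x) l -> has (fun x => x < 0) l -> orv_boundary = 0,
      all (fun x => 0 < x) l -> orv_boundary = pi ^+ 2 &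
      all (fun x => x < 0) l -> orv_boundary = - pi ^+ 2].
Proof.
move=> d0; have [e0 e1 e2 e3 e4] := lamE; rewrite d0 in e0.
rewrite /l /= -e1 -e2 -e3 -e4 !orbF !andbT; split.
- have ex P (Q : bool) : [|| P (lam 0 l1), P (lam 0 l2), P (lam 0 l3) | P (lam 0 l4)] ->
      exists i, P (lam 0 i).
    by case/or4P => h; [exists l1|exists l2|exists l3|exists l4].
  move=> /(ex (fun x => 0 < x) true)[i li] /(ex (fun x => x < 0) true)[j lj].
  exact: orv_boundary_mixed li lj.
- move=> /and4P[h1 h2 h3 h4].
  rewrite orv_boundary_pos; [|by exists l1|].
    rewrite (cvol_cone_relation_ge0 lamC lamU e0)//.
    by apply: I5P => //; rewrite eqxx.
  by apply: I5P; rewrite ?e0// ltW.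
- move=> /and4P[h1 h2 h3 h4].
  rewrite orv_boundary_neg; [|by exists l1|].
    rewrite (@cvol_cone_relation_ge0 _ _ _ NlamC NlamU l0)//.
      by rewrite NlamE e0 oppr0.
    by apply: I5P => //; rewrite ?eqxx// => _; rewrite inE NlamE oppr_gt0.
  by apply: I5P; rewrite ?e0// ltW.
Qed.

End five_points.
End cocycle.

(** * The two tetrahedra that share a lune *)

Section lune.
Variable R : realType.
Notation R4 := (V4 R).
Notation cvol := (@cone_volume R).

Lemma det_tet (a0 a1 a2 a3 b0 b1 b2 b3 c0 c1 c2 c3 d0 d1 d2 d3 : R) :
  \det (tet (vec4 a0 a1 a2 a3) (vec4 b0 b1 b2 b3)
            (vec4 c0 c1 c2 c3) (vec4 d0 d1 d2 d3)) =
    a0 * (b1 * (c2 * d3 - c3 * d2) - b2 * (c1 * d3 - c3 * d1)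
          + b3 * (c1 * d2 - c2 * d1))
  - a1 * (b0 * (c2 * d3 - c3 * d2) - b2 * (c0 * d3 - c3 * d0)
          + b3 * (c0 * d2 - c2 * d0))
  + a2 * (b0 * (c1 * d3 - c3 * d1) - b1 * (c0 * d3 - c3 * d0)
          + b3 * (c0 * d1 - c1 * d0))
  - a3 * (b0 * (c1 * d2 - c2 * d1) - b1 * (c0 * d2 - c2 * d0)
          + b2 * (c0 * d1 - c1 * d0)).
Proof.
rewrite (expand_det_row _ ord0) !big_ord_recl big_ord0 /cofactor.
do 2 rewrite !(expand_det_row _ ord0) !big_ord_recl !big_ord0 /cofactor.
rewrite !det_mx11 !mxE /=.
ring.
Qed.

Section tetrahedron.
Variables P1 S1 P2 S2 U V c s : R.
Let D := P1 * S2 - S1 * P2.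

(* The forms giving the coordinates of a point with respect to the rows
   (P1,S1,0,0), (P2,S2,0,0), (0,0,U,V), (c,0,s,0). *)
Definition form0 : R4 :=
  (S2 / D, (- P2 / D, (- (c * S2) / (s * D), c * S2 * U / (s * V * D)))).
Definition form1 : R4 :=
  (- S1 / D, (P1 / D, (c * S1 / (s * D), - (c * S1 * U) / (s * V * D)))).
Definition form2 : R4 := (0, (0, (0, V^-1))).
Definition form3 : R4 := (0, (0, (s^-1, - U / (V * s)))).

(** [form2] is listed last because the other three forms vanish on the row (0,0,U,V): they cut out
    the lune with poles at that vertex and its antipode, and [form2] then divides it. *)
Lemma cone_tetE : D != 0 -> V != 0 -> s != 0 ->
  cone (tet (vec4 P1 S1 0 0) (vec4 P2 S2 0 0) (vec4 0 0 U V) (vec4 c 0 s 0)) =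
  halfspace form0 `&` halfspace form1 `&` halfspace form3 `&` halfspace form2.
Proof.
move=> D0 V0 s0; have Dn : P1 * S2 - S1 * P2 != 0 by [].
have rowE (w : 'rV[R]_4) (w0 := w 0 ord0) (w1 := w 0 (lift ord0 ord0))
    (w2 := w 0 (lift ord0 (lift ord0 ord0)))
    (w3 := w 0 (lift ord0 (lift ord0 (lift ord0 ord0)))) :
    w *m tet (vec4 P1 S1 0 0) (vec4 P2 S2 0 0) (vec4 0 0 U V) (vec4 c 0 s 0) =
    vec4 (w0 * P1 + w1 * P2 + w3 * c) (w0 * S1 + w1 * S2)
      (w2 * U + w3 * s) (w2 * V).
  apply/rowP => k; rewrite [LHS]mxE sum_ord4 !mxE -/w0 -/w1 -/w2 -/w3.
  by case: k => -[|[|[|[|//]]]] /= ?; ring.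
apply/seteqP; split => x.
  move=> [w [w0 /(congr1 (@of_row R))]]; rewrite rowE row_ofK /of_row !mxE /=.
  move=> ->; rewrite /halfspace /dot4 /=; do ![split].
  - rewrite [leRHS](_ : _ = w 0 ord0); first exact: w0.
    by rewrite /form0 /D /=; field; rewrite Dn V0 s0.
  - rewrite [leRHS](_ : _ = w 0 (lift ord0 ord0)); first exact: w0.
    by rewrite /form1 /D /=; field; rewrite Dn V0 s0.
  - rewrite [leRHS](_ : _ = w 0 (lift ord0 (lift ord0 (lift ord0 ord0)))).
      exact: w0.
    by rewrite /form3 /=; field; rewrite V0 s0.
  - rewrite [leRHS](_ : _ = w 0 (lift ord0 (lift ord0 ord0))); first exact: w0.
    by rewrite /form2 /=; field.
move=> [[[h0 h1] h3] h2].
exists (vec4 (dot4 form0 x) (dot4 form1 x) (dot4 form2 x) (dot4 form3 x)); split.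
  by move=> i; rewrite mxE; case: i => -[|[|[|[|//]]]] /= ?.
rewrite rowE !mxE /= /row_of /dot4 /form0 /form1 /form2 /form3 /D /=.
by congr vec4; field; rewrite ?Dn ?V0 ?s0.
Qed.
End tetrahedron.

Lemma div_sqrt_scale (k x z A B : R) : 0 < k -> x = k * z -> A = k ^+ 2 * B ->
  x / Num.sqrt A = z / Num.sqrt B.
Proof.
move=> k0 -> ->; rewrite sqrtrM ?sqr_ge0// sqrtr_sqr gtr0_norm//.
by rewrite -mulf_div divff ?mul1r// gt_eqF.
Qed.

Section volume.
Variables P1 S1 P2 S2 U V c s : R.
Let D := P1 * S2 - S1 * P2.
Let y := P1 * P2 + S1 * S2.
Hypothesis PS1 : P1 ^+ 2 + S1 ^+ 2 = 1.
Hypothesis PS2 : P2 ^+ 2 + S2 ^+ 2 = 1.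
Hypothesis UV : U ^+ 2 + V ^+ 2 = 1.
Hypothesis cs : c ^+ 2 + s ^+ 2 = 1.
Hypothesis s0 : 0 < s.
Hypothesis D0 : D != 0.
Hypothesis V0 : V != 0.
Hypothesis q1 : 0 < 1 - (U * s) ^+ 2 - (P1 * c) ^+ 2.
Hypothesis q2 : 0 < 1 - (U * s) ^+ 2 - (P2 * c) ^+ 2.

Let n0 := form0 P1 S1 P2 S2 U V c s.
Let n1 := form1 P1 S1 P2 S2 U V c s.
Let n2 := form2 V.
Let n3 := form3 U V s.

Let sN0 : s != 0. Proof. by rewrite gt_eqF. Qed.

Let Q : 0 < 1 - (U * s) ^+ 2.
Proof. by move: q1; rewrite subr_gt0; apply: le_lt_trans; exact: sqr_ge0. Qed.

Let r := rcoef (U * s).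

Let r0 : 0 < r. Proof. by rewrite invr_gt0 sqrtr_gt0. Qed.

Let r2 : r ^+ 2 = (1 - (U * s) ^+ 2)^-1.
Proof. by rewrite exprVn sqr_sqrtr// ltW. Qed.

(** Lagrange's identity: [y] is the cosine and [D] the sine of the angle from a1 to b1. *)
Let yD : 1 - y ^+ 2 = D ^+ 2.
Proof.
have -> : 1 = (P1 ^+ 2 + S1 ^+ 2) * (P2 ^+ 2 + S2 ^+ 2) by rewrite PS1 PS2 mulr1.
by rewrite /y /D; ring.
Qed.

Let sV : s ^+ 2 * V ^+ 2 = s ^+ 2 - (U * s) ^+ 2.
Proof. by have -> : V ^+ 2 = 1 - U ^+ 2; [rewrite -UV; ring|ring]. Qed.

Let rp p : 1 - r ^+ 2 * p ^+ 2 = r ^+ 2 * (1 - (U * s) ^+ 2 - p ^+ 2).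
Proof. by rewrite r2; field; rewrite gt_eqF. Qed.

(** The squared determinant of the tetrahedron, a common denominator for the Gram matrix of the dual
    basis. *)
Let k := D ^+ 2 * (s ^+ 2 * V ^+ 2).

Let k0 : 0 < k.
Proof.
by apply: mulr_gt0; [|apply: mulr_gt0]; rewrite exprn_even_gt0.
Qed.

Let n00 : dot4 n0 n0 = (1 - (U * s) ^+ 2 - (P2 * c) ^+ 2) / k.
Proof.
(* Made homogeneous by means of [PS2], [UV] and [cs], so that what remains is an identity of
   rational functions. *)
have -> : 1 - (U * s) ^+ 2 - (P2 * c) ^+ 2 =
    (P2 ^+ 2 + S2 ^+ 2) * (s ^+ 2 * V ^+ 2) + (c * S2) ^+ 2 * (U ^+ 2 + V ^+ 2).
  rewrite PS2 UV mul1r mulr1 sV.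
  have -> : 1 = (c ^+ 2 * (P2 ^+ 2 + S2 ^+ 2) + s ^+ 2) by rewrite PS2 mulr1.
  by ring.
by rewrite /n0 /dot4 /form0 /= /k -/D; field; rewrite D0 V0 sN0.
Qed.

Let n11 : dot4 n1 n1 = (1 - (U * s) ^+ 2 - (P1 * c) ^+ 2) / k.
Proof.
have -> : 1 - (U * s) ^+ 2 - (P1 * c) ^+ 2 =
    (P1 ^+ 2 + S1 ^+ 2) * (s ^+ 2 * V ^+ 2) + (c * S1) ^+ 2 * (U ^+ 2 + V ^+ 2).
  rewrite PS1 UV mul1r mulr1 sV.
  have -> : 1 = (c ^+ 2 * (P1 ^+ 2 + S1 ^+ 2) + s ^+ 2) by rewrite PS1 mulr1.
  by ring.
by rewrite /n1 /dot4 /form1 /= /k -/D; field; rewrite D0 V0 sN0.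
Qed.

Let n33 : dot4 n3 n3 = D ^+ 2 / k.
Proof.
have -> : D ^+ 2 = D ^+ 2 * (U ^+ 2 + V ^+ 2) by rewrite UV mulr1.
by rewrite /n3 /dot4 /form3 /= /k; field; rewrite D0 V0 sN0.
Qed.

Let n01 : - dot4 n0 n1 = ((1 - (U * s) ^+ 2) * y - (P1 * c) * (P2 * c)) / k.
Proof.
have -> : (1 - (U * s) ^+ 2) * y - (P1 * c) * (P2 * c) =
    y * (s ^+ 2 * V ^+ 2) + c ^+ 2 * (S1 * S2) * (U ^+ 2 + V ^+ 2).
  by rewrite UV sV -[X in (X - _) * y]cs /y; ring.
by rewrite /n0 /n1 /dot4 /form0 /form1 /= /k -/D /y; field; rewrite D0 V0 sN0.
Qed.

Let n03 : - dot4 n0 n3 = D * (c * S2) / k.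
Proof.
have -> : D * (c * S2) = D * (c * S2) * (U ^+ 2 + V ^+ 2) by rewrite UV mulr1.
by rewrite /n0 /n3 /dot4 /form0 /form3 /= /k -/D; field; rewrite D0 V0 sN0.
Qed.

Let n13 : - dot4 n1 n3 = - (D * (c * S1)) / k.
Proof.
have -> : D * (c * S1) = D * (c * S1) * (U ^+ 2 + V ^+ 2) by rewrite UV mulr1.
by rewrite /n1 /n3 /dot4 /form1 /form3 /= /k -/D; field; rewrite D0 V0 sN0.
Qed.

Let kN0 : k != 0. Proof. by rewrite gt_eqF. Qed.
Let rN0 : r != 0. Proof. by rewrite gt_eqF. Qed.

(** By [cvol_trihedron], with the three dihedral angles matching the three arccosines of [Afun] one
    by one: each quotient differs only by a positive factor, 1/(k r) or 1/(k r²), common to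
    numerator and square root. *)
Lemma cvol_lune : cvol (halfspace n0 `&` halfspace n1 `&` halfspace n3) =
  pi / 2 * Afun (P1 * c) (P2 * c) (U * s) y.
Proof.
have kV : 0 < k^-1 by rewrite invr_gt0.
have D2 : 0 < D ^+ 2 by rewrite exprn_even_gt0.
rewrite cvol_trihedron.
- rewrite /Afun -/r; congr (_ * (_ - _)).
  rewrite addrAC -addrA [X in _ = X]addrAC.
  rewrite [dihedral n0 n3](_ : _ = acos (r * (P1 * c - P2 * c * y)
      / Num.sqrt ((1 - r ^+ 2 * (P2 * c) ^+ 2) * (1 - y ^+ 2)))); last first.
    congr acos; rewrite n03 n00 n33 yD rp.
    apply: (@div_sqrt_scale (k * r)^-1).
    + by rewrite invr_gt0 mulr_gt0.
    + have -> : P1 * c - P2 * c * y = D * (c * S2).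
        have -> : P1 * c = P1 * c * (P2 ^+ 2 + S2 ^+ 2) by rewrite PS2 mulr1.
        by rewrite /y /D; ring.
      by field; rewrite kN0 rN0.
    + by field; rewrite kN0 rN0.
  rewrite [dihedral n1 n3](_ : _ = acos (r * (P2 * c - P1 * c * y)
      / Num.sqrt ((1 - r ^+ 2 * (P1 * c) ^+ 2) * (1 - y ^+ 2)))); last first.
    congr acos; rewrite n13 n11 n33 yD rp.
    apply: (@div_sqrt_scale (k * r)^-1).
    + by rewrite invr_gt0 mulr_gt0.
    + have -> : P2 * c - P1 * c * y = - (D * (c * S1)).
        have -> : P2 * c = P2 * c * (P1 ^+ 2 + S1 ^+ 2) by rewrite PS1 mulr1.
        by rewrite /y /D; ring.
      by field; rewrite kN0 rN0.
    + by field; rewrite kN0 rN0.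
  rewrite [dihedral n0 n1](_ : _ = acos ((y - r ^+ 2 * (P1 * c) * (P2 * c))
      / Num.sqrt ((1 - r ^+ 2 * (P1 * c) ^+ 2) *
                  (1 - r ^+ 2 * (P2 * c) ^+ 2)))); last first.
    congr acos; rewrite n01 n00 n11 !rp.
    apply: (@div_sqrt_scale (k * r ^+ 2)^-1).
    + by rewrite invr_gt0 mulr_gt0// exprn_gt0.
    + have -> : 1 - (U * s) ^+ 2 = (r ^+ 2)^-1 by rewrite r2 invrK.
      by field; rewrite kN0 rN0.
    + by field; rewrite kN0 rN0.
  by ring.
- by rewrite n00 mulr_gt0.
- by rewrite n11 mulr_gt0.
- by rewrite n33 mulr_gt0.
Qed.

Let M1 := tet (vec4 P1 S1 0 0) (vec4 P2 S2 0 0) (vec4 0 0 U V) (vec4 c 0 s 0).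
Let M2 := tet (vec4 P1 S1 0 0) (vec4 P2 S2 0 0) (vec4 0 0 U V) (vec4 c 0 (- s) 0).

Let sgDVs (x : R) : x = D * V * s -> Num.sg x = Num.sg D * Num.sg V.
Proof. by move=> ->; rewrite !sgrM (gtr0_sg s0) mulr1. Qed.

(* The half-turn about the plane of the first two coordinates maps the second
   tetrahedron to the part of the lune lying beyond its face a1 b1 a3. *)
Lemma orv_lune :
  orv (vec4 P1 S1 0 0) (vec4 P2 S2 0 0) (vec4 0 0 U V) (vec4 c 0 s 0) -
  orv (vec4 P1 S1 0 0) (vec4 P2 S2 0 0) (vec4 0 0 U V) (vec4 c 0 (- s) 0) =
  - (Num.sg D * Num.sg V * (pi / 2 * Afun (P1 * c) (P2 * c) (U * s) y)).
Proof.
(* Replacing s by -s reverses the orientation, so the difference of the oriented volumes is, up to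
   sign, the sum of the volumes. *)
have d1 : Num.sg (\det M1) = - (Num.sg D * Num.sg V).
  rewrite -(@sgDVs (- \det M1)); first by rewrite sgrN opprK.
  by rewrite det_tet /D; ring.
have d2 : Num.sg (\det M2) = Num.sg D * Num.sg V.
  by apply: sgDVs; rewrite det_tet /D; ring.
rewrite !orv.unlock !tetrahedron_orvolE -/M1 -/M2 d1 d2.
have c1 : cone M1 = halfspace n0 `&` halfspace n1 `&` halfspace n3 `&` halfspace n2.
  by rewrite cone_tetE.
pose f := @rot23 R (-1) 0.
have fi : isom4 f by apply: isom4_rot23; ring.
have fE (n n' : R4) : n'.1 = n.1 -> n'.2.1 = n.2.1 -> n'.2.2.1 = - n.2.2.1 ->
    n'.2.2.2 = - n.2.2.2 -> halfspace n' = f @^-1` (halfspace n).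
  move=> e0 e1 e2 e3; apply/seteqP.
  have e x : dot4 n' x = dot4 n (f x).
    by rewrite /f /rot23 /rot2 /dot4 /= e0 e1 e2 e3; ring.
  by split => x; rewrite /halfspace/= e.
have mT : measurable (halfspace n0 `&` halfspace n1 `&` halfspace n3).
  by do ![apply: measurableI]; exact: measurable_halfspace.
have c2 : cone M2 = f @^-1` (halfspace n0 `&` halfspace n1 `&` halfspace n3 `&`
    halfspace (opp4 n2)).
  rewrite cone_tetE ?oppr_eq0// !preimage_setI; congr (_ `&` _ `&` _ `&` _); apply: fE;
    rewrite ?oppr0//= ?opprK//; field;
    by rewrite ?V0 ?sN0 ?D0 ?(D0 : P1 * S2 - S1 * P2 != 0).
have n20 : 0 < dot4 n2 n2.
  by rewrite /dot4/= !mul0r !add0r -expr2 exprn_even_gt0// invr_eq0.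
rewrite -cvol_lune (cvol_halfspace_split mT n20) c1 c2 cvol_isom; [|exact: fi|].
  by ring.
by apply: measurableI => //; exact: measurable_halfspace.
Qed.
End volume.

End lune.

(** * The angle sums A_1 and A_2 *)

Section angles.
Variable R : realType.

(* In terms of alpha = acos a and beta = acos b, the hypothesis on c gives
   c < - cos (alpha + beta). *)
Lemma acos_sum_bounds (a b c : R) : -1 < a < 1 -> -1 < b < 1 -> -1 < c < 1 ->
  (c + a * b) ^+ 2 < (1 - a ^+ 2) * (1 - b ^+ 2) ->
  pi < acos a + acos b + acos c < 3 * pi.
Proof.
move=> /andP[a1 a2] /andP[b1 b2] /andP[c1 c2] h.
have [a0 ap] : 0 < acos a /\ acos a < pi.
  by rewrite acos_gt0 ?acos_ltpi ?ltW ?a1 ?a2.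
have [b0 bp] : 0 < acos b /\ acos b < pi.
  by rewrite acos_gt0 ?acos_ltpi ?ltW ?b1 ?b2.
have [c0 cp] : 0 < acos c /\ acos c < pi.
  by rewrite acos_gt0 ?acos_ltpi ?ltW ?c1 ?c2.
apply/andP; split; last by lra.
have [|ab] := leP pi (acos a + acos b); first by lra.
suff : pi - (acos a + acos b) < acos c by lra.
have ca : cos (acos a) = a by rewrite acosK// in_itv/= !ltW.
have cb : cos (acos b) = b by rewrite acosK// in_itv/= !ltW.
have cc : cos (acos c) = c by rewrite acosK// in_itv/= !ltW.
have e : cos (pi - (acos a + acos b)) = sin (acos a) * sin (acos b) - a * b.
  by rewrite addrC cosDpi cosN cosD ca cb; ring.
rewrite ltNge; apply/negP => hle.
have : cos (pi - (acos a + acos b)) <= cos (acos c).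
  rewrite leNgt ltr_cos ?in_itv/=; first by rewrite -leNgt.
    by apply/andP; split; lra.
  by apply/andP; split; lra.
rewrite e cc lerBlDr; apply/negP; rewrite -ltNge.
have sa : 0 <= sin (acos a) by apply: sin_ge0_pi; apply/andP; split; lra.
have sb : 0 <= sin (acos b) by apply: sin_ge0_pi; apply/andP; split; lra.
apply: (le_lt_trans (ler_norm _)).
rewrite -[ltRHS]ger0_norm ?mulr_ge0// -ltr_sqr ?nnegrE// !real_normK ?num_real//.
by rewrite exprMn !sin2cos2 ca cb.
Qed.

Lemma sgr_sub_lt (u v : R) : `|v| < `|u| -> Num.sg (u - v) = Num.sg u.
Proof.
have [u0|u0|->] := ltrgt0P u; last by rewrite ?normr0 normr_lt0.
  move=> vu; have := ler_norm v => vv.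
  by rewrite !gtr0_sg// subr_gt0 (le_lt_trans vv).
move=> vu; have := ler_norm (- v); rewrite normrN => vv.
by rewrite !ltr0_sg// subr_lt0; lra.
Qed.
End angles.

Section area.
Variables (R : realType) (p1 p2 q : R).
Let m := 1 - q ^+ 2.
Hypothesis p12 : `|p1| < `|p2|.
Hypothesis pq : p2 ^+ 2 + q ^+ 2 < 1.

Let sp : p1 ^+ 2 < p2 ^+ 2.
Proof. exact: ltr_sqr_norm. Qed.

Let A1 : 0 < m - p1 ^+ 2. Proof. by move: sp pq; rewrite /m => *; lra. Qed.
Let A2 : 0 < m - p2 ^+ 2. Proof. by move: pq; rewrite /m => *; lra. Qed.
Let m0 : 0 < m. Proof. by move: pq (sqr_ge0 p2); rewrite /m => *; lra. Qed.
Let mN0 : m != 0. Proof. by rewrite gt_eqF. Qed.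

Lemma AfunE y : Afun p1 p2 q y =
  acos ((p1 - p2 * y) / Num.sqrt ((m - p2 ^+ 2) * (1 - y ^+ 2))) +
  acos ((p2 - p1 * y) / Num.sqrt ((m - p1 ^+ 2) * (1 - y ^+ 2))) +
  acos ((m * y - p1 * p2) / Num.sqrt ((m - p1 ^+ 2) * (m - p2 ^+ 2))) - pi.
Proof.
have r0 : 0 < rcoef q by rewrite invr_gt0 sqrtr_gt0.
have r2 : rcoef q ^+ 2 = m^-1 by rewrite exprVn sqr_sqrtr// ltW.
have rp p : 1 - rcoef q ^+ 2 * p ^+ 2 = rcoef q ^+ 2 * (m - p ^+ 2).
  by rewrite r2; field.
rewrite /Afun !rp; congr (acos _ + acos _ + acos _ - _).
- by apply: (div_sqrt_scale r0); rewrite ?mulrA.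
- by apply: (div_sqrt_scale r0); rewrite ?mulrA.
- apply: (@div_sqrt_scale _ (rcoef q ^+ 2)); first by rewrite exprn_gt0.
    by rewrite r2; field.
  by ring.
Qed.

(* Up to the factor 1 - q^2, the Gram determinant of the unit vectors with
   inner products y, p1 / sqrt (1 - q^2) and p2 / sqrt (1 - q^2). *)
Let gram y := m * (1 - y ^+ 2) - p1 ^+ 2 - p2 ^+ 2 + 2 * y * p1 * p2.

Lemma gramE y : m * gram y =
  (m - p1 ^+ 2) * (m - p2 ^+ 2) - (m * y - p1 * p2) ^+ 2.
Proof. by rewrite /gram; ring. Qed.

(** Strictness comes from |p1| < |p2|: if y² = 1, a nonnegative Gram determinant would force p1 = p2
    y. *)
Lemma gram_ge0_sqr_lt1 y : 0 <= gram y -> y ^+ 2 < 1.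
Proof.
move=> g0.
have e : (m - p2 ^+ 2) * (1 - y ^+ 2) = gram y + (p1 - p2 * y) ^+ 2.
  by rewrite /gram; ring.
have : 0 <= (m - p2 ^+ 2) * (1 - y ^+ 2) by rewrite e addr_ge0// sqr_ge0.
rewrite pmulr_rge0// subr_ge0 le_eqVlt => /predU1P[y1|//].
have : gram y + (p1 - p2 * y) ^+ 2 = 0 by rewrite -e y1; ring.
move/eqP; rewrite paddr_eq0 ?sqr_ge0// sqrf_eq0 subr_eq0 => /andP[_ /eqP p1E].
by move: sp; rewrite p1E exprMn y1 mulr1 ltxx.
Qed.

(** Each arccosine has an argument x/sqrt(B) for which B - x² is a positive multiple of [gram y], so
    all three angles are strictly between 0 and [pi] and [acos_sum_bounds] applies. *)
Lemma Afun_bounds y : 0 < gram y -> 0 < Afun p1 p2 q y < 2 * pi.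
Proof.
move=> g0; have y1 := gram_ge0_sqr_lt1 (ltW g0).
have Y : 0 < 1 - y ^+ 2 by rewrite subr_gt0.
rewrite AfunE.
set B1 := (m - p1 ^+ 2); set B2 := (m - p2 ^+ 2); set y' := 1 - y ^+ 2 in Y *.
have B1_gt0 : 0 < B1 by exact: A1.
have B2_gt0 : 0 < B2 by exact: A2.
have bnd (x B : R) : 0 < B -> x ^+ 2 < B -> -1 < x / Num.sqrt B < 1.
  move=> B0 xB; have sB : 0 < Num.sqrt B by rewrite sqrtr_gt0.
  rewrite -ltr_norml normf_div (gtr0_norm sB) ltr_pdivrMr// mul1r -sqrtr_sqr.
  by rewrite ltr_sqrt.
have BY1 : 0 < B1 * y' by rewrite mulr_gt0.
have BY2 : 0 < B2 * y' by rewrite mulr_gt0.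
have B12 : 0 < B1 * B2 by rewrite mulr_gt0.
have g1 : B2 * y' - (p1 - p2 * y) ^+ 2 = gram y by rewrite /gram /B2 /y'; ring.
have g2 : B1 * y' - (p2 - p1 * y) ^+ 2 = gram y by rewrite /gram /B1 /y'; ring.
have g3 : B1 * B2 - (m * y - p1 * p2) ^+ 2 = m * gram y by rewrite gramE.
have := @acos_sum_bounds R ((p1 - p2 * y) / Num.sqrt (B2 * y'))
  ((p2 - p1 * y) / Num.sqrt (B1 * y')) ((m * y - p1 * p2) / Num.sqrt (B1 * B2)).
case/(_ _ _ _ _)/andP.
- by apply: bnd => //; rewrite -subr_gt0 g1.
- by apply: bnd => //; rewrite -subr_gt0 g2.
- by apply: bnd => //; rewrite -subr_gt0 g3 mulr_gt0.
- rewrite !sqrtrM ?ltW//.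
  have sB1 : Num.sqrt B1 ^+ 2 = B1 by rewrite sqr_sqrtr// ltW.
  have sB2 : Num.sqrt B2 ^+ 2 = B2 by rewrite sqr_sqrtr// ltW.
  have sy : Num.sqrt y' ^+ 2 = y' by rewrite sqr_sqrtr// ltW.
  have nB1 : Num.sqrt B1 != 0 by rewrite gt_eqF// sqrtr_gt0.
  have nB2 : Num.sqrt B2 != 0 by rewrite gt_eqF// sqrtr_gt0.
  have ny : Num.sqrt y' != 0 by rewrite gt_eqF// sqrtr_gt0.
  move: (Num.sqrt B1) (Num.sqrt B2) (Num.sqrt y') sB1 sB2 sy nB1 nB2 ny.
  move=> b1 b2 z sB1 sB2 sy nB1 nB2 ny.
  (* The spherical law of cosines for angles: cos γ + cos α cos β = y sin α sin β. The required
     inequality is then y² < 1. *)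
  have -> : (m * y - p1 * p2) / (b1 * b2) +
      (p1 - p2 * y) / (b2 * z) * ((p2 - p1 * y) / (b1 * z)) =
      y * gram y / (b1 * b2 * z ^+ 2).
    have -> : y * gram y = (m * y - p1 * p2) * z ^+ 2 + (p1 - p2 * y) * (p2 - p1 * y).
      by rewrite sy /gram /y'; ring.
    by field; rewrite nB1 nB2 ny.
  have -> : 1 - ((p1 - p2 * y) / (b2 * z)) ^+ 2 = gram y / (b2 * z) ^+ 2.
    by rewrite -g1 -sB2 -sy; field; rewrite nB2 ny.
  have -> : 1 - ((p2 - p1 * y) / (b1 * z)) ^+ 2 = gram y / (b1 * z) ^+ 2.
    by rewrite -g2 -sB1 -sy; field; rewrite nB1 ny.
  have -> : (y * gram y / (b1 * b2 * z ^+ 2)) ^+ 2 =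
      y ^+ 2 * (gram y / (b2 * z) ^+ 2 * (gram y / (b1 * z) ^+ 2)).
    by field; rewrite nB1 nB2 ny.
  rewrite gtr_pMl// mulr_gt0// divr_gt0// exprn_even_gt0//= mulf_neq0//.
- by move=> h1 h2; apply/andP; split; lra.
Qed.

Lemma sqr_gram y s : s ^+ 2 = 1 ->
  m * y - p1 * p2 = s * Num.sqrt ((m - p1 ^+ 2) * (m - p2 ^+ 2)) -> gram y = 0.
Proof.
move=> s1 e; apply: (mulfI mN0); rewrite gramE e exprMn s1 mul1r mulr0.
by rewrite sqr_sqrtr ?subrr// mulr_ge0 ?ltW.
Qed.

(** A vanishing Gram determinant means a degenerate triangle: every arccosine has argument 1 or -1,
    and only the signs of the numerators remain to be found. The values [s = 1] and [s = -1]
    correspond to y_max and y_min. *)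
Lemma Afun_gram0 y s : s ^+ 2 = 1 ->
  m * y - p1 * p2 = s * Num.sqrt ((m - p1 ^+ 2) * (m - p2 ^+ 2)) ->
  Afun p1 p2 q y = acos (- s * Num.sg p2) + acos (Num.sg p2) + acos s - pi.
Proof.
move=> s1 e; have g0 := sqr_gram s1 e.
have y1 : y ^+ 2 < 1 by apply: gram_ge0_sqr_lt1; rewrite g0.
have div_sgr (x B : R) : x != 0 -> B = x ^+ 2 -> x / Num.sqrt B = Num.sg x.
  move=> x0 ->; rewrite sqrtr_sqr {1}(numEsg x) mulfK ?normr_eq0//.
have yn : `|y| < 1.
  by rewrite -(expr_lt1 (n := 2))// real_normK// num_real.
have sgs : Num.sg (s * p2) = s * Num.sg p2.
  rewrite sgrM; congr (_ * _); move/eqP: s1; rewrite sqrf_eq1 => /orP[]/eqP ->.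
    by rewrite sgr1.
  by rewrite sgrN1.
have sg2 : Num.sg (p2 - p1 * y) = Num.sg p2.
  apply: sgr_sub_lt; rewrite normrM; apply: le_lt_trans p12.
  by rewrite ler_piMr// ltW.
have p20 : p2 != 0 by rewrite -normr_gt0; apply: le_lt_trans p12.
have sg1 : Num.sg (p1 - p2 * y) = - s * Num.sg p2.
  (* Multiplying by m > 0 allows [m * y] to be replaced by means of [e]. The term with p2 then
     dominates, because |p1| sqrt(m - p2²) < |p2| sqrt(m - p1²). *)
  rewrite -[LHS]mul1r -(gtr0_sg m0) -sgrM.
  have -> : m * (p1 - p2 * y) =
      - (s * p2 * Num.sqrt ((m - p1 ^+ 2) * (m - p2 ^+ 2)) - p1 * (m - p2 ^+ 2)).
    have -> : s * p2 * Num.sqrt ((m - p1 ^+ 2) * (m - p2 ^+ 2)) = p2 * (m * y - p1 * p2).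
      by rewrite e; ring.
    by ring.
  rewrite sgrN sgr_sub_lt.
    by rewrite sgrM sgs (gtr0_sg (x := Num.sqrt _)) ?mulr1 ?mulNr// sqrtr_gt0 mulr_gt0.
  have sn : `|s| = 1 by apply/eqP; rewrite -sqrp_eq1// real_normK ?num_real// s1.
  rewrite !normrM sn mul1r (ger0_norm (sqrtr_ge0 _)) (gtr0_norm A2).
  rewrite sqrtrM ?ltW// -{1}(sqr_sqrtr (ltW A2)) expr2 !mulrA ltr_pM2r ?sqrtr_gt0//.
  apply: (@le_lt_trans _ _ (`|p1| * Num.sqrt (m - p1 ^+ 2))).
    by rewrite ler_wpM2l// ler_wsqrtr// lerD2l lerN2 ltW.
  by rewrite ltr_pM2r// sqrtr_gt0.
rewrite AfunE e.
rewrite (div_sgr (p1 - p2 * y)); first last.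
- have : (m - p2 ^+ 2) * (1 - y ^+ 2) = gram y + (p1 - p2 * y) ^+ 2.
    by rewrite /gram; ring.
  by rewrite g0 add0r.
- by rewrite -sgr_eq0 sg1 mulf_neq0// ?sgr_eq0// oppr_eq0 -sqrf_eq0 s1 oner_eq0.
rewrite (div_sgr (p2 - p1 * y)); first last.
- have : (m - p1 ^+ 2) * (1 - y ^+ 2) = gram y + (p2 - p1 * y) ^+ 2.
    by rewrite /gram; ring.
  by rewrite g0 add0r.
- by rewrite -sgr_eq0 sg2 sgr_eq0.
by rewrite sg1 sg2 mulfK// gt_eqF// sqrtr_gt0 mulr_gt0.
Qed.

End area.

Section claims.
Variables (R : realType) (p1 p2 q1 q2 : R).
Hypothesis hp : `|p1| < `|p2|.
Hypothesis hq : `|q1| < `|q2|.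
Hypothesis hpq : p2 ^+ 2 + q2 ^+ 2 < 1.

Let q12 : q1 ^+ 2 < q2 ^+ 2.
Proof. exact: ltr_sqr_norm. Qed.

Let p12 : p1 ^+ 2 < p2 ^+ 2.
Proof. exact: ltr_sqr_norm. Qed.

Let hpq1 : p2 ^+ 2 + q1 ^+ 2 < 1.
Proof. by move: q12 hpq => *; lra. Qed.

Let m := 1 - q2 ^+ 2.
Let T := Num.sqrt ((1 - q2 ^+ 2 - p1 ^+ 2) * (1 - q2 ^+ 2 - p2 ^+ 2)).

Let m0 : 0 < m. Proof. by move: hpq (sqr_ge0 p2); rewrite /m => *; lra. Qed.
Let mN0 : m != 0. Proof. by rewrite gt_eqF. Qed.

Let T0 : 0 <= T. Proof. exact: sqrtr_ge0. Qed.
Let T2 : T ^+ 2 = (m - p1 ^+ 2) * (m - p2 ^+ 2).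
Proof.
by rewrite sqr_sqrtr// mulr_ge0//; move: p12 hpq => *; lra.
Qed.

Let gram2 y : `|m * y - p1 * p2| <= T ->
  0 <= m * (1 - y ^+ 2) - p1 ^+ 2 - p2 ^+ 2 + 2 * y * p1 * p2.
Proof.
move=> h; rewrite -(pmulr_rge0 _ m0) gramE -T2 subr_ge0.
by rewrite -(real_normK (num_real (_ - _))) ler_sqr ?nnegrE.
Qed.

Let gram2_lt y : `|m * y - p1 * p2| < T ->
  0 < m * (1 - y ^+ 2) - p1 ^+ 2 - p2 ^+ 2 + 2 * y * p1 * p2.
Proof.
move=> h; rewrite -(pmulr_rgt0 _ m0) gramE -T2 subr_gt0.
by rewrite -(real_normK (num_real (_ - _))) ltr_sqr ?nnegrE.
Qed.

(** The Gram determinant for q1 exceeds that for q2 by (q2² - q1²)(1 - y²) > 0, so it is positive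
    even at the end points, where the one for q2 vanishes. *)
Lemma Afun1_bounds y : ymin p1 p2 q2 <= y <= ymax p1 p2 q2 ->
  0 < Afun p1 p2 q1 y < 2 * pi.
Proof.
rewrite /ymin /ymax -/m -/T ler_pdivrMr// ler_pdivlMr// => /andP[h1 h2].
have g2 : 0 <= m * (1 - y ^+ 2) - p1 ^+ 2 - p2 ^+ 2 + 2 * y * p1 * p2.
  by apply: gram2; rewrite ler_norml; apply/andP; split; lra.
apply: Afun_bounds => //; apply: (le_lt_trans g2).
have y1 := gram_ge0_sqr_lt1 hp hpq g2.
rewrite -subr_gt0 [ltRHS](_ : _ = (q2 ^+ 2 - q1 ^+ 2) * (1 - y ^+ 2)).
  by rewrite mulr_gt0// subr_gt0.
by rewrite /m; ring.
Qed.

Lemma Afun2_bounds y : ymin p1 p2 q2 < y < ymax p1 p2 q2 ->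
  0 < Afun p1 p2 q2 y < 2 * pi.
Proof.
rewrite /ymin /ymax -/m -/T ltr_pdivrMr// ltr_pdivlMr// => /andP[h1 h2].
apply: Afun_bounds => //; apply: gram2_lt.
by rewrite ltr_norml; apply/andP; split; lra.
Qed.

Let p2N0 : p2 != 0. Proof. by rewrite -normr_gt0; apply: le_lt_trans hp. Qed.

Lemma Afun2_ymax : Afun p1 p2 q2 (ymax p1 p2 q2) = 0.
Proof.
rewrite (@Afun_gram0 _ _ _ _ hp hpq _ 1) ?expr1n//.
  rewrite acos1 addr0 mulN1r; have [s0|s0|s0] := ltrgt0P p2.
  - by rewrite gtr0_sg// acos1 acosN1 addr0 subrr.
  - by rewrite ltr0_sg// opprK acos1 acosN1 add0r subrr.
  - by move: p2N0; rewrite s0 eqxx.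
by rewrite /ymax -/m -/T; field.
Qed.

(** For p2 > 0 the triangle collapses to an arc of area 0. For p2 < 0 all three angles are π: its
    vertices go round a great circle and its area is that of a hemisphere, 2π. *)
Lemma Afun2_ymin : Afun p1 p2 q2 (ymin p1 p2 q2) = (1 - Num.sg p2) * pi.
Proof.
rewrite (@Afun_gram0 _ _ _ _ hp hpq _ (-1)) ?sqrrN ?expr1n//.
  rewrite acosN1 addrK opprK mul1r; have [s0|s0|s0] := ltrgt0P p2.
  - by rewrite gtr0_sg// acos1 addr0 subrr mul0r.
  - by rewrite ltr0_sg// acosN1; ring.
  - by move: p2N0; rewrite s0 eqxx.
by rewrite /ymin -/m -/T; field.
Qed.

End claims.

(** * Decomposition of the octahedron *)

Section octahedron.
Variable R : realType.
Notation R4 := (V4 R).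
Notation cvol := (@cone_volume R).
Implicit Types (a b o : 'rV[R]_4).

Definition vtx (x : bool) (a b : 'rV[R]_4) := if x then b else a.

Definition oct a1 b1 a2 b2 a3 b3 o : R :=
  orv o a1 a2 a3 - orv o b1 a2 a3 - orv o a1 b2 a3 + orv o b1 b2 a3
  - orv o a1 a2 b3 + orv o b1 a2 b3 + orv o a1 b2 b3 - orv o b1 b2 b3.

Section faces.
Variables a1 b1 a2 b2 a3 b3 : 'rV[R]_4.

Definition face_set (t : bool * bool * bool) : {set 'I_3} :=
  [set i : 'I_3 | nth false [:: t.1.1; t.1.2; t.2] i].

Lemma face_cone_tet o t :
  face_cone (triple a1 a2 a3) (triple b1 b2 b3) o (face_set t) =
  tet o (vtx t.1.1 a1 b1) (vtx t.1.2 a2 b2) (vtx t.2 a3 b3).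
Proof.
pose M : 'M[R]_(3, 4) :=
  \matrix_(i < 3) (if i \in face_set t then triple b1 b2 b3 i else triple a1 a2 a3 i).
have u0 k : face_cone (triple a1 a2 a3) (triple b1 b2 b3) o (face_set t)
    (@lshift 1 3 ord0) k = o 0 k by exact: (@col_mxEu _ 1 3 4 o M).
have u1 j k : face_cone (triple a1 a2 a3) (triple b1 b2 b3) o (face_set t)
    (@rshift 1 3 j) k = M j k by exact: (@col_mxEd _ 1 3 4 o M).
apply/matrixP => i k; rewrite [RHS]mxE.
case: i => -[|[|[|[|//]]]] hi.
- by rewrite (_ : Ordinal hi = @lshift 1 3 ord0) ?u0//; exact: val_inj.
- rewrite (_ : Ordinal hi = @rshift 1 3 ord0) ?u1; last exact: val_inj.
  by rewrite mxE inE; case: t.1.1.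
- rewrite (_ : Ordinal hi = @rshift 1 3 (lift ord0 ord0)) ?u1; last exact: val_inj.
  by rewrite mxE inE; case: t.1.2.
- rewrite (_ : Ordinal hi = @rshift 1 3 (lift ord0 (lift ord0 ord0))) ?u1; last exact: val_inj.
  by rewrite mxE inE; case: t.2.
Qed.

Lemma face_set_bij : bijective face_set.
Proof.
exists (fun s : {set 'I_3} =>
  (ord0 \in s, lift ord0 ord0 \in s, lift ord0 (lift ord0 ord0) \in s)).
  by move=> [[x y] z]; rewrite /face_set !inE.
move=> s; apply/setP => i; rewrite inE /=.
by case: i => -[|[|[|//]]] hi; congr (_ \in s); exact: val_inj.
Qed.

Lemma card_face_set t : #|face_set t| = (t.1.1 + t.1.2 + t.2)%N.
Proof.
rewrite -sum1dep_card big_mkcond /= !big_ord_recl big_ord0 /= addn0 addnA.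
by case: t => [[x y] z] /=; case: x; case: y; case: z.
Qed.

Lemma octahedron_orvol_fromE o :
  octahedron_orvol_from (triple a1 a2 a3) (triple b1 b2 b3) o =
  oct a1 b1 a2 b2 a3 b3 o.
Proof.
rewrite /octahedron_orvol_from (reindex face_set); last first.
  exact: onW_bij face_set_bij.
pose G (x y z : bool) := (-1) ^+ (x + y + z) *
  orv o (vtx x a1 b1) (vtx y a2 b2) (vtx z a3 b3).
transitivity (\sum_(t : bool * bool * bool) G t.1.1 t.1.2 t.2).
  apply: eq_bigr => t _; rewrite card_face_set /G orv.unlock.
  by rewrite -face_cone_tet.
rewrite -(pair_bigA _ (fun xy z => G xy.1 xy.2 z)) /=.
rewrite -(pair_bigA _ (fun x y => \sum_z G x y z)) /=.
rewrite !big_bool /G /oct /vtx /=.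
by rewrite !addn0 !add0n expr0 !expr1; ring.
Qed.

Lemma generic_apexE o :
  generic_apex (triple a1 a2 a3) (triple b1 b2 b3) o <-> sphere3 o /\
  forall x y z, \det (tet o (vtx x a1 b1) (vtx y a2 b2) (vtx z a3 b3)) != 0.
Proof.
have [g gK1 gK2] := face_set_bij.
split=> -[so h]; split => //.
  by move=> x y z; have := h (face_set (x, y, z)); rewrite face_cone_tet.
by move=> s; rewrite -(gK2 s) face_cone_tet.
Qed.

(** Summing the five-point relation for o', o and a face over the eight faces: a term with both
    apexes belongs to an edge, shared by two faces in which it has opposite signs, and cancels. *)
Lemma oct_change_apex o o' :
  (forall x y z, \det (tet o (vtx x a1 b1) (vtx y a2 b2) (vtx z a3 b3)) != 0) ->
  (forall x y z, \det (tet o' (vtx x a1 b1) (vtx y a2 b2) (vtx z a3 b3)) != 0) ->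
  (forall y z, \det (tet o' o (vtx y a2 b2) (vtx z a3 b3)) != 0) ->
  (forall x z, \det (tet o' o (vtx x a1 b1) (vtx z a3 b3)) != 0) ->
  (forall x y, \det (tet o' o (vtx x a1 b1) (vtx y a2 b2)) != 0) ->
  eq_mod_2pi2 (oct a1 b1 a2 b2 a3 b3 o - oct a1 b1 a2 b2 a3 b3 o') 0.
Proof.
move=> h h' h23 h13 h12.
pose B x y z := orv_boundary o' o (vtx x a1 b1) (vtx y a2 b2) (vtx z a3 b3).
have B0 x y z : eq_mod_2pi2 (B x y z) 0 by exact: orv_boundary_generic.
rewrite (_ : _ - _ = B false false false - B true false false - B false true false
  + B true true false - B false false true + B true false true
  + B false true true - B true true true).
  move: B B0 => B B0.
  have mB x y z w : eq_mod_2pi2 w 0 -> eq_mod_2pi2 (w - B x y z) 0.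
    by move=> hw; exact: eq_mod0B.
  have pB x y z w : eq_mod_2pi2 w 0 -> eq_mod_2pi2 (w + B x y z) 0.
    by move=> hw; exact: eq_mod0D.
  by apply/mB/pB/pB/mB/pB/mB/mB/B0.
rewrite /B /orv_boundary /vtx /oct /=; ring.
Qed.

(** The octahedron is cut into four tetrahedra around its diagonal a1 b1; the terms o a1 b1 u, with
    u one of the other four vertices, cancel in pairs. *)
Lemma oct_cut o :
  oct a1 b1 a2 b2 a3 b3 o =
  orv_boundary o a1 b1 a2 a3 - orv_boundary o a1 b1 a2 b3
  - (orv_boundary o a1 b1 b2 a3 - orv_boundary o a1 b1 b2 b3)
  - (orv a1 b1 a2 a3 - orv a1 b1 a2 b3) + (orv a1 b1 b2 a3 - orv a1 b1 b2 b3).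
Proof. by rewrite /oct /orv_boundary; ring. Qed.

End faces.

Definition det_form (c : 'rV[R]_4 * 'rV[R]_4 * 'rV[R]_4) : R4 :=
  of_row (\row_j cofactor (tet 0 c.1.1 c.1.2 c.2) ord0 j).

Lemma dot4_det_form c x : dot4 (det_form c) x = \det (tet (row_of x) c.1.1 c.1.2 c.2).
Proof.
rewrite dot4_of_row (expand_det_row _ ord0); apply: eq_bigr => j _.
rewrite mulrC; congr (_ * _); first by rewrite [RHS]mxE.
rewrite mxE /cofactor; congr (_ * \det _); apply/matrixP => k l.
by rewrite !mxE.
Qed.

(* Hyperplanes have measure zero, so finitely many do not cover the space. *)
Lemma exists_generic_vector (cs : seq ('rV[R]_4 * 'rV[R]_4 * 'rV[R]_4)) :
  (forall c, c \in cs -> exists x, \det (tet x c.1.1 c.1.2 c.2) != 0) ->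
  exists x, forall c, c \in cs -> \det (tet x c.1.1 c.1.2 c.2) != 0.
Proof.
move=> h.
have pos c : c \in cs -> 0 < dot4 (det_form c) (det_form c).
  move=> /h[x dx]; apply: of_row_neq0; apply: contraNneq dx => c0.
  by rewrite -(of_rowK x) -dot4_det_form dot4_of_row c0 big1// => i _; rewrite mxE mul0r.
have : cvol (\big[setU/set0]_(c <- cs | c \in cs) hyperplane (det_form c)) = 0.
  apply: cvol_bigU0 => c ccs; first exact: measurable_hyperplane.
  by rewrite cvol_hyperplane// pos.
rewrite -bigcup_seq_cond => U0.
have [x Ux] : exists x, ~ (\bigcup_(c in [set x | (x \in cs) && (x \in cs)])
    hyperplane (det_form c)) x.
  apply: contrapT => nU; move: U0; rewrite (_ : \bigcup_(_ in _) _ = setT).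
    by rewrite cvolT => /eqP; rewrite gt_eqF// mulr_gt0// exprn_gt0// pi_gt0.
  apply/seteqP; split => // x _.
  by apply: contrapT => Ux; apply: nU; exists x.
exists (row_of x) => c ccs; apply/eqP => dc; apply: Ux.
by exists c; rewrite /= ?ccs// /hyperplane/= dot4_det_form.
Qed.

Lemma det_tet_scale (t : R) (x c1 c2 c3 : 'rV[R]_4) :
  \det (tet (t *: x) c1 c2 c3) = t * \det (tet x c1 c2 c3).
Proof.
rewrite -[x]of_rowK -!(dot4_det_form (c1, c2, c3)) /=.
have -> : t *: row_of (of_row x) = row_of (of_row (t *: x)) by rewrite !of_rowK.
rewrite -(dot4_det_form (c1, c2, c3)) !dot4_of_row mulr_sumr.
by apply: eq_bigr => i _; rewrite !of_rowK [(t *: x) 0 i]mxE; ring.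
Qed.

Lemma det_tet_swap1 (x o c2 c3 : 'rV[R]_4) :
  \det (tet x o c2 c3) = - \det (tet o x c2 c3).
Proof.
by rewrite -(of_rowK x) -(of_rowK o) -(of_rowK c2) -(of_rowK c3) /row_of !det_tet; ring.
Qed.

Lemma det_tet_swap2 (x o c1 c3 : 'rV[R]_4) :
  \det (tet x o c1 c3) = \det (tet o c1 x c3).
Proof.
by rewrite -(of_rowK x) -(of_rowK o) -(of_rowK c1) -(of_rowK c3) /row_of !det_tet; ring.
Qed.

Lemma det_tet_swap3 (x o c1 c2 : 'rV[R]_4) :
  \det (tet x o c1 c2) = - \det (tet o c1 c2 x).
Proof.
by rewrite -(of_rowK x) -(of_rowK o) -(of_rowK c1) -(of_rowK c2) /row_of !det_tet; ring.
Qed.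

End octahedron.

(** * Generic apexes and the flat configuration *)

Section core.
Variable R : realType.

(** With S = V = 0 the three vertices would lie in one coordinate plane and be dependent. Otherwise
    a coordinate vector completes them to a basis; which one depends on whether V or S vanishes. *)
Lemma face_witness (P S U V c t : R) : P ^+ 2 + S ^+ 2 = 1 -> U ^+ 2 + V ^+ 2 = 1 ->
  c != 0 -> t != 0 -> (S != 0) || (V != 0) ->
  exists x, \det (tet x (vec4 P S 0 0) (vec4 0 0 U V) (vec4 c 0 t 0)) != 0.
Proof.
move=> PS UV c0 t0 SV.
have nz (x z : R) : x ^+ 2 + z ^+ 2 = 1 -> z = 0 -> x != 0.
  by move=> + z0; apply: contra_eq_neq => ->; rewrite z0 !expr0n/= addr0 eq_sym oner_eq0.
have [V0|V0] := eqVneq V 0.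
  exists (vec4 0 0 0 1); rewrite det_tet.
  rewrite [X in X != 0](_ : _ = - (S * U * c)); last by rewrite V0; ring.
  rewrite oppr_eq0 !mulf_neq0//; last exact: nz UV V0.
  by move: SV; rewrite V0 eqxx orbF.
have [S0|S0] := eqVneq S 0.
  exists (vec4 0 1 0 0); rewrite det_tet.
  rewrite [X in X != 0](_ : _ = P * V * t); last by rewrite S0; ring.
  by rewrite !mulf_neq0//; exact: nz PS S0.
exists (vec4 0 0 1 0); rewrite det_tet.
rewrite [X in X != 0](_ : _ = S * V * c); last by ring.
by rewrite !mulf_neq0.
Qed.

Lemma plane_witness (P1 S1 P2 S2 w0 w1 w2 w3 : R) : P1 * S2 - S1 * P2 != 0 ->
  (w2 != 0) || (w3 != 0) ->
  exists x, \det (tet x (vec4 P1 S1 0 0) (vec4 P2 S2 0 0) (vec4 w0 w1 w2 w3)) != 0.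
Proof.
move=> D0 /orP[w|w].
  exists (vec4 0 0 0 1); rewrite det_tet.
  rewrite [X in X != 0](_ : _ = - ((P1 * S2 - S1 * P2) * w2)); last by ring.
  by rewrite oppr_eq0 mulf_neq0.
exists (vec4 0 0 1 0); rewrite det_tet.
rewrite [X in X != 0](_ : _ = (P1 * S2 - S1 * P2) * w3); last by ring.
by rewrite mulf_neq0.
Qed.

Section super_generic.
Variables a1 b1 a2 b2 a3 b3 : 'rV[R]_4.
Hypothesis facesP : forall x y z, exists v,
  \det (tet v (vtx x a1 b1) (vtx y a2 b2) (vtx z a3 b3)) != 0.

Let faces : seq ('rV[R]_4 * 'rV[R]_4 * 'rV[R]_4) :=
  codom (fun t : bool * bool * bool =>
    (vtx t.1.1 a1 b1, vtx t.1.2 a2 b2, vtx t.2 a3 b3)).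

Lemma exists_generic_apex :
  exists o, generic_apex (triple a1 a2 a3) (triple b1 b2 b3) o.
Proof.
have [|x hx] := @exists_generic_vector R faces.
  by move=> c /codomP[t ->] /=; exact: facesP.
have hx' u v w : \det (tet x (vtx u a1 b1) (vtx v a2 b2) (vtx w a3 b3)) != 0.
  by apply: (hx (_, _, _)); apply/codomP; exists (u, v, w).
have x0 : x != 0.
  have := hx' false false false; apply: contraNneq => ->.
  by rewrite -(scale0r (0 : 'rV[R]_4)) det_tet_scale mul0r.
have d0 := dotv_gt0 x0.
exists ((Num.sqrt (dotv x x))^-1 *: x); apply/generic_apexE; split.
  by rewrite /sphere3/= dotvZ exprVn sqr_sqrtr ?ltW// mulVf// gt_eqF.
by move=> u v w; rewrite det_tet_scale mulf_neq0// invr_eq0 gt_eqF// sqrtr_gt0.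
Qed.

Hypothesis planeP : forall w, [\/ w = a2, w = b2, w = a3 | w = b3] -> exists v,
  \det (tet v a1 b1 w) != 0.

(** The new apex avoids three families of hyperplanes: those of the faces, those through [o] and an
    edge, which justify the change of apex, and those through a1, b1 and another vertex, which
    justify cutting along the diagonal. *)
Lemma exists_second_apex o :
  (forall x y z, \det (tet o (vtx x a1 b1) (vtx y a2 b2) (vtx z a3 b3)) != 0) ->
  exists o', [/\
    eq_mod_2pi2 (oct a1 b1 a2 b2 a3 b3 o - oct a1 b1 a2 b2 a3 b3 o') 0,
    forall x y z, \det (tet o' (vtx x a1 b1) (vtx y a2 b2) (vtx z a3 b3)) != 0 &
    forall w, [\/ w = a2, w = b2, w = a3 | w = b3] -> \det (tet o' a1 b1 w) != 0].
Proof.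
move=> ho.
pose e23 := codom (fun t : bool * bool => (o, vtx t.1 a2 b2, vtx t.2 a3 b3)).
pose e13 := codom (fun t : bool * bool => (o, vtx t.1 a1 b1, vtx t.2 a3 b3)).
pose e12 := codom (fun t : bool * bool => (o, vtx t.1 a1 b1, vtx t.2 a2 b2)).
pose pl := [seq (a1, b1, w) | w <- [:: a2; b2; a3; b3]].
have [|o' h] := @exists_generic_vector R (faces ++ e23 ++ e13 ++ e12 ++ pl).
  move=> c; rewrite !mem_cat => /or4P[|||/orP[]].
  - by move=> /codomP[t ->] /=; exact: facesP.
  (* That [o] and an edge span a hyperplane is witnessed by the third vertex of a face on that edge,
     since [o] is generic for this face; likewise in the next two cases. *)
  - move=> /codomP[t ->] /=; exists a1; rewrite det_tet_swap1 oppr_eq0.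
    exact: (ho false).
  - move=> /codomP[t ->] /=; exists a2; rewrite det_tet_swap2.
    exact: (ho _ false).
  - move=> /codomP[t ->] /=; exists a3; rewrite det_tet_swap3 oppr_eq0.
    exact: (ho _ _ false).
  - move=> /mapP[w]; rewrite !inE => hw -> /=; apply: planeP.
    by case/or4P: hw => /eqP ->; [constructor 1|constructor 2|constructor 3|constructor 4].
have hf x y z : \det (tet o' (vtx x a1 b1) (vtx y a2 b2) (vtx z a3 b3)) != 0.
  apply: (h (_, _, _)); rewrite !mem_cat; apply/orP; left.
  by apply/codomP; exists (x, y, z).
exists o'; split => //.
  apply: oct_change_apex => //.
  - move=> y z; apply: (h (_, _, _)); rewrite !mem_cat.
    by apply/or4P; constructor 2; apply/codomP; exists (y, z).
  - move=> x z; apply: (h (_, _, _)); rewrite !mem_cat.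
    by apply/or4P; constructor 3; apply/codomP; exists (x, z).
  - move=> x y; apply: (h (_, _, _)); rewrite !mem_cat.
    by apply/or4P; constructor 4; apply/orP; left; apply/codomP; exists (x, y).
move=> w hw; apply: (h (_, _, _)); rewrite !mem_cat.
apply/or4P; constructor 4; apply/orP; right; apply/mapP; exists w => //.
by rewrite !inE; case: hw => ->; rewrite eqxx ?orbT.
Qed.

End super_generic.

Lemma has_mixed (l : seq R) x y : x \in l -> y \in l -> x * y < 0 ->
  has (fun x => 0 < x) l /\ has (fun x => x < 0) l.
Proof.
move=> xl yl; have [x0|x0|->] := ltrgt0P x; last by rewrite mul0r ltxx.
  rewrite pmulr_rlt0// => y0; split; apply/hasP; first by exists x.
  by exists y.
rewrite nmulr_rlt0// => y0; split; apply/hasP; first by exists y.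
by exists x.
Qed.

Section flat.
Variables (P1 S1 P2 S2 U c t : R) (o : 'rV[R]_4).
Let D := P1 * S2 - S1 * P2.
Let B := orv_boundary o (vec4 P1 S1 0 0) (vec4 P2 S2 0 0) (vec4 0 0 U 0) (vec4 c 0 t 0).
Hypothesis c0 : 0 < c.
Hypothesis U0 : U != 0.
Hypothesis od : \det (tet o (vec4 P1 S1 0 0) (vec4 P2 S2 0 0) (vec4 0 0 U 0)) != 0.

(** The four vertices have last coordinate 0, so the determinants with [o] all contain this height
    of [o] as a factor. *)
Let z := (of_row o).2.2.2.

(* The coefficients of the four points in the linear relation between them. *)
Let l := [:: z * (S2 * U * c); - z * (S1 * U * c); z * (D * t); - z * (D * U)].

Let flat :
  [/\ has (fun x => 0 < x) l -> has (fun x => x < 0) l -> B = 0,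
      all (fun x => 0 < x) l -> B = pi ^+ 2 &
      all (fun x => x < 0) l -> B = - pi ^+ 2].
Proof.
have := @orv_boundary_flat R o (vec4 P1 S1 0 0) (vec4 P2 S2 0 0)
  (vec4 0 0 U 0) (vec4 c 0 t 0).
have oE : o = vec4 (of_row o).1 (of_row o).2.1 (of_row o).2.2.1 z.
  by rewrite -[LHS]of_rowK.
rewrite -/B oE !det_tet => H.
have [|h1 h2 h3] := H; first by ring.
move: h1 h2 h3.
rewrite (_ : [:: _; _; _; _] = l) // /l.
by congr [:: _; _; _; _]; rewrite /D; ring.
Qed.

Let det_neq0 : [/\ z != 0, D != 0 & U != 0].
Proof.
have := od; rewrite -(of_rowK o) /row_of det_tet -/z.
rewrite [X in X != 0](_ : _ = - z * (D * U)); last by rewrite /D; ring.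
by rewrite mulNr oppr_eq0 !mulf_eq0 !negb_or => /and3P[].
Qed.

Let z2 : 0 < z ^+ 2.
Proof. by have [z0 _ _] := det_neq0; rewrite exprn_even_gt0. Qed.

Let mul3_gt0 (u v w : R) : 0 < u -> 0 < v -> 0 < w -> 0 < u * v * w.
Proof. by move=> u0 v0 w0; rewrite !mulr_gt0. Qed.

Let Uc2 : 0 < (U * c) ^+ 2.
Proof. by rewrite exprn_even_gt0//= mulf_neq0// gt_eqF. Qed.

Let D2 : 0 < D ^+ 2.
Proof. by have [_ D0 _] := det_neq0; rewrite exprn_even_gt0. Qed.

(** Coefficients of both signs in the relation make the boundary vanish; the next three lemmas each
    exhibit such a pair. *)
Let mixed (x y : R) : x \in l -> y \in l -> x * y < 0 -> B = 0.
Proof.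
by move=> xl yl /(has_mixed xl yl)[h1 h2]; have [h _ _] := flat; exact: h.
Qed.

Lemma flat_same_side : 0 < S1 * S2 -> B = 0.
Proof.
move=> S12; apply: (@mixed (z * (S2 * U * c)) (- z * (S1 * U * c))).
- by rewrite !inE eqxx.
- by rewrite !inE eqxx orbT.
- rewrite [ltLHS](_ : _ = - (z ^+ 2 * (U * c) ^+ 2 * (S1 * S2))); last by ring.
  by rewrite oppr_lt0 mul3_gt0.
Qed.

Lemma flat_same_sign : 0 < t * U -> B = 0.
Proof.
move=> tU; apply: (@mixed (z * (D * t)) (- z * (D * U))).
- by rewrite !inE eqxx !orbT.
- by rewrite !inE eqxx !orbT.
- rewrite [ltLHS](_ : _ = - (z ^+ 2 * D ^+ 2 * (t * U))); last by ring.
  by rewrite oppr_lt0 mul3_gt0.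
Qed.

Lemma flat_opposite : t * U < 0 -> 0 < D * S2 -> B = 0.
Proof.
move=> tU DS; apply: (@mixed (z * (S2 * U * c)) (z * (D * t))).
- by rewrite !inE eqxx.
- by rewrite !inE eqxx !orbT.
- rewrite [ltLHS](_ : _ = (z ^+ 2 * c * (D * S2)) * (t * U)); last by ring.
  by rewrite pmulr_rlt0// mul3_gt0.
Qed.

(** The three conditions link entries 1 and 2, 3 and 4, 1 and 3 of [l], so that all four have the
    same sign. That sign is the one of [x], which depends on the side of [o]. *)
Lemma flat_surround : S1 * S2 < 0 -> t * U < 0 -> D * S2 < 0 ->
  B = pi ^+ 2 \/ B = - pi ^+ 2.
Proof.
move=> S12 tU DS; have [_ h2 h3] := flat.
set x := z * (S2 * U * c) in h2 h3.
have xy : 0 < x * (- z * (S1 * U * c)).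
  rewrite [ltRHS](_ : _ = z ^+ 2 * (U * c) ^+ 2 * - (S1 * S2)); last by rewrite /x; ring.
  by rewrite mul3_gt0// oppr_gt0.
have xv : 0 < x * (z * (D * t)).
  rewrite [ltRHS](_ : _ = z ^+ 2 * c * (- (D * S2) * - (t * U))); last by rewrite /x; ring.
  by apply: mul3_gt0 => //; rewrite mulr_gt0 ?oppr_gt0.
have vw : 0 < (z * (D * t)) * (- z * (D * U)).
  rewrite [ltRHS](_ : _ = z ^+ 2 * D ^+ 2 * - (t * U)); last by ring.
  by rewrite mul3_gt0// oppr_gt0.
have [x0|x0|x0] := ltrgt0P x; last by rewrite x0 mul0r ltxx in xy.
  left; apply: h2; rewrite /= x0 -(pmulr_rgt0 _ x0) xy.
  have v0 : 0 < z * (D * t) by rewrite -(pmulr_rgt0 _ x0).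
  by rewrite v0 -(pmulr_rgt0 _ v0) vw.
right; apply: h3; rewrite /= x0 -(nmulr_rgt0 _ x0) xy.
have v0 : z * (D * t) < 0 by rewrite -(nmulr_rgt0 _ x0).
by rewrite v0 -(nmulr_rgt0 _ v0) vw.
Qed.

End flat.

End core.

(** * The volume of the octahedron modulo 2π² *)

Section octahedron_volume.
Variables (R : realType) (P1 S1 P2 S2 U1 V1 U2 V2 c s : R).
Let D := P1 * S2 - S1 * P2.
Let y := P1 * P2 + S1 * S2.
Hypothesis PS1 : P1 ^+ 2 + S1 ^+ 2 = 1.
Hypothesis PS2 : P2 ^+ 2 + S2 ^+ 2 = 1.
Hypothesis UV1 : U1 ^+ 2 + V1 ^+ 2 = 1.
Hypothesis UV2 : U2 ^+ 2 + V2 ^+ 2 = 1.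
Hypothesis cs : c ^+ 2 + s ^+ 2 = 1.
Hypothesis c0 : 0 < c.
Hypothesis s0 : 0 < s.
Hypothesis D0 : D != 0.
Hypothesis V10 : V1 != 0.
Hypothesis q11 : 0 < 1 - (U1 * s) ^+ 2 - (P1 * c) ^+ 2.
Hypothesis q12 : 0 < 1 - (U1 * s) ^+ 2 - (P2 * c) ^+ 2.
Hypothesis q21 : 0 < 1 - (U2 * s) ^+ 2 - (P1 * c) ^+ 2.
Hypothesis q22 : 0 < 1 - (U2 * s) ^+ 2 - (P2 * c) ^+ 2.

Let a1 := vec4 P1 S1 0 0.
Let b1 := vec4 P2 S2 0 0.
Let a2 := vec4 0 0 U1 V1.
Let b2 := vec4 0 0 U2 V2.
Let a3 := vec4 c 0 s 0.
Let b3 := vec4 c 0 (- s) 0.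
Let A1 := Afun (P1 * c) (P2 * c) (U1 * s) y.
Let A2 := Afun (P1 * c) (P2 * c) (U2 * s) y.

Let cN0 : c != 0. Proof. by rewrite gt_eqF. Qed.
Let sN0 : s != 0. Proof. by rewrite gt_eqF. Qed.

(** If S = V = 0, then P² = U² = 1 and the positive quantity would be 1 - s² - c² = 0. *)
Let degenerate_bound (P S U V : R) : P ^+ 2 + S ^+ 2 = 1 -> U ^+ 2 + V ^+ 2 = 1 ->
  0 < 1 - (U * s) ^+ 2 - (P * c) ^+ 2 -> (S != 0) || (V != 0).
Proof.
move=> PS UV; have [S0|//] := eqVneq S 0; have [V0|//] := eqVneq V 0.
rewrite !exprMn (_ : U ^+ 2 = 1); last by rewrite -UV V0; ring.
rewrite (_ : P ^+ 2 = 1); last by rewrite -PS S0; ring.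
by move=> h; exfalso; move: cs h => *; lra.
Qed.

Let facesP u v w : exists x,
  \det (tet x (vtx u a1 b1) (vtx v a2 b2) (vtx w a3 b3)) != 0.
Proof.
by case: u; case: v; case: w; apply: face_witness => //; rewrite ?oppr_eq0//;
  first [exact: (degenerate_bound PS1 UV1)|exact: (degenerate_bound PS1 UV2)
        |exact: (degenerate_bound PS2 UV1)|exact: (degenerate_bound PS2 UV2)].
Qed.

Lemma octahedron_generic_apex :
  exists o, generic_apex (triple a1 a2 a3) (triple b1 b2 b3) o.
Proof. exact: exists_generic_apex facesP. Qed.

Let UV_neq0 (U V : R) : U ^+ 2 + V ^+ 2 = 1 -> (U != 0) || (V != 0).
Proof.
move=> e; rewrite -negb_and; apply/negP => /andP[/eqP u /eqP v].
by move: e; rewrite u v => /eqP; rewrite expr0n addr0 eq_sym oner_eq0.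
Qed.

Let planeP w : [\/ w = a2, w = b2, w = a3 | w = b3] ->
  exists v, \det (tet v a1 b1 w) != 0.
Proof.
by case=> ->; apply: plane_witness; rewrite ?sN0 ?oppr_eq0 ?sN0//; exact: UV_neq0.
Qed.

Section apex.
Variable o : 'rV[R]_4.
Hypothesis ho : forall x y z,
  \det (tet o (vtx x a1 b1) (vtx y a2 b2) (vtx z a3 b3)) != 0.

Let boundary_regular (U V t : R) (oo : 'rV[R]_4) (u2 := vec4 0 0 U V) (u3 := vec4 c 0 t 0) :
  V != 0 -> t != 0 -> \det (tet oo a1 u2 u3) != 0 -> \det (tet oo b1 u2 u3) != 0 ->
  \det (tet oo a1 b1 u2) != 0 -> \det (tet oo a1 b1 u3) != 0 ->
  eq_mod_2pi2 (orv_boundary oo a1 b1 u2 u3) 0.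
Proof.
move=> V0 t0 d1 d2 d3 d4; apply: orv_boundary_generic => //.
rewrite det_tet [X in X != 0](_ : _ = - (D * V * t)); last by rewrite /D; ring.
by rewrite oppr_eq0 !mulf_neq0.
Qed.

(** The cut along the diagonal after the change of apex. The two boundaries through a2 vanish modulo
    2π² because [V1 != 0]; those through b2 are kept, since [V2] may be 0. *)
Let reduction : exists oo, [/\
  \det (tet oo a1 b1 b2) != 0,
  (V2 != 0 -> eq_mod_2pi2 (orv_boundary oo a1 b1 b2 a3 - orv_boundary oo a1 b1 b2 b3) 0) &
  eq_mod_2pi2 (oct a1 b1 a2 b2 a3 b3 o -
    (Num.sg D * (pi / 2) * (Num.sg V1 * A1) + (orv a1 b1 b2 a3 - orv a1 b1 b2 b3)
     - (orv_boundary oo a1 b1 b2 a3 - orv_boundary oo a1 b1 b2 b3))) 0].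
Proof.
have [oo [e hoo hp]] := exists_second_apex facesP planeP ho.
have hpa2 : \det (tet oo a1 b1 a2) != 0 by apply: hp; constructor 1.
have hpb2 : \det (tet oo a1 b1 b2) != 0 by apply: hp; constructor 2.
have hpa3 : \det (tet oo a1 b1 a3) != 0 by apply: hp; constructor 3.
have hpb3 : \det (tet oo a1 b1 b3) != 0 by apply: hp; constructor 4.
have msN0 : - s != 0 by rewrite oppr_eq0.
exists oo; split => //.
  move=> V20; apply: eq_mod0B; apply: boundary_regular => //.
  - exact: (hoo false true false).
  - exact: (hoo true true false).
  - exact: (hoo false true true).
  - exact: (hoo true true true).
have e1 : eq_mod_2pi2 (orv_boundary oo a1 b1 a2 a3) 0.
  apply: boundary_regular => //; [exact: (hoo false false false)|].
  exact: (hoo true false false).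
have e2 : eq_mod_2pi2 (orv_boundary oo a1 b1 a2 b3) 0.
  apply: boundary_regular => //; [exact: (hoo false false true)|].
  exact: (hoo true false true).
have lune1 : orv a1 b1 a2 a3 - orv a1 b1 a2 b3 = - (Num.sg D * Num.sg V1 * (pi / 2 * A1)).
  exact: orv_lune.
have cut := oct_cut a1 b1 a2 b2 a3 b3 oo.
rewrite lune1 in cut.
have := eq_mod0D e (eq_mod0B e1 e2); congr eq_mod_2pi2.
rewrite cut; ring.
Qed.

Lemma oct_regular : V2 != 0 -> eq_mod_2pi2 (oct a1 b1 a2 b2 a3 b3 o -
  Num.sg D * (pi / 2) * (Num.sg V1 * A1 - Num.sg V2 * A2)) 0.
Proof.
move=> V20; have [oo [_ /(_ V20) e1 e2]] := reduction.
have lune2 : orv a1 b1 b2 a3 - orv a1 b1 b2 b3 = - (Num.sg D * Num.sg V2 * (pi / 2 * A2)).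
  exact: orv_lune.
rewrite lune2 in e2.
have := eq_mod0B e2 e1; congr eq_mod_2pi2; ring.
Qed.

(** The tetrahedra with base a1 b1 b2 are degenerate, so A_2 is replaced by the boundaries through
    b2. When the points can surround the sphere, opposite signs of t U2 at t = s and t = -s make one
    boundary 0 and the other π² or -π². *)
Lemma oct_flat : V2 = 0 -> S2 != 0 ->
  (0 < S1 * S2 \/ 0 < D * S2 -> S1 != 0 -> eq_mod_2pi2 (oct a1 b1 a2 b2 a3 b3 o -
     Num.sg D * (pi / 2) * (Num.sg V1 * A1)) 0) /\
  (S1 * S2 < 0 -> D * S2 < 0 -> eq_mod_2pi2 (oct a1 b1 a2 b2 a3 b3 o -
     Num.sg D * (pi / 2) * (Num.sg V1 * A1) - pi ^+ 2) 0).
Proof.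
move=> V20 S20; have [oo [od _ e]] := reduction.
have orv0 t : orv a1 b1 b2 (vec4 c 0 t 0) = 0.
  rewrite orv.unlock tetrahedron_orvolE det_tet V20.
  by rewrite [X in Num.sg X](_ : _ = 0) ?sgr0 ?mul0r//; ring.
rewrite !orv0 subrr addr0 in e.
have U20 : U2 != 0 by have := UV_neq0 UV2; rewrite V20 eqxx orbF.
have od' : \det (tet oo (vec4 P1 S1 0 0) (vec4 P2 S2 0 0) (vec4 0 0 U2 0)) != 0.
  by have := od; rewrite /b2 V20.
have b2E : b2 = vec4 0 0 U2 0 by rewrite /b2 V20.
rewrite b2E in e.
have U2s : U2 * s != 0 by rewrite mulf_neq0.
split.
  move=> h S10.
  have zero t : t = s \/ t = - s ->
      orv_boundary oo a1 b1 (vec4 0 0 U2 0) (vec4 c 0 t 0) = 0.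
    move=> ht; case: h => h; first exact: flat_same_side.
    have [tU|tU|tU] := ltrgt0P (t * U2).
    - exact: flat_same_sign.
    - exact: flat_opposite.
    - move/eqP: tU; rewrite mulf_eq0 (negPf U20) orbF.
      by case: ht => ->; rewrite ?oppr_eq0 (negPf sN0).
  rewrite !zero ?subr0 in e; [|by right|by left].
  by rewrite b2E.
move=> h1 h2; rewrite b2E.
have Bs : exists X, (X = pi ^+ 2 \/ X = - pi ^+ 2) /\
    orv_boundary oo a1 b1 (vec4 0 0 U2 0) a3 -
    orv_boundary oo a1 b1 (vec4 0 0 U2 0) b3 = X.
  have [sU|sU|sU] := ltrgt0P (s * U2).
  - have e1 : orv_boundary oo a1 b1 (vec4 0 0 U2 0) a3 = 0 by exact: flat_same_sign.
    have [e2|e2] : orv_boundary oo a1 b1 (vec4 0 0 U2 0) b3 = pi ^+ 2 \/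
        orv_boundary oo a1 b1 (vec4 0 0 U2 0) b3 = - pi ^+ 2.
      by apply: flat_surround => //; rewrite mulNr oppr_lt0.
    + by exists (- pi ^+ 2); rewrite e1 e2 sub0r; split => //; right.
    + by exists (pi ^+ 2); rewrite e1 e2 sub0r opprK; split => //; left.
  - have e1 : orv_boundary oo a1 b1 (vec4 0 0 U2 0) b3 = 0.
      by apply: flat_same_sign => //; rewrite mulNr oppr_gt0.
    have e2 : orv_boundary oo a1 b1 (vec4 0 0 U2 0) a3 = pi ^+ 2 \/
        orv_boundary oo a1 b1 (vec4 0 0 U2 0) a3 = - pi ^+ 2.
      exact: flat_surround.
    by eexists; split; [exact: e2|rewrite e1 subr0].
  - by move/eqP: sU; rewrite mulf_eq0 (negPf U20) (negPf sN0).
have [X [hX BX]] := Bs; rewrite BX in e.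
(* The values π² and -π² differ by 2π², so the undetermined sign does not affect the class. *)
have X0 : eq_mod_2pi2 (- X - pi ^+ 2) 0.
  by case: hX => ->; [exists (-1)|exists 0]; ring.
have := eq_mod0D e X0; congr eq_mod_2pi2; ring.
Qed.

End apex.

End octahedron_volume.

(** * From the parameters p, q and theta to the signs of the determinants *)

Lemma angle_range (R : realType) (u v theta : R) :
  0 < `|u| < 1 -> 0 < `|v| < 1 -> asin `|u| <= theta <= acos `|v| ->
  [/\ 0 < sin theta, 0 < cos theta, u ^+ 2 <= sin theta ^+ 2 &
      v ^+ 2 <= cos theta ^+ 2].
Proof.
move=> /andP[u0 u1] /andP[v0 v1] /andP[ut tv].
have pp : 0 < pi :> R := pi_gt0 R.
have hu : -1 <= `|u| <= 1 by apply/andP; split; lra.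
have hv : -1 <= `|v| <= 1 by apply/andP; split; lra.
have au0 : 0 <= asin `|u|.
  rewrite leNgt; apply/negP => h.
  have : sin (asin `|u|) < sin 0.
    by rewrite ltr_sin// in_itv/= ?asin_geNpi2 ?asin_lepi2//; apply/andP; split; lra.
  by rewrite asinK ?in_itv// sin0; lra.
have av : acos `|v| <= pi / 2.
  rewrite leNgt; apply/negP => h.
  have : cos (acos `|v|) < cos (pi / 2).
    by rewrite ltr_cos// in_itv/= ?acos_ge0 ?acos_lepi//; apply/andP; split; lra.
  by rewrite acosK ?in_itv// cos_pihalf; lra.
have av0 : 0 <= acos `|v| by exact: acos_ge0.
have sle : `|u| <= sin theta.
  have <- : sin (asin `|u|) = `|u| by rewrite asinK// in_itv.
  rewrite leNgt ltr_sin ?in_itv/= -?leNgt//; apply/andP; split; lra.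
have cle : `|v| <= cos theta.
  have <- : cos (acos `|v|) = `|v| by rewrite acosK// in_itv.
  rewrite leNgt ltr_cos ?in_itv/= -?leNgt//; apply/andP; split; lra.
split; [lra|lra| |].
- by rewrite -(real_normK (num_real u)) lerXn2r// nnegrE; lra.
- by rewrite -(real_normK (num_real v)) lerXn2r// nnegrE; lra.
Qed.

Section main.
Variables (R : realType) (p1 p2 q1 q2 : R).
Hypothesis hp : `|p1| < `|p2|.
Hypothesis hq : `|q1| < `|q2|.
Hypothesis hpq : p2 ^+ 2 + q2 ^+ 2 < 1.
Variables d1 d2 e1 e2 theta : R.
Hypothesis d1E : d1 \in [:: -1; 1].
Hypothesis d2E : d2 \in [:: -1; 1].
Hypothesis e1E : e1 \in [:: -1; 1].
Hypothesis e2E : e2 \in [:: -1; 1].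
Hypothesis thetaE : asin `|q2| <= theta <= acos `|p2|.

Let c := cos theta.
Let s := sin theta.
Let P1 := p1 / c.
Let S1 := d1 * Num.sqrt (1 - p1 ^+ 2 / c ^+ 2).
Let P2 := p2 / c.
Let S2 := d2 * Num.sqrt (1 - p2 ^+ 2 / c ^+ 2).
Let U1 := q1 / s.
Let V1 := e1 * Num.sqrt (1 - q1 ^+ 2 / s ^+ 2).
Let U2 := q2 / s.
Let V2 := e2 * Num.sqrt (1 - q2 ^+ 2 / s ^+ 2).
Let D := P1 * S2 - S1 * P2.
Let y := P1 * P2 + S1 * S2.

Let sp : p1 ^+ 2 < p2 ^+ 2.
Proof. exact: ltr_sqr_norm. Qed.

Let sq : q1 ^+ 2 < q2 ^+ 2.
Proof. exact: ltr_sqr_norm. Qed.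

Let norm_range (x z : R) : `|z| < `|x| -> x ^+ 2 < 1 -> 0 < `|x| < 1.
Proof.
by move=> zx x1; rewrite (le_lt_trans _ zx)//= -(expr_lt1 (n := 2))// real_normK// num_real.
Qed.

Let range : [/\ 0 < s, 0 < c, q2 ^+ 2 <= s ^+ 2 & p2 ^+ 2 <= c ^+ 2].
Proof.
apply: angle_range => //.
- by apply: (norm_range hq); move: hpq (sqr_ge0 p2) => *; lra.
- by apply: (norm_range hp); move: hpq (sqr_ge0 q2) => *; lra.
Qed.

Let s0 : 0 < s. Proof. by case: range. Qed.
Let c0 : 0 < c. Proof. by case: range. Qed.
Let q2s : q2 ^+ 2 <= s ^+ 2. Proof. by case: range. Qed.
Let p2c : p2 ^+ 2 <= c ^+ 2. Proof. by case: range. Qed.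
Let sN0 : s != 0. Proof. by rewrite gt_eqF. Qed.
Let cN0 : c != 0. Proof. by rewrite gt_eqF. Qed.
Let cs : c ^+ 2 + s ^+ 2 = 1. Proof. exact: cos2Dsin2. Qed.

Let sgn_sqr (d : R) : d \in [:: -1; 1] -> d ^+ 2 = 1.
Proof. by rewrite !inE => /orP[]/eqP ->; rewrite ?sqrrN expr1n. Qed.

Let sgn_sg (d : R) : d \in [:: -1; 1] -> Num.sg d = d.
Proof. by rewrite !inE => /orP[]/eqP ->; rewrite ?sgrN sgr1. Qed.

Let frac_le1 (x k : R) : 0 < k -> x ^+ 2 <= k ^+ 2 -> 0 <= 1 - x ^+ 2 / k ^+ 2.
Proof. by move=> k0 xk; rewrite subr_ge0 ler_pdivrMr ?mul1r// exprn_gt0. Qed.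

Let frac_lt1 (x k : R) : 0 < k -> x ^+ 2 < k ^+ 2 -> 0 < 1 - x ^+ 2 / k ^+ 2.
Proof. by move=> k0 xk; rewrite subr_gt0 ltr_pdivrMr ?mul1r// exprn_gt0. Qed.

Let unit_pair (x k d : R) : 0 < k -> x ^+ 2 <= k ^+ 2 -> d \in [:: -1; 1] ->
  (x / k) ^+ 2 + (d * Num.sqrt (1 - x ^+ 2 / k ^+ 2)) ^+ 2 = 1.
Proof.
move=> k0 xk dE; rewrite [X in _ + X]exprMn (sgn_sqr dE) mul1r sqr_sqrtr ?frac_le1//.
by rewrite expr_div_n; ring.
Qed.

Let p1c : p1 ^+ 2 < c ^+ 2. Proof. exact: lt_le_trans sp p2c. Qed.
Let q1s : q1 ^+ 2 < s ^+ 2. Proof. exact: lt_le_trans sq q2s. Qed.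

Let PS1 : P1 ^+ 2 + S1 ^+ 2 = 1. Proof. by rewrite unit_pair// ltW. Qed.
Let PS2 : P2 ^+ 2 + S2 ^+ 2 = 1. Proof. by rewrite unit_pair. Qed.
Let UV1 : U1 ^+ 2 + V1 ^+ 2 = 1. Proof. by rewrite unit_pair// ltW. Qed.
Let UV2 : U2 ^+ 2 + V2 ^+ 2 = 1. Proof. by rewrite unit_pair. Qed.

Let P1c : P1 * c = p1. Proof. by rewrite divfK. Qed.
Let P2c : P2 * c = p2. Proof. by rewrite divfK. Qed.
Let U1s : U1 * s = q1. Proof. by rewrite divfK. Qed.
Let U2s : U2 * s = q2. Proof. by rewrite divfK. Qed.

Let sgV1 : Num.sg V1 = e1.
Proof. by rewrite sgrM (sgn_sg e1E) gtr0_sg ?mulr1// sqrtr_gt0 frac_lt1. Qed.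

Let sgS1 : Num.sg S1 = d1.
Proof. by rewrite sgrM (sgn_sg d1E) gtr0_sg ?mulr1// sqrtr_gt0 frac_lt1. Qed.

(** In [D = P1 * S2 - S1 * P2] the second term dominates: the difference of the squares (S1 P2)² -
    (P1 S2)² equals P2² - P1², which is positive. *)
Let sgD : Num.sg D = - (d1 * Num.sg p2).
Proof.
rewrite /D -opprB sgrN sgr_sub_lt.
  by rewrite sgrM sgS1 /P2 sgrM (gtr0_sg (x := c^-1)) ?mulr1// invr_gt0.
rewrite -ltr_sqr ?nnegrE// !real_normK ?num_real// -subr_gt0.
rewrite [ltRHS](_ : _ = P2 ^+ 2 - P1 ^+ 2).
  by rewrite /P1 /P2 !expr_div_n -mulrBl divr_gt0 ?subr_gt0// exprn_gt0.
have -> : P2 ^+ 2 - P1 ^+ 2 = P2 ^+ 2 * (P1 ^+ 2 + S1 ^+ 2) - P1 ^+ 2 * (P2 ^+ 2 + S2 ^+ 2).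
  by rewrite PS1 PS2 !mulr1.
by ring.
Qed.

Let p2N0 : p2 != 0. Proof. by rewrite -normr_gt0; apply: le_lt_trans hp. Qed.

Let dN0 (d : R) : d \in [:: -1; 1] -> d != 0.
Proof. by rewrite !inE => /orP[]/eqP ->; rewrite ?oppr_eq0 oner_eq0. Qed.

Let D0 : D != 0.
Proof. by rewrite -sgr_eq0 sgD oppr_eq0 mulf_eq0 sgr_eq0 negb_or p2N0 andbT dN0. Qed.

Let V10 : V1 != 0. Proof. by rewrite -sgr_eq0 sgV1 dN0. Qed.

Let q11 : 0 < 1 - (U1 * s) ^+ 2 - (P1 * c) ^+ 2.
Proof. by rewrite U1s P1c; move: sp sq hpq => *; lra. Qed.
Let q12 : 0 < 1 - (U1 * s) ^+ 2 - (P2 * c) ^+ 2.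
Proof. by rewrite U1s P2c; move: sp sq hpq => *; lra. Qed.
Let q21 : 0 < 1 - (U2 * s) ^+ 2 - (P1 * c) ^+ 2.
Proof. by rewrite U2s P1c; move: sp sq hpq => *; lra. Qed.
Let q22 : 0 < 1 - (U2 * s) ^+ 2 - (P2 * c) ^+ 2.
Proof. by rewrite U2s P2c; move: sp sq hpq => *; lra. Qed.

(* The position theta = arcsin |q2|, where b2 = (0, 0, 1, 0) or (0, 0, -1, 0). *)
Section flat_position.
Hypothesis q2sE : q2 ^+ 2 = s ^+ 2.

Let c2 : c ^+ 2 = 1 - q2 ^+ 2. Proof. by rewrite q2sE -cs; ring. Qed.

Let V20 : V2 = 0.
Proof. by rewrite /V2 q2sE divff ?subrr ?sqrtr0 ?mulr0// sqrf_eq0. Qed.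

Let p2c' : p2 ^+ 2 < c ^+ 2. Proof. by rewrite c2; move: hpq => *; lra. Qed.

Let sgS2 : Num.sg S2 = d2.
Proof. by rewrite sgrM (sgn_sg d2E) gtr0_sg ?mulr1// sqrtr_gt0 frac_lt1. Qed.

Let sqrtE : Num.sqrt (1 - p1 ^+ 2 / c ^+ 2) * Num.sqrt (1 - p2 ^+ 2 / c ^+ 2) =
  Num.sqrt ((1 - q2 ^+ 2 - p1 ^+ 2) * (1 - q2 ^+ 2 - p2 ^+ 2)) / (1 - q2 ^+ 2).
Proof.
rewrite -sqrtrM ?frac_le1 ?ltW//.
have -> : (1 - p1 ^+ 2 / c ^+ 2) * (1 - p2 ^+ 2 / c ^+ 2) =
    (1 - q2 ^+ 2 - p1 ^+ 2) * (1 - q2 ^+ 2 - p2 ^+ 2) * ((c ^+ 2)^-1) ^+ 2.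
  by rewrite -c2; field.
rewrite sqrtrM; last by rewrite -c2 mulr_ge0// subr_ge0 ltW.
by rewrite sqrtr_sqr ger0_norm ?invr_ge0 ?sqr_ge0// c2.
Qed.

(** In the flat position [y] is an end of its range: y_max if d1 d2 = 1 and y_min if d1 d2 = -1. *)
Let yE : y = (p1 * p2 + d1 * d2 *
  Num.sqrt ((1 - q2 ^+ 2 - p1 ^+ 2) * (1 - q2 ^+ 2 - p2 ^+ 2))) / (1 - q2 ^+ 2).
Proof.
rewrite /y (_ : S1 * S2 = d1 * d2 * (Num.sqrt ((1 - q2 ^+ 2 - p1 ^+ 2) *
  (1 - q2 ^+ 2 - p2 ^+ 2)) / (1 - q2 ^+ 2))); last by rewrite -sqrtE /S1 /S2 mulrACA.
by rewrite /P1 /P2 -c2; field.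
Qed.

Let flat_value : (d1 * d2 = 1 /\ Afun p1 p2 q2 y = 0) \/
  (d1 * d2 = -1 /\ Afun p1 p2 q2 y = (1 - Num.sg p2) * pi).
Proof.
have [e|e] : d1 * d2 = 1 \/ d1 * d2 = -1.
  move: d1E d2E; rewrite !inE => /orP[]/eqP -> /orP[]/eqP ->;
  rewrite ?mulN1r ?mul1r ?opprK; by [left|right].
- left; split => //; rewrite yE e mul1r; exact: Afun2_ymax.
- right; split => //; rewrite yE e mulN1r; exact: Afun2_ymin.
Qed.

(** The cases of [oct_flat] match the values of A_2: it is 0 for d1 d2 = 1, and for d1 d2 = -1 with
    p2 > 0. For d1 d2 = -1 and p2 < 0 the four points surround the great sphere and A_2 = 2π. *)
Lemma flat_position_volume o :
  (forall u v w, \det (tet o (vtx u (vec4 P1 S1 0 0) (vec4 P2 S2 0 0))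
     (vtx v (vec4 0 0 U1 V1) (vec4 0 0 U2 V2))
     (vtx w (vec4 c 0 s 0) (vec4 c 0 (- s) 0))) != 0) ->
  eq_mod_2pi2 (oct (vec4 P1 S1 0 0) (vec4 P2 S2 0 0) (vec4 0 0 U1 V1) (vec4 0 0 U2 V2)
    (vec4 c 0 s 0) (vec4 c 0 (- s) 0) o -
    Num.sg D * (pi / 2) * (e1 * Afun p1 p2 q1 y - e2 * Afun p1 p2 q2 y)) 0.
Proof.
move=> ho.
have S2N : S2 != 0 by rewrite -sgr_eq0 sgS2 dN0.
have S1N : S1 != 0 by rewrite -sgr_eq0 sgS1 dN0.
have [h1 h2] := oct_flat PS1 PS2 UV1 UV2 cs c0 s0 D0 V10 q11 q12 q21 q22 ho V20 S2N.
rewrite P1c P2c U1s sgV1 -/y -/D in h1 h2.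
have sgDS : Num.sg (D * S2) = - (d1 * d2 * Num.sg p2) by rewrite sgrM sgD sgS2; ring.
have sgSS : Num.sg (S1 * S2) = d1 * d2 by rewrite sgrM sgS1 sgS2.
have [[dd A0]|[dd AE]] := flat_value.
  rewrite A0 mulr0 subr0; apply: h1 => //; left.
  by rewrite -sgr_gt0 sgSS dd.
have [p20|p20|/eqP] := ltrgt0P p2; last by rewrite (negPf p2N0).
  rewrite AE (gtr0_sg p20) subrr mul0r mulr0 subr0; apply: h1 => //; right.
  by rewrite -sgr_gt0 sgDS dd (gtr0_sg p20) mulr1 opprK.
(* With A_2 = 2π and the sign of [D] equal to d1, this is π²(1 + d1 e2), either 0 or 2π²: the
   half-sphere accounts for the A_2 term. *)
have k : eq_mod_2pi2 (pi ^+ 2 + Num.sg D * (pi / 2) * (e2 * Afun p1 p2 q2 y)) 0.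
  rewrite AE sgD (ltr0_sg p20).
  have : d1 * e2 \in [:: -1; 1].
    move: d1E e2E; rewrite !inE => /orP[]/eqP -> /orP[]/eqP ->;
    by rewrite ?mulN1r ?mul1r ?opprK eqxx ?orbT.
  rewrite !inE => /orP[]/eqP de; [exists 0|exists 1].
    transitivity (pi ^+ 2 * (1 + d1 * e2)); first by field.
    by rewrite de addrN mulr0 mul0r.
  transitivity (pi ^+ 2 * (1 + d1 * e2)); first by field.
  by rewrite de mul1r; ring.
have := eq_mod0D (h2 _ _) k; rewrite -sgr_lt0 sgSS dd ltrN10 => /(_ isT).
rewrite -sgr_lt0 sgDS dd (ltr0_sg p20) mulrNN mulr1 ltrN10 => /(_ isT).
by congr eq_mod_2pi2; ring.
Qed.

End flat_position.

Lemma octahedron_orvolP :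
  is_octahedron_orvol
    (triple (vec4 P1 S1 0 0) (vec4 0 0 U1 V1) (vec4 c 0 s 0))
    (triple (vec4 P2 S2 0 0) (vec4 0 0 U2 V2) (vec4 c 0 (- s) 0))
    (- (d1 * Num.sg p2 * pi / 2
        * (e1 * Afun p1 p2 q1 y - e2 * Afun p1 p2 q2 y))).
Proof.
split; first exact: (octahedron_generic_apex PS1 PS2 UV1 UV2 cs c0 s0).
move=> o /generic_apexE[so ho]; rewrite octahedron_orvol_fromE.
suff [k hk] : eq_mod_2pi2 (oct (vec4 P1 S1 0 0) (vec4 P2 S2 0 0)
    (vec4 0 0 U1 V1) (vec4 0 0 U2 V2) (vec4 c 0 s 0) (vec4 c 0 (- s) 0) o -
    Num.sg D * (pi / 2) * (e1 * Afun p1 p2 q1 y - e2 * Afun p1 p2 q2 y)) 0.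
  by exists k; rewrite -hk subr0 sgD; congr (_ - _); ring.
have [q2sE|q2sN] := eqVneq (q2 ^+ 2) (s ^+ 2); first exact: flat_position_volume.
have q2s' : q2 ^+ 2 < s ^+ 2 by rewrite lt_neqAle q2sN q2s.
have sgV2 : Num.sg V2 = e2.
  by rewrite sgrM (sgn_sg e2E) gtr0_sg ?mulr1// sqrtr_gt0 frac_lt1.
have V20 : V2 != 0 by rewrite -sgr_eq0 sgV2 dN0.
have := oct_regular PS1 PS2 UV1 UV2 cs c0 s0 D0 V10 q11 q12 q21 q22 ho V20.
by rewrite P1c P2c U1s U2s sgV1 sgV2.
Qed.

End main.

Theorem proposition6p2 (R : realType) (p1 p2 q1 q2 : R)
    (hp : `|p1| < `|p2|) (hq : `|q1| < `|q2|)
    (hpq : p2 ^+ 2 + q2 ^+ 2 < 1) :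
  (forall d1 d2 e1 e2 theta : R,
     d1 \in [:: -1; 1] -> d2 \in [:: -1; 1] ->
     e1 \in [:: -1; 1] -> e2 \in [:: -1; 1] ->
     asin `|q2| <= theta <= acos `|p2| ->
     let a1 := vec4 (p1 / cos theta)
                    (d1 * Num.sqrt (1 - p1 ^+ 2 / cos theta ^+ 2)) 0 0 in
     let b1 := vec4 (p2 / cos theta)
                    (d2 * Num.sqrt (1 - p2 ^+ 2 / cos theta ^+ 2)) 0 0 in
     let a2 := vec4 0 0 (q1 / sin theta)
                    (e1 * Num.sqrt (1 - q1 ^+ 2 / sin theta ^+ 2)) in
     let b2 := vec4 0 0 (q2 / sin theta)
                    (e2 * Num.sqrt (1 - q2 ^+ 2 / sin theta ^+ 2)) in
     let a3 := vec4 (cos theta) 0 (sin theta) 0 in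
     let b3 := vec4 (cos theta) 0 (- sin theta) 0 in
     let y := dotv a1 b1 in
     is_octahedron_orvol (triple a1 a2 a3) (triple b1 b2 b3)
       (- (d1 * Num.sg p2 * pi / 2
           * (e1 * Afun p1 p2 q1 y - e2 * Afun p1 p2 q2 y)))) /\
  (forall y : R, ymin p1 p2 q2 <= y <= ymax p1 p2 q2 ->
     0 < Afun p1 p2 q1 y < 2 * pi) /\
  (forall y : R, ymin p1 p2 q2 < y < ymax p1 p2 q2 ->
     0 < Afun p1 p2 q2 y < 2 * pi) /\
  Afun p1 p2 q2 (ymax p1 p2 q2) = 0 /\
  (0 < p2 -> Afun p1 p2 q2 (ymin p1 p2 q2) = 0) /\
  (p2 < 0 -> Afun p1 p2 q2 (ymin p1 p2 q2) = 2 * pi).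
Proof.
split.
  move=> d1 d2 e1 e2 theta d1E d2E e1E e2E thetaE a1 b1 a2 b2 a3 b3 y.
  rewrite (_ : y = p1 / cos theta * (p2 / cos theta) +
      d1 * Num.sqrt (1 - p1 ^+ 2 / cos theta ^+ 2) *
      (d2 * Num.sqrt (1 - p2 ^+ 2 / cos theta ^+ 2))).
    exact: octahedron_orvolP.
  by rewrite /y /dotv sum_ord4 !mxE /= !mulr0 !addr0.
split; first by move=> y; exact: Afun1_bounds.
split; first by move=> y; exact: Afun2_bounds.
split; first exact: Afun2_ymax.
rewrite Afun2_ymin//; split => p20; first by rewrite gtr0_sg// subrr mul0r.
by rewrite ltr0_sg// opprK.
Qed.
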